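(* Let $\mathbb B$ be the closed unit disk of $\mathbb R^2\simeq\mathbb C$, $\mathbb S^1=\partial\mathbb B$, and let $\boldsymbol\mu_s:\mathbb S^1\to\mathcal P(\mathbb B)$ be the complex square root, $\boldsymbol\mu_s(\xi):=\frac12\sum_{z^2=\xi}\delta_z$. Let $\boldsymbol\mu\in H^1(\mathbb B,\mathcal P(\mathbb B))$ be such that $\boldsymbol\mu|_{\partial\mathbb B}=\boldsymbol\mu_s$. Then $\boldsymbol\mu$ does not admit a superposition principle.
   Context: Here the source domain is $\Omega=\mathbb B$ and the target is built on $D=\mathbb B$, so $p=q=2$. $\mathcal P(D)$ is the set of Borel probability measures on $D$ with the quadratic Wasserstein distance $W_2$. $L^2(\Omega,\mathcal P(D))$ is the set of measurable maps $\boldsymbol\mu:\Omega\to\mathcal P(D)$ modulo a.e. equality; such a $\boldsymbol\mu$ is identified with the measure $\boldsymbol\mu(\mathrm d\xi,\mathrm dx)=\boldsymbol\mu(\xi,\mathrm dx)\,\mathrm d\xi$ on $\Omega\times D$. Dirichlet energy. $\nabla_\Omega\cdot$ is the divergence in $\xi\in\Omega$, $\nabla_D$ the gradient in $x\in D$; for $\varphi$ valued in $\mathbb R^p$, $(\nabla_D\varphi)^{\alpha i}=\partial_{x_i}\varphi^\alpha$. For a finite vector measure $\mathbf E\in\mathcal M(\Omega\times D,\mathbb R^{pq})$, $(\boldsymbol\mu,\mathbf E)$ satisfies the continuity equation if $\iint\nabla_\Omega\cdot\varphi\,\mathrm d\boldsymbol\mu+\iint\nabla_D\varphi\cdot\mathrm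 d\mathbf E=0$ for all $\varphi\in C^1(\Omega\times D,\mathbb R^p)$ whose support is contained in $X\times D$ for some compact $X\subset\mathring\Omega$ (no support condition in $D$). In that case $\mathrm{Dir}(\boldsymbol\mu,\mathbf E):=\sup\{\iint a\,\mathrm d\boldsymbol\mu+\iint b\cdot\mathrm d\mathbf E:\ (a,b)\in C(\Omega\times D,\mathbb R\times\mathbb R^{pq}),\ a+\frac12|b|^2\le0\}$ (which, when finite, equals $\iint\frac12|\mathbf v|^2\mathrm d\boldsymbol\mu$ with $\mathbf E=\mathbf v\boldsymbol\mu$). $\mathrm{Dir}(\boldsymbol\mu)$ is the infimum of $\mathrm{Dir}(\boldsymbol\mu,\mathbf E)$ over all $\mathbf E$ such that $(\boldsymbol\mu,\mathbf E)$ satisfies the continuity equation ($+\infty$ if there is none), and $H^1(\Omega,\mathcal P(D))=\{\mathrm{Dir}<+\infty\}$. Boundary values. For $\boldsymbol\mu\in H^1(\Omega,\mathcal P(D))$ and $\varphi\in C^1(\Omega\times D,\mathbb R^p)$, $\mathrm{BT}_{\boldsymbol\mu}(\varphi):=\iint\nabla_\Omega\cdot\varphi\,\mathrm d\boldsymbol\mu+\iint\nabla_D\varphi\cdot\mathrm d\mathbf E$ for any $\mathbf E$ with $(\boldsymbol\mu,\mathbf E)$ satisfying the continuity equation and $\mathrm{Dir}(\boldsymbol\mu,\mathbf E)<+\infty$ (independent of $\mathbf E$). $\boldsymbol\mu|_{\partial\mathbb B}=\boldsymbol\mu_s$ means $\mathrm{BT}_{\boldsymbol\mu}(\varphi)=\int_{\partial\mathbb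 B}\big(\int_D\varphi(\xi,x)\cdot\xi\,\boldsymbol\mu_s(\xi,\mathrm dx)\big)\sigma(\mathrm d\xi)$ for all $\varphi\in C^1(\Omega\times D,\mathbb R^p)$, $\sigma$ being the arc-length measure (the outward normal at $\xi$ is $\xi$). Superposition principle. Let $\mathcal F:=L^2(\Omega,D)$, and for $f\in\mathcal F$ let $\mathrm{Dir}_c(f):=\int_\Omega\frac12|\nabla f|^2$ if $f\in H^1(\Omega,D)$ and $+\infty$ otherwise. $\boldsymbol\mu\in H^1(\Omega,\mathcal P(D))$ admits a superposition principle if there is a Borel probability measure $Q$ on $\mathcal F$ such that (i) for all $a\in C(\Omega\times D)$, $\iint_{\Omega\times D}a\,\mathrm d\boldsymbol\mu=\int_{\mathcal F}\big(\int_\Omega a(\xi,f(\xi))\,\mathrm d\xi\big)Q(\mathrm df)$; and (ii) $\int_{\mathcal F}\mathrm{Dir}_c(f)\,Q(\mathrm df)\le\mathrm{Dir}(\boldsymbol\mu)$. *)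

(* Defs.v *)
From HB Require Import structures.
From mathcomp Require Import all_boot all_order all_algebra.
From mathcomp Require Import all_classical all_reals all_analysis.
From mathcomp Require Import measurable_realfun ring lra.

Set Implicit Arguments.
Unset Strict Implicit.
Unset Printing Implicit Defensive.
Import Order.TTheory GRing.Theory Num.Theory.
Import numFieldNormedType.Exports.
Local Open Scope classical_set_scope.
Local Open Scope ring_scope.

(* [measurableTypeR R] is [R] with the Borel sigma-algebra carried by
   [lebesgue_measure].  The library norm of a product is the sup norm; it only
   serves for the topology and differentiability, Euclidean quantities being
   written with [sqnorm]. *)
Notation plane R := (measurableTypeR R * measurableTypeR R)%type.
Notation plane2 R := (plane R * plane R)%type.

Section Plane.
Context {R : realType}.
Implicit Types x y : plane R.

Definition coord (i : 'I_2) x : R := if i == ord0 then x.1 else x.2.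

Definition basis (i : 'I_2) : plane R := if i == ord0 then (1, 0) else (0, 1).

Definition sqnorm x : R := \sum_(i < 2) coord i x ^+ 2.

Definition disk : set (plane R) := [set x | sqnorm x <= 1].

Definition lebesgue2 : {measure set (plane R) -> \bar R} :=
  (@lebesgue_measure R \x @lebesgue_measure R)%E.

Lemma sqnormE x : sqnorm x = x.1 ^+ 2 + x.2 ^+ 2.
Proof. by rewrite /sqnorm big_ord_recl big_ord1. Qed.

Lemma measurable_disk : measurable disk.
Proof.
have -> : disk = (fun x : plane R => x.1 ^+ 2 + x.2 ^+ 2) @^-1` `]-oo, 1].
  by apply/seteqP; split => x; rewrite /disk/= sqnormE in_itv.
rewrite -[X in measurable X]setTI.
apply: (_ : measurable_fun setT (fun x : plane R => x.1 ^+ 2 + x.2 ^+ 2 : R)) => //.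
by apply: measurable_funD; apply: measurable_funX.
Qed.

End Plane.
Arguments disk {R}.
Arguments lebesgue2 {R}.

(* The subsets of [T] whose trace on [X] is open for the metric [d] on [X]. *)
Definition metric_open (R : realType) (T : Type) (X : set T) (d : T -> T -> R) :
    set (set T) :=
  [set U | forall x, X x -> U x ->
    exists2 e : R, 0 < e & forall y, X y -> d x y < e -> U y].

(* C^1(K) for K = disk or disk x disk is taken to be the set of restrictions to
   K of C^1 functions on the whole space. *)
Definition C1 (R : realType) (V : normedModType R) (f : V -> R) : Prop :=
  (forall z, differentiable f z) /\ (forall v, continuous (fun z => 'D_v f z)).

(* Integration against a signed measure, through its Jordan decomposition. *)
Section ChargeIntegral.
Context d (T : measurableType d) (R : realType).
Variable nu : {charge set T -> \bar R}.

Let exP := cid (Hahn_decomposition nu).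
Let exN := cid (projT2 exP).

Definition charge_int (A : set T) (f : T -> R) : R :=
  \int[jordan_pos (projT2 exN)]_(z in A) f z -
  \int[jordan_neg (projT2 exN)]_(z in A) f z.

End ChargeIntegral.

Section Wasserstein.
Context {R : realType}.
Implicit Types nu : probability (plane R) R.

Definition coupling nu1 nu2 : set (probability (plane2 R) R) :=
  [set g | forall A : set (plane R), measurable A ->
    g (A `*` setT) = nu1 A /\ g (setT `*` A) = nu2 A].

Definition W2 nu1 nu2 : R :=
  Num.sqrt (fine (ereal_inf
    [set (\int[g]_(z in setT) (sqnorm (z.1 - z.2))%:E)%E | g in coupling nu1 nu2])).

(* Probability measures on the disk are the probability measures on the plane
   giving mass 1 to it. *)
Definition Pdisk : set (probability (plane R) R) := [set nu | nu disk = 1%E].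

Definition W2_open : set (set (probability (plane R) R)) := metric_open Pdisk W2.

(* Values of [mu] outside the disk are irrelevant. *)
Definition L2_Pdisk (mu : plane R -> probability (plane R) R) : Prop :=
  (forall xi, disk xi -> Pdisk (mu xi)) /\
  measurable_fun disk (mu : plane R -> g_sigma_algebraType W2_open).

End Wasserstein.

Section DirichletEnergy.
Context {R : realType}.
Variable mu : plane R -> probability (plane R) R.
Implicit Types (a : plane2 R -> R) (b : 'I_2 -> 'I_2 -> plane2 R -> R).
Implicit Types (phi : 'I_2 -> plane2 R -> R).
Implicit Types (E : 'I_2 -> 'I_2 -> {charge set (plane2 R) -> \bar R}).

Definition int_mu a : R :=
  \int[lebesgue2]_(xi in disk) \int[mu xi]_(x in disk) a (xi, x).

Definition int_E E b : R :=
  \sum_(alpha < 2) \sum_(i < 2)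
    charge_int (E alpha i) (disk `*` disk) (b alpha i).

Definition div_src phi (z : plane2 R) : R :=
  \sum_(alpha < 2) 'D_((basis alpha, 0) : plane2 R) (phi alpha) z.

Definition grad_tgt phi (alpha i : 'I_2) (z : plane2 R) : R :=
  'D_((0, basis i) : plane2 R) (phi alpha) z.

Definition compact_support_src phi : Prop :=
  exists X : set (plane R), [/\ compact X, X `<=` disk^° &
    forall xi x alpha, disk xi -> disk x -> ~ X xi -> phi alpha (xi, x) = 0].

Definition weak_div phi E : R := int_mu (div_src phi) + int_E E (grad_tgt phi).

Definition continuity_equation E : Prop :=
  forall phi, (forall alpha, C1 (phi alpha)) -> compact_support_src phi ->
    weak_div phi E = 0.

Definition Dir_pair E : \bar R :=
  ereal_sup [set y | exists a b,
    [/\ {within disk `*` disk, continuous a},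
        (forall alpha i, {within disk `*` disk, continuous (b alpha i)}),
        (forall z, (disk `*` disk) z ->
          a z + 2^-1 * (\sum_(alpha < 2) \sum_(i < 2) b alpha i z ^+ 2) <= 0) &
        y = (int_mu a + int_E E b)%:E]].

Definition Dir : \bar R :=
  ereal_inf [set Dir_pair E | E in [set E | continuity_equation E]].

Definition H1_Pdisk : Prop := L2_Pdisk mu /\ (Dir < +oo)%E.

(* All admissible [E] give the same value, so the choice made by [xget] is
   immaterial; the default is only used when [mu] is not in H^1. *)
Definition BT phi : R :=
  xget 0 [set r | exists E,
    [/\ continuity_equation E, (Dir_pair E < +oo)%E & r = weak_div phi E]].

(* The unit circle is parametrised by arc length. *)
Definition boundary_values (mub : plane R -> {measure set (plane R) -> \bar R}) : Prop :=
  forall phi, (forall alpha, C1 (phi alpha)) ->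
    BT phi = \int[@lebesgue_measure R]_(t in `[0, 2 * pi])
      (let xi : plane R := (cos t, sin t) in
       \int[mub xi]_(x in disk) \sum_(alpha < 2) phi alpha (xi, x) * coord alpha xi).

End DirichletEnergy.

Section L2maps.
Context {R : realType}.

Definition lebesgue_disk : {measure set (plane R) -> \bar R} :=
  mrestr lebesgue2 measurable_disk.

Definition disk_valued (f : {mfun_ lebesgue_disk, plane R >-> plane R}) : bool :=
  `[< \forall xi \ae lebesgue_disk, disk (f xi) >].

Definition L2_disk : Type := {f | disk_valued f}.

HB.instance Definition _ := [Choice of L2_disk by <:].

Definition L2_fun (f : L2_disk) : plane R -> plane R := val f.

Definition L2_dist (f g : L2_disk) : R :=
  Num.sqrt (\int[lebesgue2]_(xi in disk) sqnorm (L2_fun f xi - L2_fun g xi)).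

Definition L2_open : set (set L2_disk) := metric_open setT L2_dist.

Let zero_class : {mfun_ lebesgue_disk, plane R >-> plane R} :=
  \pi_({mfun_ lebesgue_disk, plane R >-> plane R})%qT (cst 0).

Let zero_disk_valued : disk_valued zero_class.
Proof.
apply/asboolP.
have : (repr zero_class == cst 0 %[mod {mfun_ lebesgue_disk, plane R >-> plane R}])%qT.
  by rewrite reprK.
rewrite eqmodE => /asboolP.
apply: filterS => xi /(_ I) /= h; rewrite /aqEqMfun_to_fun h.
by rewrite /disk/= sqnormE/= expr0n addr0.
Qed.

HB.instance Definition _ :=
  isPointed.Build L2_disk (exist _ zero_class zero_disk_valued).

End L2maps.

Section ClassicalDirichlet.
Context {R : realType}.
Implicit Types (f : plane R -> plane R) (g : 'I_2 -> 'I_2 -> plane R -> R).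

Definition test_function (psi : plane R -> R) : Prop :=
  C1 psi /\ exists X : set (plane R),
    [/\ compact X, X `<=` disk^° & forall xi, ~ X xi -> psi xi = 0].

(* [g alpha i] is the weak derivative of the [i]-th component of [f] with
   respect to the [alpha]-th variable. *)
Definition weak_gradient f g : Prop :=
  (forall alpha i, measurable_fun disk (g alpha i) /\
     (\int[lebesgue2]_(xi in disk) (g alpha i xi ^+ 2)%:E < +oo)%E) /\
  (forall alpha i psi, test_function psi ->
     \int[lebesgue2]_(xi in disk) (coord i (f xi) * 'D_(basis alpha : plane R) psi xi) =
     - \int[lebesgue2]_(xi in disk) (g alpha i xi * psi xi)).

Definition in_H1 f : Prop := exists g, weak_gradient f g.

(* The weak gradient is unique up to a null set; the default is only used when
   [f] is not in H^1. *)
Definition grad f : 'I_2 -> 'I_2 -> plane R -> R :=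
  xget (fun _ _ _ => 0) [set g | weak_gradient f g].

Definition Dir_c (f : @L2_disk R) : \bar R :=
  if `[< in_H1 (L2_fun f) >] then
    (\int[lebesgue2]_(xi in disk)
      (2^-1 * \sum_(alpha < 2) \sum_(i < 2) grad (L2_fun f) alpha i xi ^+ 2)%:E)%E
  else +oo%E.

Definition superposition (mu : plane R -> probability (plane R) R) : Prop :=
  exists Q : probability (g_sigma_algebraType (@L2_open R)) R,
    (forall a : plane2 R -> R, {within disk `*` disk, continuous a} ->
       int_mu mu a =
       \int[Q]_(f in setT) \int[lebesgue2]_(xi in disk) a (xi, L2_fun f xi)) /\
    (\int[Q]_(f in setT) Dir_c f <= Dir mu)%E.

End ClassicalDirichlet.

(* The complex square root, under the identification of (x, y) with x + iy. *)
Section SquareRoot.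
Context {R : realType}.
Implicit Types xi z w : plane R.

Definition csqr z : plane R := (z.1 ^+ 2 - z.2 ^+ 2, 2 * z.1 * z.2).

Definition sqroots xi : set (plane R) := [set z | csqr z = xi].

Definition mu_s xi (A : set (plane R)) : \bar R :=
  ((2^-1)%:E * \sum_(z \in sqroots xi) (\d_z A : \bar R))%E.

Lemma csqr_eq z w : csqr z = csqr w -> z = w \/ z = - w.
Proof.
case: z w => [x y] [u v] [] /= h1 h2.
have h : x ^+ 2 + y ^+ 2 = u ^+ 2 + v ^+ 2.
  apply/eqP; rewrite -(@eqrXn2 _ 2) ?addr_ge0 ?sqr_ge0//; apply/eqP.
  have -> : (x ^+ 2 + y ^+ 2) ^+ 2 = (x ^+ 2 - y ^+ 2) ^+ 2 + (2 * x * y) ^+ 2.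
    by ring.
  by rewrite h1 h2; ring.
have hx : x ^+ 2 = u ^+ 2 by lra.
have hy : y ^+ 2 = v ^+ 2 by lra.
have hxy : x * y = u * v by lra.
move/eqP: hx; rewrite eqf_sqr => /orP[] /eqP hx; subst x.
- have [u0|u0] := eqVneq u 0; last first.
    by left; congr pair; apply: (mulfI u0).
  move/eqP: hy; rewrite eqf_sqr => /orP[] /eqP hy; subst y; first by left.
  by right; rewrite u0; congr pair; rewrite oppr0.
- have [u0|u0] := eqVneq u 0; last first.
    right; congr pair; apply: (mulfI u0); apply: oppr_inj.
    by rewrite -mulNr hxy mulrN opprK.
  move/eqP: hy; rewrite eqf_sqr => /orP[] /eqP hy; subst y; last by right.
  by left; rewrite u0; congr pair; rewrite oppr0.
Qed.

Lemma finite_sqroots xi : finite_set (sqroots xi).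
Proof.
have [->//|/set0P[w hw]] := eqVneq (sqroots xi) set0.
apply: (@sub_finite_set _ _ [set w; - w]).
  by move=> z hz; apply: csqr_eq; rewrite hz hw.
by rewrite finite_setU; split; exact: finite_set1.
Qed.

Lemma mu_s_msum xi : mu_s xi =
  mscale (2^-1)%:nng (msum (fun k => @dirac _ (plane R)
    (nth 0 (finmap.enum_fset (fset_set (sqroots xi))) k) R)
    (size (finmap.enum_fset (fset_set (sqroots xi))))).
Proof.
apply/funext => A; rewrite /mu_s /mscale /msum/=.
congr *%E; rewrite fsbig_finite; last exact: finite_sqroots.
by rewrite (big_nth 0) big_mkord.
Qed.

Let mu_s0 xi : mu_s xi set0 = 0%E.
Proof. by rewrite mu_s_msum measure0. Qed.

Let mu_s_ge0 xi A : (0 <= mu_s xi A)%E.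
Proof. by rewrite mu_s_msum measure_ge0. Qed.

Let mu_s_sigma_additive xi : semi_sigma_additive (mu_s xi).
Proof. rewrite mu_s_msum; exact: measure_semi_sigma_additive. Qed.

HB.instance Definition _ xi := isMeasure.Build _ (plane R) R (mu_s xi)
  (mu_s0 xi) (mu_s_ge0 xi) (@mu_s_sigma_additive xi).

Lemma exists_sqroot xi : sqnorm xi = 1 -> exists z, csqr z = xi.
Proof.
rewrite sqnormE; case: xi => a b /= ab1.
have a1 : a ^+ 2 <= 1 by rewrite -ab1 lerDl sqr_ge0.
have [am ap] : -1 <= a /\ a <= 1.
  by apply/andP; rewrite -ler_norml -(@expr_le1 _ 2)// -normrX ger0_norm ?sqr_ge0.
pose x : R := Num.sqrt ((1 + a) / 2); pose y : R := Num.sqrt ((1 - a) / 2).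
have hx : x ^+ 2 = (1 + a) / 2 by rewrite sqr_sqrtr//; lra.
have hy : y ^+ 2 = (1 - a) / 2 by rewrite sqr_sqrtr//; lra.
have hxy : (2 * x * y) ^+ 2 = b ^+ 2.
  rewrite !exprMn hx hy; have -> : b ^+ 2 = 1 - a ^+ 2 by lra.
  by field.
move/eqP: hxy; rewrite eqf_sqr => /orP[] /eqP hxy.
- by exists (x, y); rewrite /csqr/= hxy hx hy; congr pair; field.
- exists (x, - y); rewrite /csqr/= sqrrN mulrN hxy opprK hx hy.
  by congr pair; field.
Qed.

(* On the unit circle, [mu_s] takes its values in P(disk). *)
Lemma mu_s_disk xi : sqnorm xi = 1 -> mu_s xi disk = 1%E /\ mu_s xi setT = 1%E.
Proof.
move=> xi1; have [z zxi] := exists_sqroot xi1.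
have z1 : sqnorm z = 1.
  have : sqnorm z ^+ 2 = 1 ^+ 2.
    rewrite expr1n -xi1 -zxi !sqnormE /csqr/=; ring.
  by move/eqP; rewrite eqrXn2// ?sqnormE ?addr_ge0 ?sqr_ge0// => /eqP.
have zNz : z != - z.
  apply/eqP => /(congr1 (fun w => sqnorm (z + w))); rewrite subrr !sqnormE/=.
  move: z1; rewrite sqnormE => z1; move: z.1 z.2 z1 => u v; nra.
have -> : mu_s xi = (fun A => (2^-1)%:E * ((\d_z A : \bar R) + \d_(- z)%R A))%E.
  apply/funext => A; rewrite /mu_s.
  have -> : sqroots xi = [set z] `|` [set - z].
    apply/seteqP; split=> w; rewrite /sqroots/=.
      by move=> wxi; apply: csqr_eq; rewrite wxi.
    by case=> ->//; rewrite -zxi /csqr/=; congr pair; ring.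
  rewrite fsbigU//=; first by rewrite !fsbig_set1.
  by move=> w [] /= -> /eqP; rewrite (negbTE zNz).
have dz : disk z by rewrite /disk/= z1.
have dNz : disk (- z) by rewrite /disk/= sqnormE/= !sqrrN -sqnormE z1.
rewrite !diracE !mem_set//= -EFinD -EFinM.
by split; congr EFin; field.
Qed.

End SquareRoot.

(* Main.v *)
Require Import Defs.
From HB Require Import structures.
From mathcomp Require Import all_boot all_order all_algebra.
From mathcomp Require Import all_classical all_reals all_analysis.
From mathcomp Require Import measurable_realfun ring lra.
(* A second time, so that [coord] is not the one of [vector]. *)
Require Import Defs.

(* Suppose that Q is a superposition of mu.  The field |xi|^(2N) |x^2 - xi|^2 xi vanishes on the
   support of the boundary value; using it as a test function in the boundary condition, the
   finiteness of Dir(mu) gives N^2 \iint |xi|^(2N) |x^2 - xi|^2 dmu -> 0.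

   On the other hand, let f be in H^1(B, B).  Average f over squares of size 1/N whose centre turns
   once around the circle at distance 1/N of the boundary.  Since e^(it/2) changes sign in one turn,
   the average is orthogonal to e^(it/2) for some t.  If f^2 is close to the identity on that
   square, then the component of f along e^(it/2) has modulus close to 1 but average 0, so that the
   Poincare inequality yields a constant c > 0, independent of f, with
     c <= N^2 \int |xi|^(2N) |f^2 - xi|^2 + \int |xi|^(2N) |grad f|^2.
   The last integral tends to 0.  By Markov's inequality Q-almost no f is in H^1, hence the integral
   of Dir_c with respect to Q is infinite. *)

Set Implicit Arguments.
Unset Strict Implicit.
Unset Printing Implicit Defensive.
Import Order.TTheory GRing.Theory Num.Theory.
Import numFieldNormedType.Exports.
Local Open Scope classical_set_scope.
Local Open Scope ring_scope.

(** * The Lebesgue measure of the plane *)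

Section leb2.
Context {R : realType}.
Local Notation mu := (@lebesgue_measure R).

(** The factor N^2 is a matter of scale: a square of side 1/N has area 1/N^2, whereas the Dirichlet
    integral is scale invariant in dimension two, so a map forced to vary by a fixed amount on such
    a square spends a fixed energy there. The weight |xi|^(2N) concentrates on the annulus of width
    1/N and takes the place of traces of Sobolev maps. On the side of mu, the divergence of the test
    field is about 2N times the weighted residual, and the square of its gradient in x is again
    controlled by the residual. Young's inequality absorbs that gradient; the error is o(1/N)
    because the dual problem defining Dir can be solved up to an arbitrarily small e. Three
    obstacles shape the rest. The limit for mu is an average over Q, whereas the N from which the
    lower bound holds depends on f, hence a countable union over thresholds. [BT] selects some
    admissible field, so the boundary condition can be exploited only once all admissible fields are
    known to agree. Finally, linearity and monotonicity of [int_mu] are obtained from its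
    representation by Q. *)

Lemma lebesgue2_rect (A B : set (measurableTypeR R)) : measurable A -> measurable B ->
  lebesgue2 (A `*` B) = (mu A * mu B)%E.
Proof. exact: product_measure1E. Qed.

(* [lebesgue2] carries no sigma-finite instance, which Fubini's theorem needs. *)
Definition leb2 : set (plane R) -> \bar R := lebesgue2.
HB.instance Definition _ := Measure.on leb2.

Let leb2_sigma_finite : sigma_finite setT leb2.
Proof.
exists (fun n : nat => ([set` `]- (n%:R : R), n%:R[] : set (measurableTypeR R)) `*`
   ([set` `]- (n%:R : R), n%:R[] : set (measurableTypeR R))).
  apply/seteqP; split => // -[x y] _.
  exists (Num.truncn (`|x| + `|y|)).+1 => //=.
  have h := truncnS_gt (`|x| + `|y|).
  have hx : `|x| < (Num.truncn (`|x| + `|y|)).+1%:R by apply: le_lt_trans h; rewrite lerDl.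
  have hy : `|y| < (Num.truncn (`|x| + `|y|)).+1%:R by apply: le_lt_trans h; rewrite lerDr.
  by split => /=; rewrite in_itv/= -ltr_norml.
move=> n; split; first by apply: measurableX.
rewrite /leb2 lebesgue2_rect// !lebesgue_measure_itv/=.
by case: ifPn => _; rewrite ?mule0// ?mul0e// -EFinB -EFinM ltry.
Qed.

HB.instance Definition _ := Measure_isSigmaFinite.Build _ _ _ leb2 leb2_sigma_finite.

Lemma lebesgue_measure_shift (a : R) (A : set (measurableTypeR R)) : measurable A ->
  mu ((fun x => x + a) @^-1` A) = mu A.
Proof.
move=> mA.
have ms : measurable_fun setT ((fun x => x + a) : measurableTypeR R -> measurableTypeR R).
  exact: measurable_funD.
rewrite [RHS](@lebesgue_measure_unique R (pushforward mu ((fun x => x + a) : measurableTypeR R -> measurableTypeR R)) _ A mA)//.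
move=> _ [[p q] _ <-]/=.
rewrite /pushforward.
have -> : (fun x => x + a) @^-1` [set` `]p, q]] = [set` `]p - a, q - a]].
  by apply/seteqP; split => x /=; rewrite !in_itv/= ltrBlDr lerBrDr.
rewrite !lebesgue_measure_itv/= !lte_fin ltrD2r.
by case: ifPn => // _; rewrite -!EFinD; congr EFin; ring.
Qed.

Lemma measurable_shift2 (v : plane R) : measurable_fun setT (fun z : plane R => z + v : plane R).
Proof.
by apply: measurable_fun_pair => /=; apply: measurable_funD.
Qed.

Lemma lebesgue2_shift (v : plane R) (A : set (plane R)) : measurable A ->
  leb2 ((fun z => z + v) @^-1` A) = leb2 A.
Proof.
move=> mA; rewrite [RHS](product_measure_unique (m' := pushforward leb2 (fun z : plane R => z + v : plane R)))//.
  exact: measurable_shift2.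
move=> ms B C mB mC; rewrite /pushforward.
transitivity (leb2 (((fun x : measurableTypeR R => x + v.1 : measurableTypeR R) @^-1` B) `*` ((fun x : measurableTypeR R => x + v.2 : measurableTypeR R) @^-1` C))).
  by congr (leb2 _); apply/seteqP; split.
rewrite [LHS]lebesgue2_rect; [|by rewrite -[X in measurable X]setTI; apply: measurable_funD..].
by congr (_ * _)%E; apply: lebesgue_measure_shift.
Qed.

Lemma ge0_integral_shift2 (v : plane R) (D : set (plane R)) (f : plane R -> \bar R) :
  measurable D -> measurable_fun D f -> (forall z, D z -> (0 <= f z)%E) ->
  (\int[leb2]_(z in D) f z = \int[leb2]_(z in (fun z : plane R => (z + v)%R) @^-1` D) f (z + v)%R)%E.
Proof.
move=> mD mf f0.
have ms := @measurable_shift2 v.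
pose m2 : {measure set (plane R) -> \bar R} := measure_function_pushforward__canonical__measure_function_Measure leb2 ms.
have E1 : (\int[leb2]_(z in D) f z = \int[m2]_(z in D) f z)%E.
  apply: eq_measure_integral => A mA _.
  apply/esym.
  exact: (lebesgue2_shift v mA).
have f0' : {in D, forall y : plane R, (0 <= f y)%E} by move=> z; rewrite inE; exact: f0.
rewrite E1. exact (ge0_integral_pushforward ms leb2 mD mf f0').
Qed.

Lemma integral_shift2 (v : plane R) (f : plane R -> \bar R) : measurable_fun setT f ->
  (\int[leb2]_z f z = \int[leb2]_z f (z + v)%R)%E.
Proof.
move=> mf; rewrite [LHS]integralE [RHS]integralE; congr (_ - _)%E.
- have := @ge0_integral_shift2 v setT _ measurableT (measurable_funepos mf) (fun z _ => funepos_ge0 f z).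
  rewrite (preimage_setT (fun z : plane R => z + v)) => E; apply: (etrans E); apply: eq_integral => z _;
 rewrite ?funeposE ?funenegE//.
- have := @ge0_integral_shift2 v setT _ measurableT (measurable_funeneg mf) (fun z _ => funeneg_ge0 f z).
  rewrite (preimage_setT (fun z : plane R => z + v)) => E; apply: (etrans E); apply: eq_integral => z _;
 rewrite ?funeposE ?funenegE//.
Qed.

End leb2.
Arguments leb2 {R}.

(** * Measurability of open sets and of continuous functions *)

Section countable_base.

(** Measurability on [plane R] refers to a product sigma-algebra and continuity to a product
    topology; a countable base made of sets of [M] reconciles the two. With [M] arbitrary, the same
    lemmas serve for the plane and for its square. *)
Definition countable_base (T : topologicalType) (M : set (set T)) :=
  exists B : nat -> set T, (forall n, M (B n)) /\
    forall x U, nbhs x U -> exists n, B n x /\ B n `<=` U.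

Lemma countable_base_prod (T1 T2 : topologicalType) (M1 : set (set T1)) (M2 : set (set T2))
   (M : set (set (T1 * T2))) :
  (forall A B, M1 A -> M2 B -> M (A `*` B)) ->
  countable_base M1 -> countable_base M2 -> countable_base M.
Proof.
move=> /= MX; rewrite /countable_base => -[B1 [MB1 B1P]] [B2 [MB2 B2P]].
exists (fun n => let: (i, j) := odflt (0, 0)%N (unpickle n) in B1 i `*` B2 j); split.
  by move=> n; case: (odflt _ _) => i j; exact: MX.
move=> [x y] U hU.
have [[V W] /= [hV hW] VWU] : exists2 Q : set T1 * set T2, nbhs x Q.1 /\ nbhs y Q.2 & Q.1 `*` Q.2 `<=` U := hU.
have [i [B1x B1V]] := B1P _ _ hV; have [j [B2y B2W]] := B2P _ _ hW.
exists (pickle (i, j)); rewrite pickleK/=; split => //.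
by move=> [u w] [/= /B1V Vu /B2W Ww]; apply: VWU.
Qed.

Lemma countable_base_open (T : topologicalType) (M : set (set T)) :
  (forall F : nat -> set T, (forall n, M (F n)) -> M (\bigcup_n F n)) -> M set0 ->
  countable_base M -> forall U, open U -> M U.
Proof.
move=> Mcup M0 [B [MB BP]] U oU.
have -> : U = \bigcup_n (if `[< B n `<=` U >] then B n else set0).
  apply/seteqP; split => x.
    move=> Ux; have [n [Bx BU]] := BP x U (open_nbhs_nbhs (conj oU Ux)).
    by exists n => //; rewrite asboolT.
  by move=> [n _]; case: ifPn => // /asboolP; exact.
by apply: Mcup => n; case: ifP.
Qed.

Lemma countable_base_R (R : realType) :
  @countable_base (measurableTypeR R) measurable.
Proof.
exists (fun n => let: (q, k) := odflt (0, 0%N) (@unpickle (rat * nat)%type n) in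
   ball (ratr q : R) (k.+1%:R^-1)); split.
  by move=> n; case: (odflt _ _) => q k; exact: measurable_ball.
move=> x U /nbhs_ballP [e /= e0 xeU].
(* A ball of radius less than e/2 that contains [x] lies within distance e of [x], and its centre
   can be chosen rational. *)
pose k := Num.truncn (2 / e).
have ke : k.+1%:R^-1 < e / 2.
  have := truncnS_gt (2 / e); rewrite -/k => h.
  by rewrite -[e / 2]invrK ltf_pV2 ?posrE ?invr_gt0 ?divr_gt0// invf_div.
have k0 : 0 < k.+1%:R^-1 :> R by rewrite invr_gt0.
suff [q /andP[q1 q2]] : exists q : rat, x - k.+1%:R^-1 < ratr q < x + k.+1%:R^-1.
  exists (pickle (q, k)); rewrite pickleK/=; move: (k.+1%:R^-1) ke k0 q1 q2 => r ke k0 q1 q2; split.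
    by rewrite /ball/= ltr_norml; apply/andP; split; lra.
  move=> y; rewrite /ball/= ltr_norml => /andP[h1 h2]; apply: xeU.
  by rewrite /ball/= ltr_norml; apply/andP; split; lra.
move: (k.+1%:R^-1) k0 => r k0.
have [q h] := @rat_in_itvoo R (x - r) (x + r) ltac:(lra).
by exists q; rewrite in_itv/= in h.
Qed.

Lemma open_measurable_plane (R : realType) (U : set (plane R)) : open U -> measurable U.
Proof.
apply: countable_base_open => //; first exact: bigcupT_measurable.
by apply: countable_base_prod; [exact: measurableX|exact: countable_base_R..].
Qed.

Lemma open_measurable_plane2 (R : realType) (U : set (plane2 R)) : open U -> measurable U.
Proof.
apply: countable_base_open => //; first exact: bigcupT_measurable.
apply: countable_base_prod; [exact: measurableX|..].
all: by apply: countable_base_prod; [exact: measurableX|exact: countable_base_R..].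
Qed.

Lemma continuous_measurable_plane (R : realType) (D : set (plane R)) (f : plane R -> R) :
  measurable D -> {within D, continuous f} -> measurable_fun D f.
Proof.
move=> mD /continuousP cf; apply: (measurability _ (RGenOpens.measurableE R)).
move=> _ [_ [a [b ->] <-]].
have /cf/open_subspaceP[U oU UD] : open `]a, b[%classic by exact: interval_open.
by rewrite setIC -UD; apply: measurableI => //; exact: open_measurable_plane.
Qed.

Lemma continuous_measurable_plane2 (R : realType) (D : set (plane2 R)) (f : plane2 R -> R) :
  measurable D -> {within D, continuous f} -> measurable_fun D f.
Proof.
move=> mD /continuousP cf; apply: (measurability _ (RGenOpens.measurableE R)).
move=> _ [_ [a [b ->] <-]].
have /cf/open_subspaceP[U oU UD] : open `]a, b[%classic by exact: interval_open.
by rewrite setIC -UD; apply: measurableI => //; exact: open_measurable_plane2.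
Qed.

End countable_base.

(** * The unit disk and the radial weight *)

Section disk.
Context {R : realType}.

Lemma continuous_sqnorm : continuous (@sqnorm R).
Proof.
move=> z; rewrite (_ : sqnorm = fun x : plane R => x.1 * x.1 + x.2 * x.2); last first.
  by apply/funext => x; rewrite sqnormE !expr2.
by apply: cvgD; apply: cvgM; (exact: cvg_fst || exact: cvg_snd).
Qed.

Lemma disk_bounds (x : plane R) : disk x -> [/\ -1 <= x.1 <= 1 & -1 <= x.2 <= 1].
Proof. by rewrite /disk/= sqnormE => h; split; apply/andP; split; nra. Qed.

Lemma compact_disk : compact (@disk R).
Proof.
apply: (@subclosed_compact (plane R) _ ((`[-1, 1]%classic : set (measurableTypeR R)) `*` (`[-1, 1]%classic : set (measurableTypeR R)))).
- rewrite (_ : disk = sqnorm @^-1` [set x | x <= 1])//.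
  by apply: closed_comp; [move=> ? _; exact: continuous_sqnorm|exact: closed_le].
- by apply: compact_setX; exact: segment_compact.
- by move=> x /disk_bounds[h1 h2]; split; rewrite /= in_itv.
Qed.

Lemma leb2_disk_fin : (leb2 (@disk R) < +oo)%E.
Proof.
apply: (@le_lt_trans _ _ (leb2 ((`[-1, 1]%classic : set (measurableTypeR R)) `*` (`[-1, 1]%classic : set (measurableTypeR R))))).
  apply: le_measure; rewrite ?inE; [exact: measurable_disk|exact: measurableX|].
  by move=> x /disk_bounds[h1 h2]; split; rewrite /= in_itv.
rewrite [X in (X < _)%E]lebesgue2_rect//.
by rewrite !lebesgue_measure_itv/=; case: ifPn => _; rewrite -?EFinB -?EFinM ltry.
Qed.

Lemma open_disk_interior (x : plane R) : sqnorm x < 1 -> disk^° x.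
Proof.
move=> x1; rewrite /interior.
have o : open [set y : plane R | sqnorm y < 1].
  by apply: (open_comp (f := sqnorm) (D := [set y | y < 1])) => [? _|]; [exact: continuous_sqnorm|exact: open_lt].
by apply: filterS (open_nbhs_nbhs (conj o x1)) => y /= /ltW.
Qed.

Lemma measurable_sqnorm : measurable_fun setT (@sqnorm R).
Proof.
rewrite (_ : sqnorm = fun x : plane R => x.1 ^+ 2 + x.2 ^+ 2); last first.
  by apply/funext => x; rewrite sqnormE.
by apply: measurable_funD; apply: measurable_funX.
Qed.

(** Fubini: the vertical section at [x] lies in the pair of points sqrt(1 - x^2) and - sqrt(1 -
    x^2). *)
Lemma leb2_circle : leb2 [set x : plane R | sqnorm x = 1] = 0%E.
Proof.
have E : leb2 [set x : plane R | sqnorm x = 1] =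
   (\int[@lebesgue_measure R]_x (@lebesgue_measure R \o xsection [set x : plane R | sqnorm x = 1%R]) x)%E by [].
rewrite E; apply: integral0_eq => x _ /=.
pose B : set (measurableTypeR R) := [set Num.sqrt (1 - x ^+ 2); - Num.sqrt (1 - x ^+ 2)].
have mA : measurable (xsection [set x : plane R | sqnorm x = 1] x).
  by apply: measurable_xsection; rewrite -[X in measurable X]setTI; exact: (measurable_sqnorm measurableT (measurable_set1 1)).
apply: (@subset_measure0 _ (measurableTypeR R) R lebesgue_measure _ B mA).
- by apply: measurableU; exact: measurable_set1.
- move=> y; rewrite /xsection/= inE/= sqnormE/= => h; rewrite /B.
  have -> : 1 - x ^+ 2 = y ^+ 2 by lra.
  rewrite sqrtr_sqr; case: (ger0P y) => _; first by left.
  by right; rewrite opprK.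
- apply/eqP; rewrite -measure_le0 (le_trans (measureU2 _ _ _))//=; [exact: measurable_set1..|].
  by rewrite !lebesgue_measure_set1 adde0.
Qed.

Lemma ae_sqnorm_lt1 : \forall z \ae (@leb2 R), disk z -> sqnorm z < 1.
Proof.
exists [set x : plane R | sqnorm x = 1]; split.
- rewrite -[X in measurable X]setTI; exact: (measurable_sqnorm measurableT (measurable_set1 1)).
- exact: leb2_circle.
- move=> z /= /not_implyP[dz /negP]; rewrite -leNgt => z1.
  by apply/eqP; rewrite eq_le z1 andbT.
Qed.

Lemma sqnorm_ge0 (x : plane R) : 0 <= sqnorm x.
Proof. by rewrite sqnormE addr_ge0// sqr_ge0. Qed.

(** Dominated convergence by |G|: the circle is a null set, and inside it the powers of [sqnorm z]
    tend to 0. It is applied to the gradient energy of a map and to the constant 1. *)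
Lemma radial_weight_cvg0 (G : plane R -> R) :
  leb2.-integrable disk (EFin \o G) ->
  (\int[leb2]_(z in disk) (sqnorm z ^+ N * G z)%:E)%E @[N --> \oo] --> 0%E.
Proof.
move=> iG; have mG := measurable_int leb2 iG.
have -> : 0%E = (\int[leb2]_(z in (@disk R)) (cst 0%E z))%E by rewrite integral0.
have [] := @dominated_convergence _ _ R leb2 disk measurable_disk
   (fun N z => (sqnorm z ^+ N * G z)%:E) (cst 0%E) (fun z => `|(G z)%:E|)%E => //.
- move=> N; apply/measurable_EFinP; apply: measurable_funM; last exact/measurable_EFinP.
  by apply: measurable_funTS; apply: measurable_funX; exact: measurable_sqnorm.
- apply: filterS ae_sqnorm_lt1 => z z1 /z1 {}z1.
  rewrite /cst/= -[X in _ --> X%:E](mul0r (G z)).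
  apply: cvg_EFin; first exact: nearW.
  apply: cvgM; last exact: cvg_cst.
  by apply: cvg_expr; rewrite ger0_norm// sqnorm_ge0.
- exact: integrable_abse.
- apply: aeW => z N dz /=; rewrite lee_fin normrM ger0_norm ?exprn_ge0 ?sqnorm_ge0//.
  by rewrite ler_piMl// exprn_ile1// sqnorm_ge0.
Qed.

End disk.

(** * Functions of class C^1 *)

Section C1_calculus.
Context {R : realType} {V : normedModType R}.
Implicit Types (f g : V -> R) (df dg : V -> V -> R).

(** A function of class C^1 bundled with its derivative [df v z] at [z] along [v]. Carrying the
    derivative along makes that of a compound function computable by combining the lemmas below. *)
Definition C1d f df :=
  [/\ forall z, differentiable f z, forall v z, 'D_v f z = df v z
    & forall v, continuous (df v)].

Lemma C1d_C1 f df : C1d f df -> C1 f.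
Proof.
move=> [fd fE cf]; split => // v.
by rewrite (_ : (fun z => 'D_v f z) = df v)//; apply/funext => z.
Qed.

Lemma C1_C1d f : C1 f -> C1d f (fun v z => 'D_v f z).
Proof. by move=> [fd cf]; split. Qed.

Lemma C1d_continuous f df : C1d f df -> continuous f.
Proof. by move=> [fd _ _] z; exact: differentiable_continuous. Qed.

Lemma C1d_cst (c : R) : C1d (fun=> c) (fun _ _ => 0).
Proof.
split => [z|v z|v]; [exact: differentiable_cst|exact: derive_cst|].
by move=> z; exact: cvg_cst.
Qed.

Lemma C1d_add f g df dg : C1d f df -> C1d g dg ->
  C1d (fun z => f z + g z) (fun v z => df v z + dg v z).
Proof.
move=> [fd fE cf] [gd gE cg]; split => [z|v z|v].
- exact: differentiableD.
- by rewrite -fE -gE deriveD//; exact: diff_derivable.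
- by move=> z; apply: cvgD; [exact: cf|exact: cg].
Qed.

Lemma C1d_mul f g df dg : C1d f df -> C1d g dg ->
  C1d (fun z => f z * g z) (fun v z => df v z * g z + f z * dg v z).
Proof.
move=> Cf Cg; have [fd fE cf] := Cf; have [gd gE cg] := Cg; split => [z|v z|v].
- exact: differentiableM.
- rewrite -fE -gE deriveM//; [|exact: diff_derivable..].
  by rewrite addrC /GRing.scale/= [X in X + _]mulrC.
- move=> z; apply: cvgD; apply: cvgM; first exact: cf.
  + exact: (C1d_continuous Cg).
  + exact: (C1d_continuous Cf).
  + exact: cg.
Qed.

Lemma C1d_opp f df : C1d f df -> C1d (fun z => - f z) (fun v z => - df v z).
Proof.
move=> [fd fE cf]; split => [z|v z|v].
- exact: differentiableN.
- by rewrite -fE deriveN//; exact: diff_derivable.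
- by move=> z; apply: cvgN; exact: cf.
Qed.

Lemma C1d_comp f df (p dp : R -> R) : C1d f df ->
  (forall x : R, is_derive x (1 : R) p (dp x)) -> continuous dp ->
  C1d (fun z => p (f z)) (fun v z => dp (f z) * df v z).
Proof.
move=> Cf pE cp; have [fd fE cf] := Cf.
have pd x : differentiable p x by apply/derivable1_diffP; exact: ex_derive.
split => [z|v z|v].
- exact: differentiable_comp.
- rewrite deriveE; last exact: differentiable_comp.
  rewrite diff_comp//= deriv1E//.
  by rewrite -fE deriveE//= /GRing.scale/= mulrC derive1E derive_val.
- move=> z; apply: cvgM; last exact: cf.
  by apply: continuous_comp; [exact: (C1d_continuous Cf)|exact: cp].
Qed.

Lemma C1d_linear f : linear f -> continuous f -> C1d f (fun v _ => f v).
Proof.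
move=> lf cf.
pose F : {linear V -> R} := HB.pack f (GRing.isLinear.Build _ _ _ _ f lf).
split => [z|v z|v].
- exact: (@linear_differentiable _ _ _ F).
- rewrite deriveE; last exact: (@linear_differentiable _ _ _ F).
  by rewrite (@diff_lin _ _ _ F).
- by move=> z; exact: cvg_cst.
Qed.

Lemma C1d_line f df (z w : V) : C1d f df ->
  forall t : R, is_derive t (1 : R) (fun t : R => f (z + t *: w)) (df w (z + t *: w)).
Proof.
move=> [fd fE cf] t.
have lin : is_diff t (fun t : R => z + t *: w) (fun h => h *: w).
  have := @is_diffD _ _ _ (cst z) (fun t : R => t *: w) (cst 0) (fun h => h *: w) t.
  rewrite (_ : cst 0 + _ = (fun h => h *: w)); last by apply/funext => h /=; rewrite /GRing.add/= add0r.
  apply; exact: is_diff_scalel.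
have := @is_diff_comp _ _ _ _ (fun t : R => z + t *: w) _ f _ t lin (differentiableP (fd (z + t *: w))).
move=> [] dff E.
split; first exact/derivable1_diffP.
by rewrite deriveE// E/= scale1r -fE deriveE.
Qed.

Lemma C1d_ext f g df dg :
  f =1 g -> (forall v z, df v z = dg v z) -> C1d f df -> C1d g dg.
Proof.
move=> /funext -> dfg; rewrite (_ : df = dg)//.
by apply/funext => v; apply/funext => z.
Qed.

Lemma C1d_exprn f df n : C1d f df ->
  C1d (fun z => f z ^+ n) (fun v z => n%:R * f z ^+ n.-1 * df v z).
Proof.
move=> Cf; elim: n => [|n IH].
  by apply: C1d_ext (C1d_cst 1) => [z|v z]; rewrite ?expr0// !mul0r.
apply: C1d_ext (C1d_mul Cf IH) => [z|v z]; first by rewrite exprS.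
by case: n IH => [|n] _ /=; [rewrite expr0 !mul0r mulr0 addr0 mulr1 !mul1r|rewrite !exprS -!natr1; ring].
Qed.

End C1_calculus.

(** * Test functions of class C^1 on rectangles *)

Section pos2.
Context {R : realType}.

(** The square of the positive part: the simplest function of class C^1 that vanishes on a half-line
    and is positive on the other one. All cutoffs are built from it. *)
Definition pos2 (x : R) : R := Num.max x 0 ^+ 2.

Lemma pos2_ge0 x : 0 <= pos2 x. Proof. exact: sqr_ge0. Qed.

Lemma pos2_le0 x : x <= 0 -> pos2 x = 0.
Proof. by move=> x0; rewrite /pos2 max_r// expr0n. Qed.

Lemma pos2_gt0 x : 0 < x -> 0 < pos2 x.
Proof. by move=> x0; rewrite /pos2 max_l ?ltW// exprn_gt0. Qed.

Lemma is_derive_quadratic (p : R -> R) (x d : R) :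
  (forall h, `|p (x + h) - p x - d * h| <= h ^+ 2) -> is_derive x (1 : R) p d.
Proof.
move=> H.
have C : h^-1 *: (p (h *: (1 : R) + x) - p x) @[h --> 0^'] --> d.
  apply/cvgrPdist_le => /= e e0.
  near=> h.
  have h0 : h != 0 by near: h; exact: nbhs_dnbhs_neq.
  have he : `|h| <= e.
    near: h; apply: dnbhs0_le => //.
  rewrite /GRing.scale/= mulr1 [h + x]addrC distrC.
  have -> : h^-1 * (p (x + h) - p x) - d = h^-1 * (p (x + h) - p x - d * h).
    by field.
  rewrite normrM normfV ler_pdivrMl ?normr_gt0//.
  by rewrite (le_trans (H h))// -[h ^+ 2]ger0_norm ?sqr_ge0// normrX expr2 ler_wpM2l.
split; first by apply/cvg_ex; exists d.
exact/cvg_lim.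
Unshelve. all: by end_near. Qed.

Lemma is_derive_pos2 (x : R) : is_derive x (1 : R) pos2 (2 * Num.max x 0).
Proof.
apply: is_derive_quadratic => h; rewrite /pos2 ler_norml.
by case: (leP x 0) => hx; case: (leP (x + h) 0) => hy; apply/andP; split; nra.
Qed.

Lemma continuous_pos2' : continuous (fun x : R => 2 * Num.max x 0).
Proof.
have -> : (fun x : R => 2 * Num.max x 0) = (fun x => x + `|x|).
  by apply/funext => x; rewrite maxr_absE addr0 subr0 mulrC divfK.
by move=> x; apply: cvgD; [exact: cvg_id|exact: norm_continuous].
Qed.

Lemma C1d_pos2 {V : normedModType R} (f : V -> R) df : C1d f df ->
  C1d (fun z => pos2 (f z)) (fun v z => 2 * Num.max (f z) 0 * df v z).
Proof.
move=> Cf; apply: (C1d_comp (p := pos2) (dp := fun x => 2 * Num.max x 0)) => //.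
  exact: is_derive_pos2.
exact: continuous_pos2'.
Qed.

(* [saturate n] is a C^1 approximation of the indicator of the positive reals. *)
Definition saturate (n : nat) (x : R) : R := 1 - pos2 (1 - n%:R * x).

Lemma saturate_eq0 n : saturate n 0 = 0.
Proof. by rewrite /saturate mulr0 subr0 /pos2 max_l// expr1n subrr. Qed.

Lemma saturate_ge0 n x : 0 <= x -> 0 <= saturate n x <= 1.
Proof.
move=> x0; have : 0 <= n%:R * x by rewrite mulr_ge0.
rewrite /saturate /pos2; move: (_ * x) => y y0.
by case: (leP (1 - y) 0) => hy; apply/andP; split; nra.
Qed.

Lemma saturate_cvg x : 0 < x -> \forall n \near \oo, saturate n x = 1.
Proof.
move=> x0; near=> n; rewrite /saturate pos2_le0 ?subr0// subr_le0.
rewrite -ler_pdivrMr// div1r.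
by near: n; exact: nbhs_infty_ger.
Unshelve. all: by end_near. Qed.

Lemma C1d_saturate {V : normedModType R} n (f : V -> R) df : C1d f df ->
  exists df', C1d (fun z => saturate n (f z)) df'.
Proof.
move=> Cf; eexists; rewrite /saturate.
exact: C1d_add (C1d_cst _) (C1d_opp (C1d_pos2 (C1d_add (C1d_cst _) (C1d_opp (C1d_mul (C1d_cst _) Cf))))).
Qed.

End pos2.

Section bump.
Context {R : realType}.
Implicit Types p q : plane R.

Lemma C1d_fst : C1d (fst : plane R -> R) (fun v _ => v.1).
Proof. by apply: C1d_linear => // z; exact: cvg_fst. Qed.

Lemma C1d_snd : C1d (snd : plane R -> R) (fun v _ => v.2).
Proof. by apply: C1d_linear => // z; exact: cvg_snd. Qed.

Definition rect p q : set (plane R) :=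
  [set z | [/\ p.1 < z.1, z.1 < q.1, p.2 < z.2 & z.2 < q.2]].

Definition crect p q : set (plane R) :=
  [set z | [/\ p.1 <= z.1, z.1 <= q.1, p.2 <= z.2 & z.2 <= q.2]].

Lemma rect_crect p q : rect p q `<=` crect p q.
Proof. by move=> z [? ? ? ?]; split; exact: ltW. Qed.

Lemma rectE p q : rect p q = (`]p.1, q.1[%classic : set (measurableTypeR R)) `*` (`]p.2, q.2[%classic : set (measurableTypeR R)).
Proof.
apply/seteqP; split => z; rewrite /rect/= !in_itv/=.
  by move=> [-> -> -> ->].
by move=> [/andP[? ?] /andP[? ?]].
Qed.

Lemma crectE p q : crect p q = (`[p.1, q.1]%classic : set (measurableTypeR R)) `*` (`[p.2, q.2]%classic : set (measurableTypeR R)).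
Proof.
apply/seteqP; split => z; rewrite /crect/= !in_itv/=.
  by move=> [-> -> -> ->].
by move=> [/andP[? ?] /andP[? ?]].
Qed.

Lemma measurable_rect p q : measurable (rect p q).
Proof. by rewrite rectE; exact: measurableX. Qed.

Lemma compact_crect p q : compact (crect p q).
Proof. by rewrite crectE; apply: compact_setX; exact: segment_compact. Qed.

(** Of class C^1 and positive exactly on the open rectangle. After composition with [saturate n] it
    still vanishes off [rect p q], and it converges pointwise to the indicator of [rect p q]. *)
Definition bump_arg p q (z : plane R) : R :=
  pos2 (z.1 - p.1) * pos2 (q.1 - z.1) * (pos2 (z.2 - p.2) * pos2 (q.2 - z.2)).

Definition rect_bump p q n (z : plane R) : R := saturate n (bump_arg p q z).

Lemma bump_arg_ge0 p q z : 0 <= bump_arg p q z.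
Proof. by apply: mulr_ge0; apply: mulr_ge0; exact: pos2_ge0. Qed.

Lemma bump_out p q n z : ~ rect p q z -> rect_bump p q n z = 0.
Proof.
move=> Hz; rewrite /rect_bump (_ : bump_arg p q z = 0) ?saturate_eq0// /bump_arg.
case: (ltP p.1 z.1) => h1; last by rewrite [pos2 (z.1 - _)]pos2_le0 ?subr_le0// !mul0r.
case: (ltP z.1 q.1) => h2; last by rewrite [pos2 (_ - z.1)]pos2_le0 ?subr_le0// mulr0 mul0r.
case: (ltP p.2 z.2) => h3; last by rewrite [pos2 (z.2 - _)]pos2_le0 ?subr_le0// mul0r mulr0.
case: (ltP z.2 q.2) => h4; last by rewrite [pos2 (_ - z.2)]pos2_le0 ?subr_le0// !mulr0.
by exfalso; apply: Hz.
Qed.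

Lemma bump_ge0 p q n z : 0 <= rect_bump p q n z <= 1.
Proof. exact/saturate_ge0/bump_arg_ge0. Qed.

Lemma bump_cvg p q z : rect p q z -> \forall n \near \oo, rect_bump p q n z = 1.
Proof.
by move=> [h1 h2 h3 h4]; apply: saturate_cvg; apply: mulr_gt0; apply: mulr_gt0; rewrite pos2_gt0// subr_gt0.
Qed.

Lemma C1_bump p q n : C1 (rect_bump p q n).
Proof.
have C0 c : C1d (fun=> c : R) _ := @C1d_cst R (plane R) c.
have C := C1d_mul
  (C1d_mul (C1d_pos2 (C1d_add C1d_fst (C0 (- p.1)))) (C1d_pos2 (C1d_add (C0 q.1) (C1d_opp C1d_fst))))
  (C1d_mul (C1d_pos2 (C1d_add C1d_snd (C0 (- p.2)))) (C1d_pos2 (C1d_add (C0 q.2) (C1d_opp C1d_snd)))).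
have [df] := C1d_saturate n C.
exact: C1d_C1.
Qed.

Lemma test_function_bump p q n : (forall z, crect p q z -> sqnorm z < 1) ->
  test_function (rect_bump p q n).
Proof.
move=> h; split; first exact: C1_bump.
exists (crect p q); split; first exact: compact_crect.
  by move=> z /h; exact: open_disk_interior.
by move=> z zr; apply: bump_out => /rect_crect.
Qed.

End bump.

Section segment_FTC.
Context {R : realType} {V : normedModType R}.
Local Notation mu := (@lebesgue_measure R).

Lemma continuous_segment (z w : V) : continuous (fun t : R => z + t *: w).
Proof.
move=> t; apply: cvgD; first exact: cvg_cst.
by apply: cvgZr_tmp; exact: cvg_id.
Qed.

Lemma C1d_FTC (f : V -> R) df (z w : V) : C1d f df ->
  (\int[mu]_(t in `[0%R, 1%R]) (df w (z + t *: w)%R)%:E = (f (z + w) - f z)%:E)%E.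
Proof.
move=> Cf.
rewrite (@continuous_FTC2 R (fun t => df w (z + t *: w)) (fun t => f (z + t *: w)) 0 1)//.
- by rewrite scale1r scale0r addr0 -EFinB.
- apply: continuous_subspaceT => t; have [_ _ cf] := Cf.
  by apply: continuous_comp; [exact: continuous_segment|exact: cf].
- have c : continuous (fun t : R => f (z + t *: w)).
    by move=> t; apply: continuous_comp; [exact: continuous_segment|exact: (C1d_continuous Cf)].
  split.
  + by move=> t _; have [] := C1d_line z w Cf t.
  + exact/cvg_at_right_filter/c.
  + exact/cvg_at_left_filter/c.
- move=> t _; rewrite derive1E; exact: (@derive_val _ _ _ _ _ _ _ (C1d_line z w Cf t)).
Qed.

End segment_FTC.

(** * The fundamental lemma of the calculus of variations on a rectangle *)

Section fundamental_lemma.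
Context {R : realType}.

(** The whole line is added to the open rays so that cylinders over a ray belong to [rays2]; this
    makes both projections measurable for the sigma-algebra that [rays2] generates. *)
Let rays : set (set (measurableTypeR R)) :=
  [set A | A = setT \/ exists x : R, A = `]x, +oo[%classic].

Let raysI : setI_closed rays.
Proof.
move=> A B [->|[x ->]] [->|[y ->]].
- by left; rewrite setIT.
- by right; exists y; rewrite setTI.
- by right; exists x; rewrite setIT.
- right; exists (Num.max x y); apply/seteqP; split => z; rewrite /= !in_itv/= !andbT gt_max.
    by move=> [-> ->].
  by move=> /andP[].
Qed.

Let measurable_rays A : rays A -> measurable A.
Proof. by move=> [->|[x ->]]. Qed.

Let raysE : @measurable _ (measurableTypeR R) = <<s rays >>.
Proof.
apply/seteqP; split.
  rewrite [X in X `<=` _]RGenOInfty.measurableE.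
  apply: smallest_sub; first exact: smallest_sigma_algebra.
  by move=> _ [x ->]; apply: sub_sigma_algebra; right; exists x.
apply: smallest_sub; first exact: sigma_algebra_measurable.
exact: measurable_rays.
Qed.

Let rays2 : set (set (plane R)) := [set A `*` B | A in rays & B in rays].

Let rays2E : @measurable _ (plane R) = <<s rays2 >>.
Proof.
rewrite measurable_prod_measurableType.
apply/seteqP; split.
  apply: smallest_sub; first exact: smallest_sigma_algebra.
  have mfst : forall A, measurable A -> <<s rays2 >> (A `*` setT).
    move=> A; rewrite raysE => mA.
    have : measurable_fun setT (fst : g_sigma_algebraType rays2 -> measurableTypeR R).
      apply: (@measurability _ _ _ _ _ _ rays) => //.
      move=> _ [B rB <-]; apply: sub_sigma_algebra; rewrite setTI.
      exists B => //; exists setT; first by left.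
      by apply/seteqP; split => z; [case|move=> ?; split].
    rewrite -raysE in mA; move=> /(_ measurableT _ mA); rewrite setTI.
    rewrite (_ : _ `*` _ = fst @^-1` A)//.
    by apply/seteqP; split => z; [case|move=> ?; split].
  have msnd : forall A, measurable A -> <<s rays2 >> (setT `*` A).
    move=> A; rewrite raysE => mA.
    have : measurable_fun setT (snd : g_sigma_algebraType rays2 -> measurableTypeR R).
      apply: (@measurability _ _ _ _ _ _ rays) => //.
      move=> _ [B rB <-]; apply: sub_sigma_algebra; rewrite setTI.
      exists setT; first by left. exists B => //.
      by apply/seteqP; split => z; [case|move=> ?; split].
    rewrite -raysE in mA; move=> /(_ measurableT _ mA); rewrite setTI.
    rewrite (_ : _ `*` _ = snd @^-1` A)//.
    by apply/seteqP; split => z; [case|move=> ?; split].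
  move=> _ [A mA [B mB <-]].
  rewrite (_ : A `*` B = (A `*` setT) `&` (setT `*` B)); last first.
    by apply/seteqP; split => z; [case|case=> -[? ?] [? ?]].
  by apply: (@measurableI _ (g_sigma_algebraType rays2)); [exact: mfst|exact: msnd].
apply: smallest_sub; first exact: smallest_sigma_algebra.
move=> _ [A rA [B rB <-]]; apply: sub_sigma_algebra; exists A; first exact: measurable_rays.
by exists B => //; exact: measurable_rays.
Qed.

Let rays2I : setI_closed rays2.
Proof.
move=> _ _ [A rA [B rB <-]] [A' rA' [B' rB' <-]].
by exists (A `&` A'); [exact: raysI|exists (B `&` B'); [exact: raysI|rewrite setXI]].
Qed.

(* The rectangles with upper right corner [q] suffice: they are the traces on [rect p q] of the
   products of open rays, a generating pi-system. *)
Lemma integral_rect_ae_eq0 (p q : plane R) (Z : plane R -> R) :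
  leb2.-integrable setT (EFin \o Z) ->
  (forall z, ~ rect p q z -> Z z = 0) ->
  (forall p' n, p.1 <= p'.1 -> p.2 <= p'.2 ->
     (\int[leb2]_z (Z z * rect_bump p' q n z)%:E = 0)%E) ->
  ae_eq leb2 setT Z (cst 0).
Proof.
move=> iZ Zout Zbump.
have mZ := measurable_int leb2 iZ.
have mZ' : measurable_fun setT Z by apply/measurable_EFinP.
have Zrect p' : p.1 <= p'.1 -> p.2 <= p'.2 -> (\int[leb2]_(z in rect p' q) (Z z)%:E = 0)%E.
  move=> h1 h2.
  have mb n : measurable_fun setT (rect_bump p' q n).
    apply: continuous_measurable_plane => //; apply: continuous_subspaceT.
    exact: (C1d_continuous (C1_C1d (C1_bump p' q n))).
  have h : (\int[leb2]_z (Z z * rect_bump p' q n z)%:E)%E @[n --> \oo] --> (\int[leb2]_z (Z z * \1_(rect p' q) z)%:E)%E.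
    have [] // := @dominated_convergence _ _ R leb2 setT measurableT
     (fun n z => (Z z * rect_bump p' q n z)%:E) (fun z => (Z z * \1_(rect p' q) z)%:E) (fun z => `|(Z z)%:E|)%E.
    - by move=> n; apply/measurable_EFinP; exact: measurable_funM.
    - apply/measurable_EFinP; apply: measurable_funM => //.
      by apply: measurable_indic; exact: measurable_rect.
    - apply: aeW => z _; apply: cvg_near_cst.
      have [zr|zr] := pselect (rect p' q z).
        have := bump_cvg zr; apply: filterS => n ->.
        by rewrite indicE mem_set.
      by apply: nearW => n; rewrite bump_out// indicE memNset.
    - by apply: integrable_abse.
    - apply: aeW => z n _ /=; rewrite lee_fin normrM.
      have /andP[b0 b1] := bump_ge0 p' q n z.
      by rewrite (ger0_norm b0) ler_piMr.
  rewrite integral_mkcond.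
  rewrite (_ : (fun z => (Z z)%:E) \_ (rect p' q) = (fun z => (Z z * \1_(rect p' q) z)%:E)); last first.
    by apply/funext => z; rewrite patchE indicE; case: (z \in _); rewrite ?mulr1 ?mulr0.
  have E0 : (\int[leb2]_z (Z z * rect_bump p' q n z)%:E)%E @[n --> \oo] --> 0%E.
    rewrite (_ : (fun n => _) = cst 0%E); last by apply/funext => n; exact: Zbump.
    exact: cvg_cst.
  by have := cvg_unique _ h E0; apply.
(* The signed measure of density [Z] is shown to vanish on every measurable set, by Dynkin's theorem
   from its vanishing on [rays2]. *)
pose nu : {charge set (plane R) -> \bar R} := charge_induced_charge__canonical__charge_Charge iZ.
have nuE A : nu A = (\int[leb2]_(z in A) (Z z)%:E)%E by [].
have nuI A : nu A = (\int[leb2]_(z in A `&` rect p q) (Z z)%:E)%E.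
  rewrite nuE [LHS]integral_mkcond [RHS]integral_mkcond; congr (integral _ _ _).
  apply/funext => z; rewrite !patchE in_setI.
  case: (z \in A) => //=; case: ifPn => // /negP h.
  by rewrite Zout// => /mem_set.
have nu0 : forall A, measurable A -> nu A = 0%E.
  move=> A; rewrite rays2E.
  apply: (@dynkin_induction _ (plane R) rays2 (fun A => nu A = 0%E)) => //.
  - by rewrite nuI setTI Zrect.
  - have key (A' : set (measurableTypeR R)) (a b : R) : rays A' -> exists2 c, a <= c &
        forall x, (A' x /\ a < x < b) <-> (c < x < b).
      move=> [->|[x ->]]; first by exists a => // x; split => // -[].
      exists (Num.max a x); first by rewrite le_max lexx.
      move=> y; rewrite /= in_itv/= andbT gt_max; split.
        by move=> [-> /andP[-> ->]].
      by move=> /andP[/andP[-> ->] ->].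
    move=> _ [A1 rA1 [A2 rA2 <-]].
    have [x px hx] := key _ p.1 q.1 rA1; have [y py hy] := key _ p.2 q.2 rA2.
    rewrite nuI -(Zrect (x, y) px py); congr (integral _ _ _).
    apply/seteqP; split => z; rewrite /rect/=.
      move=> [[/= z1 z2] [h1 h2 h3 h4]].
      have /andP[-> ->] := (hx z.1).1 (conj z1 (introT andP (conj h1 h2))).
      by have /andP[-> ->] := (hy z.2).1 (conj z2 (introT andP (conj h3 h4))).
    move=> [h1 h2 h3 h4].
    have [A1z /andP[-> ->]] := (hx z.1).2 (introT andP (conj h1 h2)).
    by have [A2z /andP[-> ->]] := (hy z.2).2 (introT andP (conj h3 h4)).
  (* Complements are harmless because the whole plane has charge 0: [Z] lives on [rect p q], to
     which [Zrect] applies. *)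
  - move=> S mS S0; have := @chargeU _ _ _ nu S (~` S) mS (measurableC mS) (setICr S).
    by rewrite setUv S0 add0e => <-; rewrite nuI setTI Zrect.
  - move=> F mF tF F0.
    have : semi_sigma_additive nu by exact: charge_semi_sigma_additive.
    move=> /(_ F mF tF (bigcupT_measurable F mF)).
    rewrite (_ : (fun n => _) = cst 0%E); last first.
      by apply/funext => n; rewrite big1// => i _; exact: F0.
    by move/cvg_lim => <-//; rewrite lim_cst.
have := @integral_ae_eq _ _ R leb2 setT measurableT (cst 0%E) (EFin \o Z) iZ.
move=> /(_ (measurable_cst _)) H.
have {}H : ae_eq leb2 setT (EFin \o Z) (cst 0%E).
  by apply: H => E _ mE; rewrite integral0; exact: nu0.
by apply: filterS H => z h _; case: (h I).
Qed.

End fundamental_lemma.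

Section integral_helpers.
Context d (T : measurableType d) {R : realType} (m : {measure set T -> \bar R}).

Lemma integrable_le (D : set T) (f g : T -> R) : measurable D ->
  measurable_fun D f -> m.-integrable D (EFin \o g) ->
  (forall x, D x -> `|f x| <= g x) -> m.-integrable D (EFin \o f).
Proof.
move=> mD mf ig fg.
apply: (@le_integrable _ _ _ m D mD (EFin \o f) (EFin \o g)) => //.
  exact/measurable_EFinP.
by move=> x Dx; rewrite /= lee_fin (le_trans (fg x Dx))// ler_norm.
Qed.

Lemma integrable_mul_bounded (D : set T) (f g : T -> R) (M : R) : measurable D ->
  m.-integrable D (EFin \o f) -> measurable_fun D g ->
  (forall x, D x -> f x != 0 -> `|g x| <= M) ->
  m.-integrable D (EFin \o (fun x => f x * g x)).
Proof.
move=> mD fi mg gM.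
have mf : measurable_fun D f by apply/measurable_EFinP; exact: measurable_int fi.
apply: (@integrable_le _ _ (fun x => `|f x| * `|M|)) => //.
- exact: measurable_funM.
- have := @integrableZr _ _ _ m D mD `|M| _ (integrable_abse fi); exact.
- move=> x Dx; rewrite normrM.
  have [->|f0] := eqVneq (f x) 0; first by rewrite normr0 !mul0r.
  by rewrite ler_wpM2l// (le_trans (gM x Dx f0))// ler_norm.
Qed.

Lemma EFin_Rintegral (D : set T) (f : T -> R) : measurable D -> m.-integrable D (EFin \o f) ->
  (\int[m]_(x in D) f x)%:E = (\int[m]_(x in D) (f x)%:E)%E.
Proof. by move=> mD fi; rewrite /Rintegral fineK//; exact: integrable_fin_num. Qed.

Lemma integrable_indic_lty (A : set T) : measurable A -> (m A < +oo)%E ->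
  m.-integrable setT (EFin \o (\1_A : T -> R)).
Proof.
move=> mA Aoo; apply/integrableP; split; first exact/measurable_EFinP.
under eq_integral do rewrite /= ger0_norm//.
by rewrite integral_indic// setIT.
Qed.

Lemma integrable_cst_lty (D : set T) (c : R) : measurable D -> (m D < +oo)%E ->
  m.-integrable D (EFin \o (fun=> c)).
Proof.
move=> mD Doo; apply/integrableP; split; first exact/measurable_EFinP/measurable_cst.
by rewrite integral_cst//= lte_mul_pinfty.
Qed.

Lemma integrableDR (D : set T) (f g : T -> R) : measurable D ->
  m.-integrable D (EFin \o f) -> m.-integrable D (EFin \o g) ->
  m.-integrable D (EFin \o (fun x => f x + g x)).
Proof. by move=> mD fi gi; have := integrableD mD fi gi; exact. Qed.

Lemma integrableBR (D : set T) (f g : T -> R) : measurable D ->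
  m.-integrable D (EFin \o f) -> m.-integrable D (EFin \o g) ->
  m.-integrable D (EFin \o (fun x => f x - g x)).
Proof. by move=> mD fi gi; have := integrableB mD fi gi; exact. Qed.

Lemma integrableZR (D : set T) (f : T -> R) c : measurable D ->
  m.-integrable D (EFin \o f) ->
  m.-integrable D (EFin \o (fun x => c * f x)).
Proof. by move=> mD fi; have := @integrableZl _ _ _ m D mD c _ fi; exact. Qed.

Lemma integral_lincomb (D : set T) (f g : T -> R) a b : measurable D ->
  m.-integrable D (EFin \o f) -> m.-integrable D (EFin \o g) ->
  (\int[m]_(x in D) (a * f x + b * g x)%:E =
    a%:E * \int[m]_(x in D) (f x)%:E + b%:E * \int[m]_(x in D) (g x)%:E)%E.
Proof.
move=> mD fi gi; rewrite integralD_EFin//; [|exact: integrableZR..].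
by rewrite -!integralZl.
Qed.

End integral_helpers.

Section unit_interval.
Context {R : realType}.
Local Notation mu := (@lebesgue_measure R).

Lemma lebesgue_measure01 : mu (`[0%R, 1%R]%classic : set (measurableTypeR R)) = 1%E.
Proof.
apply: etrans (lebesgue_measure_itv `[0, 1]) _.
by rewrite /= lte_fin ltr01 -EFinB subr0.
Qed.

Lemma integral_indic01 :
  (\int[mu]_t (\1_(`[0%R, 1%R]%classic : set (measurableTypeR R)) t)%:E = 1)%E.
Proof.
by rewrite integral_indic// setIT; exact: lebesgue_measure01.
Qed.

(** Jensen's inequality on [0, 1]: with I the integral of [u], integrate u^2 >= 2 I u - I^2 over
    [0, 1]. *)
Lemma sqr_integral_le (u : R -> R) : mu.-integrable setT (EFin \o u) ->
  (forall t, ~ (0 <= t <= 1) -> u t = 0) ->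
  ((fine (\int[mu]_t (u t)%:E) ^+ 2)%:E <= \int[mu]_t (u t ^+ 2)%:E)%E.
Proof.
move=> iu u0; set I := fine _.
have mu_ : measurable_fun setT u by apply/measurable_EFinP; exact: (measurable_int mu iu).
have IE : (\int[mu]_t (u t)%:E)%E = I%:E by rewrite /I fineK//; exact: integrable_fin_num.
have mu2 : measurable_fun setT (fun t => u t ^+ 2) by exact: measurable_funX.
have [Hoo|Hfin] := eqVneq (\int[mu]_t (u t ^+ 2)%:E)%E +oo%E; first by rewrite Hoo leey.
have i2 : mu.-integrable setT (EFin \o (fun t => u t ^+ 2)).
  apply/integrableP; split; first exact/measurable_EFinP.
  under eq_integral do rewrite /= ger0_norm ?sqr_ge0//.
  by rewrite ltey.
pose ind : R -> R := \1_(`[0, 1]%classic : set (measurableTypeR R)).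
have iind : mu.-integrable setT (EFin \o ind).
  have := @integrable_indic_itv R 0 1 true false.
  exact.
have : (\int[mu]_t (2 * I * u t - I ^+ 2 * ind t)%:E <= \int[mu]_t (u t ^+ 2)%:E)%E.
  apply: le_integral => //.
  - by apply: integrableBR => //; exact: integrableZR.
  - move=> t _; rewrite lee_fin /ind indicE.
    case: (boolP (t \in _)) => ht.
      by have := sqr_ge0 (u t - I); rewrite mulr1 /=; nra.
    rewrite u0 ?mulr0 ?expr0n ?subr0//.
    by move=> h; move: ht; rewrite notin_setE; apply; rewrite /= in_itv.
rewrite integralB_EFin//; [|exact: integrableZR..].
under eq_integral do rewrite EFinM.
under [X in (_ - X)%E]eq_integral do rewrite EFinM.
rewrite !integralZl// IE integral_indic01 -!EFinM -EFinB; apply: le_trans.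
by rewrite lee_fin; nra.
Qed.

End unit_interval.

(** * Translation estimates for weakly differentiable functions *)

Section directional.
Context {R : realType}.

Lemma rect_bump_shift (p q w : plane R) n z :
  rect_bump p q n (z - w) = rect_bump (p + w) (q + w) n z.
Proof.
rewrite /rect_bump /bump_arg /=; congr (saturate n _).
by congr (pos2 _ * pos2 _ * (pos2 _ * pos2 _)); ring.
Qed.

Lemma derive_basis (f : plane R -> R) (v z : plane R) : differentiable f z ->
  'D_v f z = \sum_(alpha < 2) coord alpha v * 'D_(basis alpha : plane R) f z.
Proof.
move=> fd; rewrite big_ord_recl big_ord1 !deriveE// /coord /basis/=.
have {1}-> : v = v.1 *: ((1, 0) : plane R) + v.2 *: ((0, 1) : plane R).
  by case: v => a b; congr pair => /=; rewrite scaler0 ?addr0 ?add0r; apply/esym; exact: mulr1.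
by rewrite linearD !linearZ.
Qed.

Lemma derive_shift (V : normedModType R) (f : V -> R) (w v z : V) :
  'D_v (fun x => f (x + w)) z = 'D_v f (z + w).
Proof.
rewrite /derive (_ : (fun h => _) = (fun h : R => h^-1 *: (f (h *: v + (z + w)) - f (z + w))))//.
by apply/funext => h; rewrite /= addrA.
Qed.

Lemma bounded_compact (T : topologicalType) (f : T -> R) (A : set T) : compact A ->
  {within A, continuous f} -> exists M, forall x, A x -> `|f x| <= M.
Proof.
move=> cA cf; have /compact_bounded[N [_ N1x]] := continuous_compact cf cA.
exists (N + 1) => x Ax; apply: N1x; first by rewrite ltrDl.
by exists x.
Qed.

End directional.

Section translation_estimate.
Context {R : realType}.
Local Notation mu := (@lebesgue_measure R).
Variables (k : plane R -> R) (g : 'I_2 -> plane R -> R).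
Hypothesis mk : measurable_fun setT k.
Hypothesis k1 : forall z, `|k z| <= 1.
Hypothesis kout : forall z, ~ disk z -> k z = 0.
Hypothesis mg : forall alpha, measurable_fun setT (g alpha).
Hypothesis gout : forall alpha z, ~ disk z -> g alpha z = 0.
Hypothesis ig2 : forall alpha, leb2.-integrable setT (EFin \o (fun z => g alpha z ^+ 2)).
Hypothesis weak : forall alpha psi, test_function psi ->
  (\int[leb2]_z (k z * 'D_(basis alpha : plane R) psi z) = - \int[leb2]_z (g alpha z * psi z))%R.

Definition directional (v z : plane R) : R := \sum_(alpha < 2) coord alpha v * g alpha z.

Let indd : plane R -> R := \1_disk.

Let iindd : leb2.-integrable setT (EFin \o indd).
Proof.
apply: integrable_indic_lty; [exact: measurable_disk|exact: leb2_disk_fin].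
Qed.

Lemma integrable_k : leb2.-integrable setT (EFin \o k).
Proof.
apply: (@integrable_le _ _ _ leb2 setT k indd) => // z _.
rewrite /indd indicE; case: (boolP (z \in _)) => [_|]; first exact: k1.
by rewrite notin_setE => /kout ->; rewrite normr0.
Qed.

Lemma integrable_g alpha : leb2.-integrable setT (EFin \o g alpha).
Proof.
apply: (@integrable_le _ _ _ leb2 setT (g alpha) (fun z => indd z + g alpha z ^+ 2)) => //.
  exact: integrableDR.
move=> z _; rewrite /indd indicE; case: (boolP (z \in _)) => [_|].
  move: (g alpha z) => x; rewrite ler_norml expr2.
  have := sqr_ge0 (x - 2^-1); have := sqr_ge0 (x + 2^-1); rewrite !expr2 /= => h1 h2.
  by apply/andP; split; nra.
by rewrite notin_setE => /gout ->; rewrite normr0 expr0n addr0.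
Qed.

Lemma measurable_directional v : measurable_fun setT (directional v).
Proof.
apply: measurable_sum => alpha; apply: measurable_funM => //; exact: measurable_cst.
Qed.

Lemma integrable_directional v : leb2.-integrable setT (EFin \o directional v).
Proof.
rewrite /directional; under eq_fun do rewrite big_ord_recl big_ord1.
by apply: integrableDR => //; apply: integrableZR => //; exact: integrable_g.
Qed.

Lemma continuous_bounded_disk (h : plane R -> R) : continuous h ->
  exists M, forall z, disk z -> `|h z| <= M.
Proof. by move=> ch; apply: bounded_compact; [exact: compact_disk|exact: continuous_subspaceT]. Qed.

Lemma integrable_kM h : continuous h -> leb2.-integrable setT (EFin \o (fun z => k z * h z)).
Proof.
move=> ch; have [M hM] := continuous_bounded_disk ch.
apply: (@integrable_mul_bounded _ _ _ leb2 setT k h M) => //; first exact: integrable_k.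
  by apply: continuous_measurable_plane => //; exact: continuous_subspaceT.
by move=> z _ kz; apply: hM; apply: contrapT => /kout /eqP; exact/negP.
Qed.

Lemma integrable_gM alpha h : continuous h -> leb2.-integrable setT (EFin \o (fun z => g alpha z * h z)).
Proof.
move=> ch; have [M hM] := continuous_bounded_disk ch.
apply: (@integrable_mul_bounded _ _ _ leb2 setT (g alpha) h M) => //; first exact: integrable_g.
  by apply: continuous_measurable_plane => //; exact: continuous_subspaceT.
by move=> z _ kz; apply: hM; apply: contrapT => /(gout alpha) /eqP; exact/negP.
Qed.

Lemma weak_directional v psi : test_function psi ->
  (\int[leb2]_z (k z * 'D_v psi z)%:E = \int[leb2]_z (- (directional v z * psi z))%:E)%E.
Proof.
move=> tpsi; have [Cpsi _] := tpsi; have [psid psic] := Cpsi.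
have cpsi : continuous psi := C1d_continuous (C1_C1d Cpsi).
have ikD alpha : leb2.-integrable setT (EFin \o (fun z => k z * 'D_(basis alpha : plane R) psi z)).
  exact: integrable_kM.
have igD alpha : leb2.-integrable setT (EFin \o (fun z => g alpha z * psi z)).
  exact: integrable_gM.
have W alpha : (\int[leb2]_z (k z * 'D_(basis alpha : plane R) psi z)%:E = - \int[leb2]_z (g alpha z * psi z)%:E)%E.
  rewrite -!EFin_Rintegral//.
  by rewrite -EFinN weak.
transitivity (\int[leb2]_z (coord ord0 v * (k z * 'D_(basis ord0 : plane R) psi z) + coord (lift ord0 ord0) v * (k z * 'D_(basis (lift ord0 ord0) : plane R) psi z))%:E)%E.
  apply: eq_integral => z _; rewrite derive_basis// big_ord_recl big_ord1.
  by congr EFin; ring.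
rewrite integral_lincomb// !W.
transitivity (\int[leb2]_z ((- coord ord0 v) * (g ord0 z * psi z) + (- coord (lift ord0 ord0) v) * (g (lift ord0 ord0) z * psi z))%:E)%E; last first.
  apply: eq_integral => z _; rewrite /directional big_ord_recl big_ord1.
  by congr EFin; ring.
by rewrite integral_lincomb// !EFinN !mulNe !muleN.
Qed.

Lemma measurable_segment (v : plane R) :
  measurable_fun setT (fun x : plane R * measurableTypeR R => x.1 + x.2 *: v : plane R).
Proof.
apply: measurable_fun_pair => /=.
  apply: measurable_funD; first exact: (measurableT_comp measurable_fst measurable_fst).
  by apply: measurable_funM; [exact: measurable_snd|exact: measurable_cst].
apply: measurable_funD; first exact: (measurableT_comp measurable_snd measurable_fst).
by apply: measurable_funM; [exact: measurable_snd|exact: measurable_cst].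
Qed.

Let U : measurableTypeR R -> R := \1_(`[0, 1]%classic : set (measurableTypeR R)).

Let U1 t : 0 <= t <= 1 -> U t = 1.
Proof. by move=> t01; rewrite /U indicE mem_set//= in_itv. Qed.

Let U0 t : ~ (0 <= t <= 1) -> U t = 0.
Proof. by move=> t01; rewrite /U indicE memNset//= in_itv. Qed.

Let Uitv : measurable (`[0, 1]%classic : set (measurableTypeR R)).
Proof. exact: measurable_itv. Qed.

Let mU : measurable_fun setT U.
Proof. exact: measurable_indic. Qed.

Section rectangle.
Variables (p q v : plane R).
Hypothesis Hpq : forall z t, crect p q z -> 0 <= t <= 1 -> sqnorm (z + t *: v) < 1.

Let P : set (plane R) := rect p q.

(** The integrand of k(z + v) - k(z) = \int_0^1 D_v k(z + t v) dt, cut off to [rect p q] and to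
    [0, 1] so that it is integrable on the full product space and Fubini's theorem applies. *)
Definition segment_grad (z : plane R) (t : measurableTypeR R) : R :=
  \1_P z * (U t * directional v (z + t *: v)).

Lemma segment_grad_out z t : ~ (0 <= t <= 1) -> segment_grad z t = 0.
Proof. by move=> t01; rewrite /segment_grad U0// mul0r mulr0. Qed.

Lemma segment_grad_in z t : 0 <= t <= 1 ->
  segment_grad z t = \1_P z * directional v (z + t *: v).
Proof. by move=> t01; rewrite /segment_grad U1// mul1r. Qed.

Lemma measurable_segment_grad : measurable_fun setT (fun x : plane R * measurableTypeR R => segment_grad x.1 x.2).
Proof.
apply: measurable_funM.
  apply: measurableT_comp => //; apply: measurable_indic; exact: measurable_rect.
apply: measurable_funM; first exact: measurableT_comp.
apply: (@measurableT_comp _ _ _ _ _ _ (directional v)); first exact: measurable_directional.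
exact: measurable_segment.
Qed.

Let prodm := (@leb2 R \x @lebesgue_measure R)%E.

Lemma integrable_segment_grad :
  prodm.-integrable setT (fun x : plane R * measurableTypeR R => (segment_grad x.1 x.2)%:E).
Proof.
apply/integrable21ltyP; first by apply/measurable_EFinP; exact: measurable_segment_grad.
set C := (\int[leb2]_z `|directional v z|%:E)%E.
have mC : measurable_fun setT (fun z => `|directional v z|%:E).
  apply/measurable_EFinP/measurableT_comp => //; exact: measurable_directional.
have Cfin : (C < +oo)%E.
  by have /integrableP[_] := integrable_directional v.
apply: (@le_lt_trans _ _ (\int[mu]_t ((U t)%:E * C))%E).
  apply: ge0_le_integral => //=.
  - by move=> t _; exact: integral_ge0.
  - apply: (@measurable_fun_fubini_tonelli_G _ _ _ _ _ leb2 (fun x : plane R * measurableTypeR R => `|(segment_grad x.1 x.2)%:E|%E)).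
      by apply/measurableT_comp => //; apply/measurable_EFinP; exact: measurable_segment_grad.
    by [].
  - by apply: emeasurable_funM; [exact/measurable_EFinP|exact: measurable_cst].
  move=> t _; have [t01|t01] := pselect (0 <= t <= 1); last first.
    rewrite U0// mul0e integral0_eq// => z _.
    by rewrite /segment_grad U0// mul0r mulr0 normr0.
  have CE : C = (\int[leb2]_z `|directional v (z + t *: v)%R|%:E)%E.
    have := @ge0_integral_shift2 _ (t *: v) setT _ measurableT mC.
    by rewrite (preimage_setT (fun z : plane R => z + t *: v)); apply.
  rewrite U1// mul1e CE.
  apply: ge0_le_integral => //=.
  - apply/measurable_EFinP/measurableT_comp => //.
    have := measurableT_comp measurable_segment_grad (pair2_measurable t); exact.
  - by apply: (measurableT_comp mC); exact: measurable_shift2.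
  move=> z _; rewrite lee_fin /segment_grad U1// mul1r normrM.
  by rewrite ler_piMl// indicE; case: (_ \in _); rewrite ?normr1 ?normr0.
have C0 : (0 <= C)%E by exact: integral_ge0.
have mUE : measurable_fun setT (fun t => (U t)%:E) by exact/measurable_EFinP.
have UE0 : forall t, setT t -> (0 <= (U t)%:E)%E by move=> t _; rewrite lee_fin.
rewrite (ge0_integralZr mu measurableT mUE UE0 C0).
by rewrite integral_indic01 mul1e.
Qed.

Let rect_sub p' : p.1 <= p'.1 -> p.2 <= p'.2 -> rect p' q `<=` rect p q.
Proof. by move=> h1 h2 z [z1 z2 z3 z4]; split => //; [exact: le_lt_trans z1|exact: le_lt_trans z3]. Qed.

Let crect_sub p' : p.1 <= p'.1 -> p.2 <= p'.2 -> crect p' q `<=` crect p q.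
Proof. by move=> h1 h2 z [z1 z2 z3 z4]; split => //; [exact: le_trans z1|exact: le_trans z3]. Qed.

(** The fundamental theorem of calculus for [k], tested against a bump. It is applied to the bump,
    which is smooth enough, along - v; Fubini's theorem then isolates each t, where the weak
    gradient moves the derivative onto [k], and a translation by t v brings the bump back. *)
Lemma segment_identity p' n : p.1 <= p'.1 -> p.2 <= p'.2 ->
  (\int[leb2]_z ((k (z + v) - k z) * rect_bump p' q n z)%:E =
   \int[leb2]_z (fine (\int[mu]_t (segment_grad z t)%:E) * rect_bump p' q n z)%:E)%E.
Proof.
move=> pp1 pp2; set psi := rect_bump p' q n.
have Cpsi := C1_C1d (C1_bump p' q n); rewrite -/psi in Cpsi.
have cpsi : continuous psi := C1d_continuous Cpsi.
have [_ _ cdpsi] := Cpsi.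
have mpsi : measurable_fun setT psi.
  by apply: continuous_measurable_plane => //; exact: continuous_subspaceT.
have cpsi' : continuous (fun z : plane R => psi (z - v)).
  by move=> z; apply: (@continuous_comp _ _ _ (fun z : plane R => z - v) psi); [apply: cvgB; [exact: cvg_id|exact: cvg_cst]|exact: cpsi].
pose D (z : plane R) (t : measurableTypeR R) : R := 'D_(- v) psi (z + t *: (- v)).
pose h (x : plane R * measurableTypeR R) : R := k x.1 * (U x.2 * D x.1 x.2).
have mD : measurable_fun setT (fun x : plane R * measurableTypeR R => D x.1 x.2).
  apply: (@measurableT_comp _ _ _ _ _ _ (fun z : plane R => 'D_(- v) psi z)).
    by apply: continuous_measurable_plane => //; apply: continuous_subspaceT; exact: cdpsi.
  exact: measurable_segment.
have mh : measurable_fun setT h.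
  apply: measurable_funM; first exact: measurableT_comp.
  by apply: measurable_funM => //; exact: measurableT_comp.
have ih : prodm.-integrable setT (EFin \o h).
  have [M hM] : exists M, forall x : plane R * R, (disk `*` `[0, 1]%classic) x -> `|D x.1 x.2| <= M.
    apply: (@bounded_compact R (plane R * R)%type (fun x => D x.1 x.2)).
      by apply: compact_setX; [exact: compact_disk|exact: segment_compact].
    apply: continuous_subspaceT => x.
    apply: (@continuous_comp _ _ _ (fun x : plane R * R => x.1 + x.2 *: (- v)) (fun z : plane R => 'D_(- v) psi z)); last exact: cdpsi.
    apply: cvgD; first exact: cvg_fst.
    by apply: cvgZr_tmp; exact: cvg_snd.
  have iB : prodm.-integrable setT (EFin \o (\1_((@disk R) `*` (`[0, 1]%classic : set (measurableTypeR R))) : plane R * measurableTypeR R -> R)).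
    apply: integrable_indic_lty; first by apply: measurableX => //; exact: measurable_disk.
    apply: le_lt_trans (@leb2_disk_fin R).
    rewrite le_eqVlt; apply/orP; left; apply/eqP.
    apply: etrans (product_measure1E leb2 (@lebesgue_measure R) (@measurable_disk R) Uitv) _.
    apply: etrans (mule1 _); congr (_ * _)%E; exact: lebesgue_measure01.
  apply: (integrable_le _ mh (integrableZR `|M| _ iB)) => //.
  move=> [z t] _; rewrite /h/= indicE.
  case: (boolP (_ \in _)) => [|].
    rewrite inE => -[/= dz]; rewrite in_itv/= => t01.
    rewrite mulr1 !normrM U1// normr1 mul1r.
    rewrite (le_trans (ler_piMl _ (k1 z)))//.
    by rewrite (le_trans (hM (z, t) _)) ?ler_norm//; split => //=; rewrite in_itv.
  rewrite notin_setE => hzt; have [dz|/kout ->] := pselect (disk z); last by rewrite mul0r normr0 mulr0.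
  rewrite U0 ?mul0r ?mulr0 ?normr0// => t01; apply: hzt; split => //.
have S1 : (\int[leb2]_z (k z * (psi (z - v) - psi z))%:E = \int[leb2]_z \int[mu]_t (h (z, t))%:E)%E.
  apply: eq_integral => z _.
  have := C1d_FTC z (- v) Cpsi; rewrite integral_mkcond => E.
  rewrite EFinM -E -integralZl//.
    apply: eq_integral => t _; rewrite /h/= /D /U patchE indicE.
    by case: (_ \in _); rewrite ?mul1r -?EFinM//= ?mule0 mul0r mulr0.
  apply/(integrable_mkcond _ Uitv).
  apply: continuous_compact_integrable; first exact: segment_compact.
  apply: continuous_subspaceT => t; apply: (@continuous_comp _ _ _ (fun t : R => z + t *: (- v)) (fun z : plane R => 'D_(- v) psi z)).
    exact: continuous_segment.
  exact: cdpsi.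
have S2 : (\int[leb2]_z \int[mu]_t (h (z, t))%:E = \int[mu]_t \int[leb2]_z (h (z, t))%:E)%E.
  exact: Fubini ih.
pose h2 (x : plane R * measurableTypeR R) : R := segment_grad x.1 x.2 * psi x.1.
have S3 : (\int[mu]_t \int[leb2]_z (h (z, t))%:E = \int[mu]_t \int[leb2]_z (h2 (z, t))%:E)%E.
  apply: eq_integral => t _; have [t01|t01] := pselect (0 <= t <= 1); last first.
    apply: eq_integral => z _; rewrite /h/= /h2/= /segment_grad U0//.
    by rewrite !mul0r !mulr0 mul0r.
  (* The bump carried along by t v. By [Hpq] its support stays inside the open disk, which makes it
     an admissible test function for every t in [0, 1]. *)
  pose psit := rect_bump (p' + t *: v) (q + t *: v) n.
  have psitE z : psit z = psi (z + t *: (- v)) by rewrite /psit -rect_bump_shift scalerN.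
  have tpsit : test_function psit.
    apply: test_function_bump => z [z1 z2 z3 z4].
    rewrite -(subrK (t *: v) z); apply: Hpq => //; apply: (crect_sub pp1 pp2).
    split; [rewrite lerBrDr//|rewrite lerBlDr//|rewrite lerBrDr//|rewrite lerBlDr//].
  transitivity (\int[leb2]_z (k z * 'D_(- v) psit z)%:E)%E.
    apply: eq_integral => z _; rewrite /h/= U1// mul1r /D.
    by rewrite (funext psitE : psit = fun y => psi (y + t *: (- v))) derive_shift.
  rewrite weak_directional//.
  transitivity (\int[leb2]_z (directional v z * psi (z + t *: (- v)))%:E)%E.
    apply: eq_integral => z _; rewrite psitE /directional !big_ord_recl !big_ord0 /coord/=.
    by congr EFin; ring.
  rewrite (@integral_shift2 _ (t *: v) (fun z => (directional v z * psi (z + t *: (- v)))%:E)); last first.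
    apply/measurable_EFinP; apply: measurable_funM; first exact: measurable_directional.
    apply: (measurableT_comp mpsi); exact: measurable_shift2.
  apply: eq_integral => z _; rewrite /h2/= /segment_grad U1// mul1r.
  rewrite scalerN addrK indicE; case: (boolP (z \in P)) => [_|]; first by rewrite mul1r.
  rewrite notin_setE => zP; rewrite /psi bump_out ?mulr0//.
  by move/(rect_sub pp1 pp2).
have ih2 : prodm.-integrable setT (EFin \o h2).
  apply: (integrable_mul_bounded (M := 1) _ integrable_segment_grad) => //.
    exact: (measurableT_comp mpsi).
  move=> [z t] _ _; have /andP[b0 b1] := bump_ge0 p' q n z.
  by rewrite ger0_norm.
have S4 : (\int[mu]_t \int[leb2]_z (h2 (z, t))%:E = \int[leb2]_z \int[mu]_t (h2 (z, t))%:E)%E.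
  exact/esym/(Fubini ih2).
have S5 : (\int[leb2]_z \int[mu]_t (h2 (z, t))%:E = \int[leb2]_z (fine (\int[mu]_t (segment_grad z t)%:E) * psi z)%:E)%E.
  apply: ae_eq_integral.
  - exact: measurableT.
  - exact: (measurable_fubini_F ih2).
  - apply/measurable_EFinP; apply: measurable_funM => //.
    by apply: measurableT_comp => //; exact: (measurable_fubini_F integrable_segment_grad).
  (* For almost every z the integral over the segment is finite, so that [fine] loses nothing. *)
  have := ae_integrable1 integrable_segment_grad; apply: filterS => z iz _.
  rewrite EFinM fineK; last exact: integrable_fin_num.
  by rewrite -integralZr.
have ipsi : leb2.-integrable setT (EFin \o psi).
  apply: (integrable_le _ mpsi iindd) => // z _; rewrite /indd indicE.
  have [zr|zr] := pselect (rect p' q z); last by rewrite /psi bump_out// normr0.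
  have /andP[b0 b1] := bump_ge0 p' q n z.
  rewrite mem_set ?ger0_norm//; apply/ltW; rewrite -(addr0 z) -(scale0r v).
  by apply: Hpq; [apply: (crect_sub pp1 pp2); exact: rect_crect|rewrite lexx ler01].
rewrite -S5 -S4 -S3 -S2 -S1.
have mkv : measurable_fun setT (fun z : plane R => k (z + v)).
  by apply: (measurableT_comp mk); exact: measurable_shift2.
have ikv : leb2.-integrable setT (EFin \o (fun z : plane R => psi z * k (z + v))).
  by apply: (integrable_mul_bounded (M := 1) _ ipsi).
under eq_integral do rewrite mulrBl mulrC.
rewrite (integralB_EFin measurableT ikv (integrable_kM cpsi)).
under [RHS]eq_integral do rewrite mulrBr.
rewrite [RHS](integralB_EFin measurableT (integrable_kM cpsi') (integrable_kM cpsi)).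
congr (_ - _)%E.
(* The translation by v turns k(z) psi(z - v) into k(z + v) psi(z). *)
rewrite [RHS](@integral_shift2 _ v (fun z => (k z * psi (z - v))%:E)).
  by apply: eq_integral => z _; rewrite addrK mulrC.
apply/measurable_EFinP; apply: measurable_funM => //.
apply: (measurableT_comp mpsi); exact: measurable_shift2.
Qed.

End rectangle.

End translation_estimate.

Section translation_estimate.
Context {R : realType}.
Local Notation mu := (@lebesgue_measure R).
Variables (k : plane R -> R) (g : 'I_2 -> plane R -> R).
Hypothesis mk : measurable_fun setT k.
Hypothesis k1 : forall z, `|k z| <= 1.
Hypothesis kout : forall z, ~ disk z -> k z = 0.
Hypothesis mg : forall alpha, measurable_fun setT (g alpha).
Hypothesis gout : forall alpha z, ~ disk z -> g alpha z = 0.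
Hypothesis ig2 : forall alpha, leb2.-integrable setT (EFin \o (fun z => g alpha z ^+ 2)).
Hypothesis weak : forall alpha psi, test_function psi ->
  (\int[leb2]_z (k z * 'D_(basis alpha : plane R) psi z) = - \int[leb2]_z (g alpha z * psi z))%R.

Variables (p q v : plane R).
Hypothesis Hpq : forall z t, crect p q z -> 0 <= t <= 1 -> sqnorm (z + t *: v) < 1.

Local Notation P := (rect p q).
Local Notation sg := (segment_grad g p q v).
Let msg := measurable_segment_grad mg p q v.
Let isg := integrable_segment_grad mg gout ig2 p q v.

Let mP : measurable P. Proof. exact: measurable_rect. Qed.

Let Pdisk : P `<=` disk.
Proof.
move=> z /rect_crect zP; apply/ltW; rewrite -(addr0 z) -(scale0r v).
by apply: Hpq => //; rewrite lexx ler01.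
Qed.

Let iP : leb2.-integrable setT (EFin \o (\1_P : plane R -> R)).
Proof.
apply: integrable_indic_lty => //; apply: le_lt_trans leb2_disk_fin.
by apply: le_measure; rewrite ?inE//; exact: measurable_disk.
Qed.

Let Gamma (z : plane R) : R := fine (\int[mu]_t (sg z t)%:E).

Let mGamma : measurable_fun setT Gamma.
Proof. by apply: measurableT_comp => //; exact: (measurable_fubini_F isg). Qed.

Let iGamma : leb2.-integrable setT (EFin \o Gamma).
Proof.
apply: le_integrable (integrable_fubini_F isg) => //; first exact/measurable_EFinP.
move=> z _ /=; rewrite /Gamma /fubini_F.
by case: (integral _ _ _) => [r||] /=; rewrite ?normr0 ?leey.
Qed.

Let W z := k (z + v) - k z.

Let mW : measurable_fun setT W.
Proof. by apply: measurable_funB => //; apply: (measurableT_comp mk); exact: measurable_shift2. Qed.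

Let iW : leb2.-integrable setT (EFin \o (fun z => \1_P z * W z)).
Proof.
apply: (integrable_mul_bounded (M := 2) _ iP) => // z _ _.
rewrite /W (le_trans (ler_normB _ _))//.
by have := k1 (z + v); have := k1 z; lra.
Qed.

(** [segment_identity] says that the difference of the two sides is orthogonal to every bump whose
    upper right corner is [q], and the difference vanishes off [rect p q]: this is the situation of
    [integral_rect_ae_eq0]. *)
Lemma segment_grad_ae : ae_eq leb2 setT (fun z => \1_P z * W z) Gamma.
Proof.
have : ae_eq leb2 setT (fun z => \1_P z * W z - Gamma z) (cst 0).
  apply: (@integral_rect_ae_eq0 _ p q).
  - exact: integrableBR.
  - move=> z zP; rewrite indicE memNset// mul0r /Gamma integral0_eq ?subrr// => t _.
    by rewrite /segment_grad indicE memNset// mul0r.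
  - move=> p' n pp1 pp2; have := segment_identity mk k1 kout mg gout ig2 weak Hpq n pp1 pp2.
    rewrite -/Gamma => E.
    have mb : measurable_fun setT (rect_bump p' q n).
      apply: continuous_measurable_plane => //; apply: continuous_subspaceT.
      exact: (C1d_continuous (C1_C1d (C1_bump p' q n))).
    have b1 z : `|rect_bump p' q n z| <= 1.
      by have /andP[b0 b1] := bump_ge0 p' q n z; rewrite ger0_norm.
    under eq_integral do rewrite mulrBl.
    rewrite integralB_EFin//=; [|exact: (integrable_mul_bounded (M := 1))..].
    rewrite -E (_ : (\int[leb2]_x _)%E = (\int[leb2]_z ((k (z + v) - k z) * rect_bump p' q n z)%:E)%E).
      rewrite subee// E; apply: integrable_fin_num => //.
      exact: (integrable_mul_bounded (M := 1)).
    apply: eq_integral => z _; rewrite indicE; case: (boolP (z \in P)) => [|]; first by rewrite mul1r.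
    rewrite notin_setE => zP; rewrite bump_out ?mulr0// => -[h1 h2 h3 h4]; apply: zP.
    by split => //; [exact: le_lt_trans h1|exact: le_lt_trans h3].
by apply: filterS => z /(_ I)/eqP; rewrite subr_eq0 => /eqP.
Qed.

(** Jensen's inequality in t bounds the squared difference by the average over the segment of the
    squared derivative. After Tonelli, each t contributes at most the integral over [S], by
    translation invariance and because the segments issued from [P] stay in [S]. *)
Lemma translation_estimate (S : set (plane R)) : measurable S ->
  (forall z t, P z -> 0 <= t <= 1 -> S (z + t *: v)) ->
  (\int[leb2]_(z in P) ((k (z + v) - k z) ^+ 2)%:E <=
   \int[leb2]_(z in S) (directional g v z ^+ 2)%:E)%E.
Proof.
move=> mS PS.
have msg2 : measurable_fun setT (fun x : plane R * measurableTypeR R => (sg x.1 x.2 ^+ 2)%:E).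
  by apply/measurable_EFinP; exact: measurable_funX.
apply: (@le_trans _ _ (\int[leb2]_z \int[mu]_t (sg z t ^+ 2)%:E)%E).
  rewrite integral_mkcond; apply: ae_ge0_le_integral => //=.
  - by move=> z _; rewrite patchE; case: ifP => // _; rewrite lee_fin sqr_ge0.
  - apply/(measurable_restrictT _ mP); apply: measurable_funTS.
    by apply/measurable_EFinP; exact: measurable_funX.
  - by move=> z _; apply: integral_ge0 => t _; rewrite lee_fin sqr_ge0.
  - by apply: (measurable_fun_fubini_tonelli_F _ msg2) => x; rewrite lee_fin sqr_ge0.
  have := segment_grad_ae; have := ae_integrable1 isg.
  apply: filterS2 => z iz Ez _; rewrite patchE.
  have -> : (if z \in P then ((k (z + v) - k z) ^+ 2)%:E else 0%E) = (Gamma z ^+ 2)%:E.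
    by rewrite -Ez// /W indicE; case: (z \in P); rewrite ?mul1r// mul0r expr0n.
  apply: sqr_integral_le => // t t01.
  exact: segment_grad_out.
rewrite (fubini_tonelli (fun x : plane R * measurableTypeR R => (sg x.1 x.2 ^+ 2)%:E))//=; last first.
  by move=> x; rewrite lee_fin sqr_ge0.
set C := (X in (_ <= X)%E).
have C0 : (0 <= C)%E by apply: integral_ge0 => z _; rewrite lee_fin sqr_ge0.
have md2 : measurable_fun setT (fun z => (directional g v z ^+ 2)%:E).
  by apply/measurable_EFinP; apply: measurable_funX; exact: measurable_directional.
pose U : measurableTypeR R -> R := \1_(`[0, 1]%classic : set (measurableTypeR R)).
have mU : measurable_fun setT (fun t => (U t)%:E) by apply/measurable_EFinP; exact: measurable_indic.
apply: (@le_trans _ _ (\int[mu]_t ((U t)%:E * C))%E); last first.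
  rewrite (ge0_integralZr mu measurableT mU _ C0); last by move=> t _; rewrite lee_fin.
  by rewrite integral_indic01 mul1e.
apply: ge0_le_integral => //=.
- by move=> t _; apply: integral_ge0 => z _; rewrite lee_fin sqr_ge0.
- by apply: (measurable_fun_fubini_tonelli_G _ msg2) => x; rewrite lee_fin sqr_ge0.
- by apply: emeasurable_funM => //; exact: measurable_cst.
move=> t _; have [t01|t01] := pselect (0 <= t <= 1); last first.
  rewrite integral0_eq => [|z _]; first by rewrite mule_ge0// lee_fin.
  by rewrite segment_grad_out// expr0n.
have -> : U t = 1 by rewrite /U indicE mem_set//= in_itv.
rewrite mul1e /C [X in (_ <= X)%E]integral_mkcond.
have mSd : measurable_fun setT ((fun z => (directional g v z ^+ 2)%:E) \_ S).
  by apply/(measurable_restrictT _ mS); exact: measurable_funTS.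
have Sd0 z : (0 <= ((fun z => (directional g v z ^+ 2)%:E) \_ S) z)%E.
  by rewrite patchE; case: ifP => // _; rewrite lee_fin sqr_ge0.
have := @ge0_integral_shift2 _ (t *: v) setT _ measurableT mSd (fun z _ => Sd0 z).
rewrite (preimage_setT (fun z : plane R => z + t *: v)) => E.
apply: (@le_trans _ _ (\int[leb2]_z (((fun z => (directional g v z ^+ 2)%:E) \_ S) (z + t *: v)%R))%E); last first.
  by rewrite le_eqVlt; apply/orP; left; apply/eqP; exact/esym/E.
apply: ge0_le_integral => //=.
- by move=> z _; rewrite lee_fin sqr_ge0.
- by have := measurableT_comp msg2 (pair2_measurable t); exact.
- by have := measurableT_comp mSd (measurable_shift2 (t *: v)); exact.
move=> z _; rewrite patchE segment_grad_in// indicE; case: (boolP (z \in P)) => [|_].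
  by rewrite inE => /PS /(_ t01) h; rewrite mem_set// !mul1r.
by rewrite mul0r expr0n/=; case: ifP => // _; rewrite lee_fin sqr_ge0.
Qed.

End translation_estimate.

(** * The Poincare inequality on a square *)

Section poincare.
Context {R : realType}.
Local Notation mu := (@lebesgue_measure R).
Variables (k : plane R -> R) (g : 'I_2 -> plane R -> R).
Hypothesis mk : measurable_fun setT k.
Hypothesis k1 : forall z, `|k z| <= 1.
Hypothesis kout : forall z, ~ disk z -> k z = 0.
Hypothesis mg : forall alpha, measurable_fun setT (g alpha).
Hypothesis gout : forall alpha z, ~ disk z -> g alpha z = 0.
Hypothesis ig2 : forall alpha, leb2.-integrable setT (EFin \o (fun z => g alpha z ^+ 2)).
Hypothesis weak : forall alpha psi, test_function psi ->
  (\int[leb2]_z (k z * 'D_(basis alpha : plane R) psi z) = - \int[leb2]_z (g alpha z * psi z))%R.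

Variables (c : plane R) (d : R).
Let Q : set (plane R) := rect (c - (d, d)) (c + (d, d)).
Hypothesis d0 : 0 < d.
Hypothesis Qdisk : forall z, crect (c - (d, d)) (c + (d, d)) z -> sqnorm z < 1.

Let mQ : measurable Q. Proof. exact: measurable_rect. Qed.

Let A : \bar R := (\int[leb2]_(z in Q) (g ord0 z ^+ 2 + g (lift ord0 ord0) z ^+ 2)%:E)%E.

Let weight_ge0 (V : set (plane R)) v : (0 <= (8 * d ^+ 2 * \1_V v)%:E)%E.
Proof.
rewrite lee_fin indicE; apply: mulr_ge0; last exact: ler0n.
by apply: mulr_ge0 => //; exact: sqr_ge0.
Qed.

(** Both z and z + v lie in the square only if each coordinate of v is less than 2d in absolute
    value; then |v|^2 <= 8 d^2, and Cauchy-Schwarz bounds the squared derivative along v by 8 d^2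
    times the squared gradient. *)
Lemma difference_energy (v : plane R) :
  (\int[leb2]_z (\1_Q z * \1_Q (z + v) * (k (z + v) - k z) ^+ 2)%:E
    <= (8 * d ^+ 2 * \1_(rect (- (2 * d), - (2 * d)) (2 * d, 2 * d)) v)%:E * A)%E.
Proof.
have A0 : (0 <= A)%E by apply: integral_ge0 => z _; rewrite lee_fin addr_ge0// sqr_ge0.
have [vsmall|vbig] := pselect (rect (- (2 * d), - (2 * d)) (2 * d, 2 * d) v); last first.
  rewrite integral0_eq => [|z _].
    by apply: mule_ge0 => //; exact: weight_ge0.
  rewrite !indicE.
  have [zQ|zQ] := pselect (Q z); last by rewrite [z \in Q]memNset// !mul0r.
  have [zvQ|zvQ] := pselect (Q (z + v)); last by rewrite [z + v \in Q]memNset// mulr0 mul0r.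
  exfalso; apply: vbig; move: zQ zvQ; rewrite /Q /rect/= => -[? ? ? ?] [? ? ? ?].
  by split; lra.
rewrite [\1_(rect _ _) v]indicE mem_set// mulr1.
(* The rectangle of corners [p] and [q] is the intersection of [Q] with [Q] - v; by convexity the
   segments from z to z + v stay in [Q]. *)
pose p : plane R := (Num.max (c.1 - d) (c.1 - d - v.1), Num.max (c.2 - d) (c.2 - d - v.2)).
pose q : plane R := (Num.min (c.1 + d) (c.1 + d - v.1), Num.min (c.2 + d) (c.2 + d - v.2)).
have PE z : rect p q z <-> Q z /\ Q (z + v).
  rewrite /Q /rect /= !gt_max !lt_min; split.
    by move=> [/andP[? ?] /andP[? ?] /andP[? ?] /andP[? ?]]; split; split => //=; lra.
  by move=> [[? ? ? ?] [? ? ? ?]]; split; apply/andP; split; lra.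
have PC z : crect p q z -> crect (c - (d, d)) (c + (d, d)) z /\ crect (c - (d, d)) (c + (d, d)) (z + v).
  rewrite /crect /= !ge_max !le_min.
  by move=> [/andP[? ?] /andP[? ?] /andP[? ?] /andP[? ?]]; split; split => //=; lra.
have conv t (a b x y : R) : 0 <= t <= 1 -> a <= x <= b -> a <= x + y <= b -> a <= x + t * y <= b.
  move=> /andP[t0 t1] /andP[ax xb] /andP[axy xyb].
  have h1 : 0 <= t * (x + y - a) by rewrite mulr_ge0// subr_ge0.
  have h2 : 0 <= t * (b - (x + y)) by rewrite mulr_ge0// subr_ge0.
  have h3 : 0 <= (1 - t) * (x - a) by rewrite mulr_ge0// subr_ge0.
  have h4 : 0 <= (1 - t) * (b - x) by rewrite mulr_ge0// subr_ge0.
  by apply/andP; split; nra.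
have convs t (a b x y : R) : 0 <= t <= 1 -> a < x < b -> a < x + y < b -> a < x + t * y < b.
  move=> /andP[t0 t1] /andP[ax xb] /andP[axy xyb].
  have [->|tn0] := eqVneq t 0; first by rewrite mul0r addr0 ax.
  have tp : 0 < t by rewrite lt_neqAle eq_sym tn0.
  have h1 : 0 < t * (x + y - a) by rewrite mulr_gt0// subr_gt0.
  have h2 : 0 < t * (b - (x + y)) by rewrite mulr_gt0// subr_gt0.
  have h3 : 0 <= (1 - t) * (x - a) by rewrite mulr_ge0// subr_ge0// ltW.
  have h4 : 0 <= (1 - t) * (b - x) by rewrite mulr_ge0// subr_ge0// ltW.
  by apply/andP; split; nra.
have Hpq z t : crect p q z -> 0 <= t <= 1 -> sqnorm (z + t *: v) < 1.
  move=> /PC [[h1 h2 h3 h4] [h5 h6 h7 h8]] t01; apply: Qdisk.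
  have /andP[? ?] := conv t _ _ z.1 v.1 t01 (introT andP (conj h1 h2)) (introT andP (conj h5 h6)).
  have /andP[? ?] := conv t _ _ z.2 v.2 t01 (introT andP (conj h3 h4)) (introT andP (conj h7 h8)).
  by split.
have PQ z t : rect p q z -> 0 <= t <= 1 -> Q (z + t *: v).
  move=> /PE [[h1 h2 h3 h4] [h5 h6 h7 h8]] t01.
  have /andP[? ?] := convs t _ _ z.1 v.1 t01 (introT andP (conj h1 h2)) (introT andP (conj h5 h6)).
  have /andP[? ?] := convs t _ _ z.2 v.2 t01 (introT andP (conj h3 h4)) (introT andP (conj h7 h8)).
  by split.
have mdir : measurable_fun setT (fun z => (directional g v z ^+ 2)%:E).
  by apply/measurable_EFinP; apply: measurable_funX; exact: measurable_directional.
have mgg : measurable_fun setT (fun z => (g ord0 z ^+ 2 + g (lift ord0 ord0) z ^+ 2)%:E).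
  by apply/measurable_EFinP; apply: measurable_funD; exact: measurable_funX.
rewrite (_ : (\int[leb2]_z _)%E = (\int[leb2]_(z in rect p q) ((k (z + v) - k z) ^+ 2)%:E)%E); last first.
  rewrite [RHS]integral_mkcond; apply: eq_integral => z _; rewrite patchE !indicE.
  have [/[dup] zP /PE [z1 z2]|zP] := pselect (rect p q z).
    by rewrite [z \in rect p q]mem_set// !mem_set// !mul1r.
  rewrite [z \in rect p q]memNset//.
  have [zQ|zQ] := pselect (Q z); last by rewrite [z \in Q]memNset// !mul0r.
  have [zvQ|zvQ] := pselect (Q (z + v)); last by rewrite [z + v \in Q]memNset// mulr0 mul0r.
  by exfalso; apply: zP; apply/PE.
apply: le_trans (translation_estimate mk k1 kout mg gout ig2 weak Hpq mQ PQ) _.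
rewrite -ge0_integralZl//; last 3 first.
- exact: measurable_funTS.
- by move=> z _; rewrite lee_fin addr_ge0// sqr_ge0.
- by rewrite lee_fin mulr_ge0// sqr_ge0.
apply: ge0_le_integral => //.
- by move=> z _; rewrite lee_fin sqr_ge0.
- exact: measurable_funTS.
- by apply: emeasurable_funM; [exact: measurable_cst|exact: measurable_funTS].
move=> z _; rewrite -EFinM lee_fin /directional big_ord_recl big_ord1 /coord/=.
move: vsmall; rewrite /rect/= => -[].
move: (g _ z) (g _ z) (v.1 : R) (v.2 : R) => a b x y x1 x2 y1 y2.
have x8 : x ^+ 2 <= 4 * d ^+ 2 by nra.
have y8 : y ^+ 2 <= 4 * d ^+ 2 by nra.
apply: (@le_trans _ _ ((x ^+ 2 + y ^+ 2) * (b ^+ 2 + a ^+ 2))).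
  by have := sqr_ge0 (x * a - y * b); nra.
by apply: ler_wpM2r; [rewrite addr_ge0// sqr_ge0|lra].
Qed.

(** Substitute w = z + v and integrate [difference_energy] over v, which ranges in a square of side
    4d: the constant is 8 d^2 times 16 d^2. *)
Lemma poincare :
  (\int[leb2]_z \int[leb2]_w (\1_Q z * \1_Q w * (k w - k z) ^+ 2)%:E <= (128 * d ^+ 4)%:E * A)%E.
Proof.
have A0 : (0 <= A)%E by apply: integral_ge0 => z _; rewrite lee_fin addr_ge0// sqr_ge0.
have m1Q : measurable_fun setT (\1_Q : plane R -> R) by exact: measurable_indic.
have madd : measurable_fun setT (fun x : plane R * plane R => x.1 + x.2 : plane R).
  apply: measurable_fun_pair => /=.
    by apply: measurable_funD; [exact: (measurableT_comp measurable_fst measurable_fst)|exact: (measurableT_comp measurable_fst measurable_snd)].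
  by apply: measurable_funD; [exact: (measurableT_comp measurable_snd measurable_fst)|exact: (measurableT_comp measurable_snd measurable_snd)].
pose H (x : plane R * plane R) : \bar R := (\1_Q x.1 * \1_Q (x.1 + x.2) * (k (x.1 + x.2) - k x.1) ^+ 2)%:E.
have mH : measurable_fun setT H.
  apply/measurable_EFinP; apply: measurable_funM.
    by apply: measurable_funM; apply: measurableT_comp.
  by apply: measurable_funX; apply: measurable_funB; apply: measurableT_comp.
have H0 x : (0 <= H x)%E.
  rewrite lee_fin !indicE; apply: mulr_ge0; last exact: sqr_ge0.
  by apply: mulr_ge0; exact: ler0n.
rewrite (_ : (\int[leb2]_z _)%E = (\int[leb2]_z \int[leb2]_v H (z, v))%E); last first.
  apply: eq_integral => z _.
  rewrite (@integral_shift2 _ z (fun w => (\1_Q z * \1_Q w * (k w - k z) ^+ 2)%:E)).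
    by apply: eq_integral => v _; rewrite /H/= [v + z]addrC.
  apply/measurable_EFinP; apply: measurable_funM; first by apply: measurable_funM => //; exact: measurable_cst.
  by apply: measurable_funX; apply: measurable_funB => //; exact: measurable_cst.
rewrite (fubini_tonelli H)//.
pose V : set (plane R) := rect (- (2 * d), - (2 * d)) (2 * d, 2 * d).
have mV : measurable V by exact: measurable_rect.
have mindV : measurable_fun setT (fun v : plane R => (8 * d ^+ 2 * \1_V v)%:E).
  by apply/measurable_EFinP; apply: measurable_funM; [exact: measurable_cst|exact: measurable_indic].
apply: (@le_trans _ _ (\int[leb2]_v ((8 * d ^+ 2 * \1_V v)%:E * A))%E).
  apply: ge0_le_integral => //.
  - by move=> v _; apply: integral_ge0.
  - exact: (measurable_fun_fubini_tonelli_G _ mH).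
  - by apply: emeasurable_funM => //; exact: measurable_cst.
  by move=> v _; exact: difference_energy.
rewrite (ge0_integralZr leb2 measurableT mindV _ A0); last first.
  by move=> v _; exact: weight_ge0.
apply: lee_wpmul2r => //.
under eq_integral do rewrite EFinM.
have mF : measurable_fun setT (fun v : plane R => (\1_V v : R)%:E).
  by apply/measurable_EFinP; exact: measurable_indic.
rewrite (ge0_integralZl leb2 measurableT mF)//; last by rewrite lee_fin mulr_ge0// sqr_ge0.
have EV : leb2 V = ((4 * d) ^+ 2)%:E.
  rewrite /V rectE; apply: etrans (lebesgue2_rect _ _) _ => //.
  have E4 : @lebesgue_measure R (`]- (2 * d), (2 * d)[%classic : set (measurableTypeR R)) = (4 * d)%:E.
    apply: etrans (lebesgue_measure_itv `]- (2 * d), (2 * d)[) _.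
    have h2d : - (2 * d) < 2 * d by have := d0; lra.
    rewrite /= lte_fin h2d.
    by rewrite -EFinB; congr EFin; ring.
  by rewrite /= E4 -EFinM -expr2.
have -> : (\int[leb2]_v (\1_V v : R)%:E = ((4 * d) ^+ 2)%:E)%E.
  by rewrite integral_indic// setIT; exact: EV.
by rewrite -EFinM lee_fin; nra.
Qed.

(** Expanding the square in the double integral of K(z) K(w) (k(w) - k(z))^2 gives twice the product
    on the left, since the cross term is the square of the weighted mean of [k], which is 0. The
    weights are then bounded by the indicator of [Q]. *)
Lemma weighted_poincare (K : plane R -> R) : measurable_fun setT K ->
  (forall z, 0 <= K z <= 1) -> (forall z, ~ Q z -> K z = 0) ->
  (\int[leb2]_z (K z * k z)%:E = 0)%E ->
  ((2%:E * (\int[leb2]_z (K z)%:E) * (\int[leb2]_z (K z * k z ^+ 2)%:E)) <= (128 * d ^+ 4)%:E * A)%E.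
Proof.
move=> mK K01 Kout Kk0.
have KQ z : K z <= \1_Q z.
  rewrite indicE; have [zQ|zQ] := pselect (Q z); first by rewrite mem_set//; have /andP[] := K01 z.
  by rewrite Kout// memNset.
have K0 z : 0 <= K z by have /andP[] := K01 z.
have iQ : leb2.-integrable setT (EFin \o (\1_Q : plane R -> R)).
  apply: integrable_indic_lty => //; apply: le_lt_trans leb2_disk_fin.
  apply: le_measure; rewrite ?inE//; first exact: measurable_disk.
  by move=> z /rect_crect /Qdisk /ltW.
have iK : leb2.-integrable setT (EFin \o K).
  by apply: (integrable_le _ mK iQ) => // z _; rewrite ger0_norm.
have iKk : leb2.-integrable setT (EFin \o (fun z => K z * k z)).
  exact: (integrable_mul_bounded (M := 1) _ iK).
have k21 z : `|k z ^+ 2| <= 1 by rewrite normrX exprn_ile1.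
have iKk2 : leb2.-integrable setT (EFin \o (fun z => K z * k z ^+ 2)).
  by apply: (integrable_mul_bounded (M := 1) _ iK) => //; exact: measurable_funX.
set m := (\int[leb2]_z (K z)%:E)%E; set B := (\int[leb2]_z (K z * k z ^+ 2)%:E)%E.
have mE : m = (fine m)%:E by rewrite fineK//; exact: integrable_fin_num.
have BE : B = (fine B)%:E by rewrite fineK//; exact: integrable_fin_num.
have inner z : (\int[leb2]_w (K z * K w * (k w - k z) ^+ 2)%:E = (fine B * K z + fine m * (K z * k z ^+ 2))%:E)%E.
  transitivity (\int[leb2]_w (1 * (K z * (K w * k w ^+ 2) + (- 2 * K z * k z) * (K w * k w)) + (K z * k z ^+ 2) * K w)%:E)%E.
    by apply: eq_integral => w _; congr EFin; ring.
  rewrite integral_lincomb//; last by apply: integrableDR => //; exact: integrableZR.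
  rewrite integral_lincomb// Kk0 -/m -/B mule0 adde0 mul1e mE BE -!EFinM -EFinD.
  by congr EFin; rewrite /=; ring.
apply: le_trans poincare.
have mkk : measurable_fun setT (fun x : plane R * plane R => (k x.2 - k x.1) ^+ 2).
  by apply: measurable_funX; apply: measurable_funB; apply: measurableT_comp.
apply: (@le_trans _ _ (\int[leb2]_z \int[leb2]_w (K z * K w * (k w - k z) ^+ 2)%:E)%E).
  under [X in (_ <= X)%E]eq_integral do rewrite inner.
  rewrite integral_lincomb// -/m -/B mE BE -!EFinM -EFinD lee_fin /=.
  by rewrite le_eqVlt; apply/orP; left; apply/eqP; ring.
have mKK : measurable_fun setT (fun x : plane R * plane R => (K x.1 * K x.2 * (k x.2 - k x.1) ^+ 2)%:E).
  apply/measurable_EFinP; apply: measurable_funM => //.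
  by apply: measurable_funM; apply: measurableT_comp.
have mQQ : measurable_fun setT (fun x : plane R * plane R => (\1_Q x.1 * \1_Q x.2 * (k x.2 - k x.1) ^+ 2)%:E).
  have m1Q : measurable_fun setT (\1_Q : plane R -> R) by exact: measurable_indic.
  apply/measurable_EFinP; apply: measurable_funM => //.
  by apply: measurable_funM; apply: measurableT_comp.
have K0' (x : plane R * plane R) : (0 <= (K x.1 * K x.2 * (k x.2 - k x.1) ^+ 2)%:E)%E.
  by rewrite lee_fin; apply: mulr_ge0; [exact: mulr_ge0|exact: sqr_ge0].
have Q0' (x : plane R * plane R) : (0 <= (\1_Q x.1 * \1_Q x.2 * (k x.2 - k x.1) ^+ 2)%:E)%E.
  by rewrite lee_fin !indicE; apply: mulr_ge0; [exact: mulr_ge0|exact: sqr_ge0].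
apply: ge0_le_integral => //.
- by move=> z _; apply: integral_ge0 => w _; exact: (K0' (z, w)).
- exact: (measurable_fun_fubini_tonelli_F _ mKK).
- exact: (measurable_fun_fubini_tonelli_F _ mQQ).
move=> z _; apply: ge0_le_integral => //.
- by move=> w _; exact: (K0' (z, w)).
- by have := measurableT_comp mKK (pair1_measurable z); exact.
- by have := measurableT_comp mQQ (pair1_measurable z); exact.
move=> w _; rewrite lee_fin; apply: ler_wpM2r; first exact: sqr_ge0.
exact: ler_pM.
Qed.

End poincare.

(** * Approximate square roots in H^1 *)

Section tent.
Context {R : realType}.
Implicit Types (c z : plane R) (d : R).

Definition tent (x : R) : R := Num.max 0 (1 - `|x|).

Lemma tent01 x : 0 <= tent x <= 1.
Proof.
rewrite /tent le_max lexx/= ge_max ler01/= lerBlDr lerDl normr_ge0//.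
Qed.

Lemma tent_out x : 1 <= `|x| -> tent x = 0.
Proof. by move=> x1; rewrite /tent max_l// subr_le0. Qed.

Lemma tent_ge x : `|x| <= 2^-1 -> 2^-1 <= tent x.
Proof. by move=> x1; rewrite /tent le_max; apply/orP; right; lra. Qed.

Lemma tent_lip x y : `|tent x - tent y| <= `|x - y|.
Proof.
rewrite /tent; have := lerB_dist x y; have := lerB_dist y x; rewrite (distrC y x).
move: (`|x - y|) `|x| `|y| => a b c h1 h2.
by rewrite ler_norml /Num.max; case: ltP => ?; case: ltP => ?; apply/andP; split; lra.
Qed.

Lemma measurable_tent : measurable_fun setT tent.
Proof.
apply: measurable_maxr; first exact: measurable_cst.
by apply: measurable_funB => //; exact: measurableT_comp.
Qed.

(** A weight on the square of centre [c] and half-side [d] that is Lipschitz in [c]: the averages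
    must depend continuously on the centre for the intermediate value theorem to apply. *)
Definition tent2 d c z : R := tent ((z.1 - c.1) / d) * tent ((z.2 - c.2) / d).

Lemma tent201 d c z : 0 <= tent2 d c z <= 1.
Proof.
have /andP[a0 a1] := tent01 ((z.1 - c.1) / d).
have /andP[b0 b1] := tent01 ((z.2 - c.2) / d).
by rewrite /tent2 mulr_ge0//= mulr_ile1.
Qed.

Lemma tent2_out d c z : 0 < d -> ~ rect (c - (d, d)) (c + (d, d)) z -> tent2 d c z = 0.
Proof.
move=> d0 zQ; rewrite /tent2.
have E x : 1 <= `|x / d| \/ - d < x < d.
  rewrite normrM normfV (gtr0_norm d0) ler_pdivlMr// mul1r.
  by case: (leP d `|x|) => [|]; [left|rewrite ltr_norml; right].
case: (E (z.1 - c.1)) => [/tent_out ->|/andP[h1 h2]]; first by rewrite mul0r.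
case: (E (z.2 - c.2)) => [/tent_out ->|/andP[h3 h4]]; first by rewrite mulr0.
by exfalso; apply: zQ; split => /=; lra.
Qed.

Lemma tent2_ge d c z : 0 < d -> rect (c - (d / 2, d / 2)) (c + (d / 2, d / 2)) z -> 4^-1 <= tent2 d c z.
Proof.
move=> d0 [/= h1 h2 h3 h4].
have E x : - (d / 2) < x < d / 2 -> 2^-1 <= tent (x / d).
  move=> /andP[x1 x2]; apply: tent_ge.
  rewrite normrM normfV (gtr0_norm d0) ler_pdivrMr// ler_norml.
  by apply/andP; split; lra.
have e1 := E (z.1 - c.1) ltac:(apply/andP; split; lra).
have e2 := E (z.2 - c.2) ltac:(apply/andP; split; lra).
by rewrite /tent2; move: e1 e2; move: (tent _) (tent _) => a b; nra.
Qed.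

Lemma tent2_lip d c c' z : 0 < d ->
  `|tent2 d c z - tent2 d c' z| <= (`|c.1 - c'.1| + `|c.2 - c'.2|) / d.
Proof.
move=> d0; rewrite /tent2.
have E (x a b : R) : `|tent ((x - a) / d) - tent ((x - b) / d)| <= `|a - b| / d.
  apply: le_trans (tent_lip _ _) _.
  have -> : (x - a) / d - (x - b) / d = (b - a) / d by ring.
  by rewrite normrM normfV (gtr0_norm d0) distrC.
have e1 := E z.1 c.1 c'.1; have e2 := E z.2 c.2 c'.2.
have /andP[a0 a1] := tent01 ((z.1 - c'.1) / d).
have /andP[b0 b1] := tent01 ((z.2 - c.2) / d).
rewrite [X in _ <= X]mulrDl; apply: le_trans (lerD e1 e2).
set a := tent ((z.1 - c.1) / d); set a' := tent ((z.1 - c'.1) / d) in a0 a1 *.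
set b := tent ((z.2 - c.2) / d) in b0 b1 *; set b' := tent ((z.2 - c'.2) / d).
have -> : a * b - a' * b' = b * (a - a') + a' * (b - b') by ring.
apply: le_trans (ler_normD _ _) _; rewrite !normrM (ger0_norm a0) (ger0_norm b0).
by apply: lerD; rewrite ler_piMl.
Qed.

Lemma measurable_tent2 d c : measurable_fun setT (tent2 d c).
Proof.
apply: measurable_funM; apply: (measurableT_comp measurable_tent); apply: measurable_funM => //;
  exact: measurable_funB.
Qed.

(** On the concentric square of side d both tents are at least 1/2, so the integral is at least d^2
    / 4. *)
Lemma integral_tent2_ge d c : 0 < d ->
  (((d / 2) ^+ 2)%:E <= \int[leb2]_z (tent2 d c z)%:E)%E.
Proof.
move=> d0; set P := rect (c - (d / 2, d / 2)) (c + (d / 2, d / 2)).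
have mP : measurable_fun setT (\1_P : plane R -> R) by apply: measurable_indic; exact: measurable_rect.
have mh : measurable_fun setT (fun z : plane R => (4^-1 * \1_P z : R)%:E).
  by apply/measurable_EFinP; apply: measurable_funM => //; exact: measurable_cst.
apply: (@le_trans _ _ (\int[leb2]_z (4^-1 * \1_P z)%:E)%E).
  under eq_integral do rewrite EFinM.
  have mF : measurable_fun setT (fun v : plane R => (\1_P v : R)%:E).
    by apply/measurable_EFinP; apply: measurable_indic; exact: measurable_rect.
  rewrite (ge0_integralZl leb2 measurableT mF)//.
  have EP : leb2 P = (d ^+ 2)%:E.
    rewrite /P rectE; apply: etrans (lebesgue2_rect _ _) _ => //.
    have E4 x : @lebesgue_measure R (`]x - d / 2, x + d / 2[%classic : set (measurableTypeR R)) = d%:E.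
      apply: etrans (lebesgue_measure_itv `]x - d / 2, x + d / 2[) _.
      have h2d : x - d / 2 < x + d / 2 by have := d0; lra.
      rewrite /= lte_fin h2d.
      by rewrite -EFinB; congr EFin; field.
    by rewrite /= !E4 -EFinM -expr2.
  have -> : (\int[leb2]_v (\1_P v : R)%:E = (d ^+ 2)%:E)%E.
    by rewrite integral_indic//; [rewrite setIT; exact: EP|exact: measurable_rect].
  by rewrite -EFinM lee_fin; nra.
apply: ge0_le_integral => //.
  by apply/measurable_EFinP; exact: measurable_tent2.
move=> z _; rewrite lee_fin indicE; have [zP|zP] := pselect (P z).
  by rewrite mem_set// mulr1; exact: tent2_ge.
by rewrite memNset// mulr0; have /andP[] := tent201 d c z.
Qed.

End tent.

(** * The component of a map along a fixed direction *)

Section component.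
Context {R : realType}.
Variables (f : plane R -> plane R) (g : 'I_2 -> 'I_2 -> plane R -> R).
Hypothesis mf : forall i, measurable_fun setT (fun z => coord i (f z)).
Hypothesis fdisk : forall z, disk (f z).
Hypothesis wg : weak_gradient f g.

Let gr alpha i : plane R -> R := g alpha i \_ disk.

Let mgr alpha i : measurable_fun setT (gr alpha i).
Proof.
have [h _] := wg; have [m _] := h alpha i.
by apply/(measurable_restrictT _ (@measurable_disk R)).
Qed.

Let igr2 alpha i : leb2.-integrable setT (EFin \o (fun z => gr alpha i z ^+ 2)).
Proof.
have [h _] := wg; have [m fin] := h alpha i.
have -> : EFin \o (fun z => gr alpha i z ^+ 2) = (fun z => (g alpha i z ^+ 2)%:E) \_ disk.
  by apply/funext => z; rewrite /gr /= !patchE; case: ifP => // _; rewrite expr0n.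
apply/(integrable_mkcond _ (@measurable_disk R)); apply/integrableP; split.
  by apply/measurable_EFinP; exact: measurable_funX.
by under eq_integral do rewrite /= ger0_norm ?sqr_ge0//.
Qed.

Let fi1 i z : `|coord i (f z)| <= 1.
Proof.
have := fdisk z; rewrite /disk/= sqnormE => h.
rewrite ler_norml /coord; case: ifP => _; apply/andP; split; nra.
Qed.

Let indd : plane R -> R := \1_disk.

Let iindd : leb2.-integrable setT (EFin \o indd).
Proof. apply: integrable_indic_lty; [exact: measurable_disk|exact: leb2_disk_fin]. Qed.

Let igr alpha i : leb2.-integrable setT (EFin \o gr alpha i).
Proof.
apply: (@integrable_le _ _ _ leb2 setT (gr alpha i) (fun z => indd z + gr alpha i z ^+ 2)) => //.
  exact: integrableDR.
move=> z _; rewrite /indd indicE /gr patchE; case: (boolP (z \in _)) => [_|_].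
  move: (g alpha i z) => x; rewrite ler_norml expr2.
  have := sqr_ge0 (x - 2^-1); have := sqr_ge0 (x + 2^-1); rewrite !expr2 /= => h1 h2.
  by apply/andP; split; nra.
by rewrite normr0 expr0n addr0.
Qed.

Variables (a b : R).
Hypothesis ab1 : a ^+ 2 + b ^+ 2 = 1.

(** The scalar product of [f] with the unit vector (a, b), extended by 0 outside the disk to meet
    the hypotheses of the Poincare inequality. The extension need not be weakly differentiable
    across the circle, but test functions only see the open disk. *)
Definition component (z : plane R) : R :=
  (a * coord ord0 (f z) + b * coord (lift ord0 ord0) (f z)) * \1_disk z.

Definition component_grad (alpha : 'I_2) (z : plane R) : R :=
  a * (g alpha ord0 \_ disk) z + b * (g alpha (lift ord0 ord0) \_ disk) z.

Lemma measurable_component : measurable_fun setT component.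
Proof.
apply: measurable_funM; last by apply: measurable_indic; exact: measurable_disk.
by apply: measurable_funD; apply: measurable_funM => //; exact: measurable_cst.
Qed.

Lemma component_le1 z : `|component z| <= 1.
Proof.
have := fdisk z; rewrite /component /disk/= sqnormE /coord/= => h.
rewrite normrM indicE normr_nat.
case: (z \in _); last by rewrite mulr0.
rewrite mulr1 ler_norml.
move: (f z).1 (f z).2 h => x y h.
have := sqr_ge0 (a - x); have := sqr_ge0 (b - y); have := sqr_ge0 (a + x); have := sqr_ge0 (b + y).
by move: ab1 => h0 h1 h2 h3 h4; apply/andP; split; nra.
Qed.

Lemma component_out z : ~ disk z -> component z = 0.
Proof. by move=> zd; rewrite /component indicE memNset// mulr0. Qed.

Lemma measurable_component_grad alpha : measurable_fun setT (component_grad alpha).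
Proof.
by apply: measurable_funD; apply: measurable_funM; (exact: measurable_cst || exact: mgr).
Qed.

Lemma component_grad_out alpha z : ~ disk z -> component_grad alpha z = 0.
Proof. by move=> zd; rewrite /component_grad !patchE memNset// !mulr0 addr0. Qed.

Lemma component_grad_sqr alpha z :
  component_grad alpha z ^+ 2 <= gr alpha ord0 z ^+ 2 + gr alpha (lift ord0 ord0) z ^+ 2.
Proof.
rewrite /component_grad -/(gr alpha ord0) -/(gr alpha (lift ord0 ord0)).
move: (gr _ _ z) (gr _ _ z) => x y; have := sqr_ge0 (a * y - b * x); have := sqr_ge0 (a * x - b * y).
move=> h1 h2; rewrite -[X in _ <= X]mul1r -ab1; nra.
Qed.

Lemma integrable_component_grad alpha :
  leb2.-integrable setT (EFin \o (fun z => component_grad alpha z ^+ 2)).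
Proof.
apply: (integrable_le _ _ (integrableDR _ (igr2 alpha ord0) (igr2 alpha (lift ord0 ord0)))) => //.
  by apply: measurable_funX; exact: measurable_component_grad.
move=> z _; rewrite ger0_norm ?sqr_ge0//; exact: component_grad_sqr.
Qed.

Lemma component_weak alpha psi : test_function psi ->
  (\int[leb2]_z (component z * 'D_(basis alpha : plane R) psi z) =
   - \int[leb2]_z (component_grad alpha z * psi z))%R.
Proof.
move=> tpsi; have [_ /(_ alpha _ _ tpsi) W] := wg.
have [Cpsi _] := tpsi; have [psid psic] := Cpsi.
have cpsi : continuous psi := C1d_continuous (C1_C1d Cpsi).
have mpsi : measurable_fun setT psi by apply: continuous_measurable_plane => //; exact: continuous_subspaceT.
have [M hM] := continuous_bounded_disk cpsi.
have [M' hM'] := continuous_bounded_disk (psic (basis alpha : plane R)).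
have mD : measurable_fun setT (fun z => 'D_(basis alpha : plane R) psi z).
  by apply: continuous_measurable_plane => //; apply: continuous_subspaceT; exact: psic.
have ifD i : leb2.-integrable disk (EFin \o (fun z => coord i (f z) * 'D_(basis alpha : plane R) psi z)).
  apply: (@integrable_le _ _ _ leb2 _ _ (fun z => `|M'| * indd z)).
  - exact: measurable_disk.
  - by apply: measurable_funTS; apply: measurable_funM.
  - by apply: integrableS (integrableZR _ _ iindd) => //; exact: measurable_disk.
  - move=> z dz; rewrite normrM (le_trans (ler_piMl _ (fi1 i z)))//.
    by rewrite /indd indicE mem_set// mulr1 (le_trans (hM' z dz))// ler_norm.
have igp i : leb2.-integrable setT (EFin \o (fun z => gr alpha i z * psi z)).
  apply: (integrable_mul_bounded (M := M) _ (igr alpha i)) => // z _ gz; apply: hM.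
  by apply: contrapT => zd; move: gz; rewrite /gr patchE memNset// eqxx.
rewrite (_ : (\int[leb2]_z (component_grad alpha z * psi z))%R =
   a * (\int[leb2]_z (gr alpha ord0 z * psi z))%R + b * (\int[leb2]_z (gr alpha (lift ord0 ord0) z * psi z))%R); last first.
  rewrite -!RintegralZl// -RintegralD//; [|exact: integrableZR..].
  by apply: eq_Rintegral => z _; rewrite /component_grad -/(gr alpha ord0) -/(gr alpha (lift ord0 ord0)); ring.
rewrite (_ : (\int[leb2]_z (component z * 'D_(basis alpha : plane R) psi z))%R =
   a * (\int[leb2]_(z in disk) (coord ord0 (f z) * 'D_(basis alpha : plane R) psi z))%R
   + b * (\int[leb2]_(z in disk) (coord (lift ord0 ord0) (f z) * 'D_(basis alpha : plane R) psi z))%R); last first.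
  rewrite -!RintegralZl//; [|exact: measurable_disk..].
  rewrite -RintegralD//; [|exact: measurable_disk|apply: integrableZR => //; exact: measurable_disk..].
  rewrite [RHS]Rintegral_mkcond; apply: eq_Rintegral => z _.
  by rewrite /component patchE indicE; case: (z \in _); rewrite ?mulr1 ?mulr0 ?mul0r//; ring.
have W' i : (\int[leb2]_(z in disk) (coord i (f z) * 'D_(basis alpha : plane R) psi z))%R =
   - (\int[leb2]_z (gr alpha i z * psi z))%R.
  rewrite [LHS](W i); congr (- _); rewrite Rintegral_mkcond; apply: eq_Rintegral => z _.
  by rewrite /gr !patchE; case: ifP; rewrite ?mul0r.
by rewrite !W'; ring.
Qed.

End component.

(** * Averages over a square that turns around the circle *)

Section winding.
Context {R : realType}.
Variable f : plane R -> plane R.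
Hypothesis mf : forall i, measurable_fun setT (fun z => coord i (f z)).
Hypothesis fi1 : forall i z, `|coord i (f z)| <= 1.
Variables (r d : R).
Hypothesis d0 : 0 < d.

Definition circle_point (t : R) : plane R := (r * cos t, r * sin t).

Lemma integrable_tent2_coord c i : leb2.-integrable disk (EFin \o (fun z => tent2 d c z * coord i (f z))).
Proof.
apply: (@integrable_le _ _ _ leb2 _ _ (\1_disk : plane R -> R)).
- exact: measurable_disk.
- by apply: measurable_funTS; apply: measurable_funM => //; exact: measurable_tent2.
- apply: integrableS (integrable_indic_lty _ _) => //; [exact: measurable_disk..|exact: leb2_disk_fin].
- move=> z dz; rewrite indicE mem_set// normrM mulr_ile1//.
  by have /andP[K0 K1] := tent201 d c z; rewrite ger0_norm.
Qed.

Definition smoothed (i : 'I_2) (t : R) : R :=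
  \int[leb2]_(z in disk) (tent2 d (circle_point t) z * coord i (f z)).

(** By [tent2_lip] and the bound on [f], the variation of the average is at most the displacement of
    the centre divided by d, times the area of the disk. *)
Lemma continuous_smoothed i : continuous (smoothed i).
Proof.
move=> t.
pose area := fine (leb2 (@disk R)).
pose bd s := (`|r * cos t - r * cos s| + `|r * sin t - r * sin s|) / d * area.
have area0 : 0 <= area by exact: fine_ge0.
have H s : `|smoothed i t - smoothed i s| <= bd s.
  rewrite /smoothed -RintegralB; [|exact: measurable_disk|exact: integrable_tent2_coord..].
  apply: le_trans (le_normr_Rintegral _ _) _.
  - exact: measurable_disk.
  - by apply: integrableBR; [exact: measurable_disk|exact: integrable_tent2_coord..].
  rewrite -(_ : \int[leb2]_(z in disk) ((`|r * cos t - r * cos s| + `|r * sin t - r * sin s|) / d) = bd s); last first.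
    by rewrite Rintegral_cst//; exact: measurable_disk.
  apply: le_Rintegral.
  - exact: measurable_disk.
  - have := integrable_abse (integrableBR (@measurable_disk R) (integrable_tent2_coord (circle_point t) i) (integrable_tent2_coord (circle_point s) i)); exact.
  - by apply: integrable_cst_lty; [exact: measurable_disk|exact: leb2_disk_fin].
  move=> z dz; rewrite -mulrBl normrM (le_trans (ler_piMr _ (fi1 i z)))//.
  exact: tent2_lip.
apply/cvgrPdist_lt => e e0.
have cbd : bd s @[s --> t] --> 0.
  have -> : 0 = bd t by rewrite /bd !subrr normr0 addr0 mul0r mul0r.
  rewrite /bd; apply: cvgM; last exact: cvg_cst.
  apply: cvgM; last exact: cvg_cst.
  by apply: cvgD; apply: cvg_norm; apply: cvgB; (try exact: cvg_cst); apply: cvgM;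
    (try exact: cvg_cst); [exact: continuous_cos|exact: continuous_sin].
have /cvgrPdist_lt /(_ e e0) := cbd.
apply: filterS => s; rewrite sub0r normrN; apply: le_lt_trans.
by rewrite (le_trans (H s))// ler_norm.
Qed.

(* After one turn [smoothed] is back to its initial value, whereas [e^(it/2)] has changed sign. *)
Lemma exists_orthogonal : exists t,
  cos (t / 2) * smoothed ord0 t + sin (t / 2) * smoothed (lift ord0 ord0) t = 0.
Proof.
pose phi t := cos (t / 2) * smoothed ord0 t + sin (t / 2) * smoothed (lift ord0 ord0) t.
have chalf (h : R -> R) : continuous h -> continuous (fun t : R => h (t / 2)).
  move=> ch t; apply: (@continuous_comp _ _ _ (fun t : R => t / 2) h); last exact: ch.
  by apply: cvgM; [exact: cvg_id|exact: cvg_cst].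
have cphi : continuous phi.
  move=> t; apply: cvgD; apply: cvgM; try exact: continuous_smoothed.
    exact/chalf/continuous_cos.
  exact/chalf/continuous_sin.
have s0 i : smoothed i (2 * pi) = smoothed i 0.
  rewrite /smoothed; suff -> : circle_point (2 * pi) = circle_point 0 by [].
  by rewrite /circle_point mulr_natl cos2pi sin2pi cos0 sin0.
have phi2pi : phi (2 * pi) = - phi 0.
  rewrite /phi !s0 mul0r cos0 sin0 [2 * pi]mulrC mulfK// cospi sinpi.
  by rewrite !mul0r !addr0 mulN1r mul1r.
have pi20 : 0 <= 2 * pi :> R by rewrite mulr_ge0// pi_ge0.
have h0 : Num.min (phi 0) (phi (2 * pi)) <= 0 <= Num.max (phi 0) (phi (2 * pi)).
  rewrite phi2pi ge_min le_max oppr_ge0 oppr_le0.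
  by case: (leP (phi 0) 0) => h; rewrite ?orbT// (ltW h) ?orbT.
by have [t _ ht] := IVT pi20 (continuous_subspaceT cphi) h0; exists t.
Qed.

End winding.

(** * The energy of an approximate square root near the circle *)

Section energy_lower_bound.
Context {R : realType}.
Variables (f : plane R -> plane R) (g : 'I_2 -> 'I_2 -> plane R -> R).
Hypothesis mf : forall i, measurable_fun setT (fun z => coord i (f z)).
Hypothesis fdisk : forall z, disk (f z).
Hypothesis wg : weak_gradient f g.

Let fi1 i z : `|coord i (f z)| <= 1.
Proof.
have := fdisk z; rewrite /disk/= sqnormE => h.
rewrite ler_norml /coord; case: ifP => _; apply/andP; split; nra.
Qed.

Definition defect (z : plane R) : R := sqnorm (csqr (f z) - z).

Definition grad_sqr (z : plane R) : R := \sum_(alpha < 2) \sum_(i < 2) g alpha i z ^+ 2.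

Lemma defect_ge0 z : 0 <= defect z. Proof. exact: sqnorm_ge0. Qed.

Lemma grad_sqr_ge0 z : 0 <= grad_sqr z.
Proof. by apply: sumr_ge0 => alpha _; apply: sumr_ge0 => i _; exact: sqr_ge0. Qed.

Lemma measurable_defect : measurable_fun setT defect.
Proof.
rewrite /defect; under eq_fun do rewrite sqnormE.
have m1 := mf ord0; have m2 := mf (lift ord0 ord0).
rewrite /coord/= in m1 m2.
apply: measurable_funD; apply: measurable_funX; apply: measurable_funB => //=.
  by apply: measurable_funB; exact: measurable_funX.
by apply: measurable_funM => //; apply: measurable_funM => //; exact: measurable_cst.
Qed.

Lemma measurable_grad_sqr : measurable_fun disk grad_sqr.
Proof.
apply: measurable_sum => alpha; apply: measurable_sum => i; apply: measurable_funX.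
by have [h _] := wg; have [] := h alpha i.
Qed.

(* With [f z = (x, y)] and [z = (u, v)]: near the point of argument [t] of the circle, where
   [u cos t + v sin t] is close to 1, a vector whose square is close to [z] has a large component
   along the square root [e^(it/2)]. *)
Lemma component_sqr_ge (t x y u v : R) :
  2^-1 - ((x ^+ 2 - y ^+ 2 - u) ^+ 2 + (2 * x * y - v) ^+ 2)
   - (3 / 4 - (u * cos t + v * sin t))
  <= (cos (t / 2) * x + sin (t / 2) * y) ^+ 2.
Proof.
have ct : cos t = cos (t / 2) ^+ 2 - sin (t / 2) ^+ 2.
  by rewrite [in LHS](splitr t) cosD !expr2.
have st : sin t = 2 * (cos (t / 2) * sin (t / 2)).
  by rewrite [in LHS](splitr t) sinD; ring.
have := cos2Dsin2 (t / 2); rewrite ct st.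
move: (cos (t / 2)) (sin (t / 2)) => C S CS.
set p := x ^+ 2 - y ^+ 2 - u; set q := 2 * x * y - v.
pose c := C ^+ 2 - S ^+ 2; pose s := 2 * (C * S).
have cs1 : c ^+ 2 + s ^+ 2 = 1.
  by rewrite -[RHS](expr1n _ 2) -CS /c /s; ring.
(* In complex notation, Re(f^2 e^(-it)) is the square of the component of f along e^(it/2) minus the
   square of the orthogonal one; [p] and [q] are the coordinates of f^2 - z. *)
have E : (C * x + S * y) ^+ 2 = (C * y - S * x) ^+ 2 + (u * c + v * s) + (p * c + q * s).
  by rewrite /p /q /c /s; ring.
rewrite E -/c -/s.
have h1 : (p * c + q * s) ^+ 2 <= p ^+ 2 + q ^+ 2.
  rewrite -[X in _ <= X]mulr1 -cs1; have := sqr_ge0 (p * s - q * c); nra.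
(* Nonnegativity of (p c + q s + 1/2)^2 gives p c + q s >= - 1/4 - (p c + q s)^2, where 1/4 = 3/4 -
   1/2. *)
have := sqr_ge0 (C * y - S * x); have := sqr_ge0 (p * c + q * s + 2^-1); nra.
Qed.

Lemma bernoulli_le (x : R) n : 0 <= x <= 1 -> 1 - n%:R * x <= (1 - x) ^+ n.
Proof.
move=> /andP[x0 x1]; elim: n => [|n IH]; first by rewrite mul0r subr0 expr0.
rewrite exprS; apply: (@le_trans _ _ ((1 - x) * (1 - n%:R * x))); last by rewrite ler_wpM2l// subr_ge0.
have : 0 <= n%:R * x ^+ 2 by rewrite mulr_ge0// sqr_ge0.
rewrite -natr1; nra.
Qed.

(** Let X and Y be the two integrals on the right, m and B the integrals of K and of K k^2.
    Closeness to a square root gives m <= 2 B + 4 X, and the Poincare inequality gives 2 m B <= 256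
    d^4 Y. As m >= d^2 / 4, it follows that d^2 / 4 <= 1024 d^2 Y + 4 X; with 16 N d = 1 the
    constant is 8 * 512 = 4096. *)
Lemma energy_step (N : nat) : (0 < N)%N ->
  ((4096^-1)%:E <= (N%:R ^+ 2)%:E * \int[leb2]_(z in disk) (sqnorm z ^+ N * defect z)%:E +
   \int[leb2]_(z in disk) (sqnorm z ^+ N * grad_sqr z)%:E)%E.
Proof.
(* Half-side d = 1/(16 N) and centre at distance 2 d from the circle. Then every point of the square
   satisfies 1 - 8 d <= |z|^2 < 1, with 8 d = 1/(2 N), and its scalar product with (cos t, sin t) is
   at least 1 - 4 d >= 3/4. *)
move=> N0; pose d : R := (16 * N%:R)^-1; pose r : R := 1 - 2 * d.
have N1 : 1 <= N%:R :> R by rewrite ler1n.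
have d0 : 0 < d by rewrite invr_gt0 mulr_gt0// ltr0n.
have dN : 16 * N%:R * d = 1 by rewrite /d divff// mulf_neq0// pnatr_eq0 -lt0n.
have d16 : d <= 16^-1 by nra.
have [t ht] := exists_orthogonal mf fi1 r d0.
pose c := circle_point r t.
have cs1 : cos t ^+ 2 + sin t ^+ 2 = 1 by rewrite cos2Dsin2.
have ab1 : cos (t / 2) ^+ 2 + sin (t / 2) ^+ 2 = 1 by rewrite cos2Dsin2.
have cst1 : -1 <= cos t <= 1 by apply/andP; split; nra.
have snt1 : -1 <= sin t <= 1 by apply/andP; split; nra.
pose a := cos (t / 2); pose b := sin (t / 2).
pose k := component f a b; pose h := component_grad g a b.
(* the square lies in the strip 1 - 1/(2N) <= |z|^2 < 1 *)
have strip z : crect (c - (d, d)) (c + (d, d)) z ->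
   [/\ sqnorm z < 1, 1 - (2 * N%:R)^-1 <= sqnorm z & 3 / 4 <= z.1 * cos t + z.2 * sin t].
  rewrite /crect/= => -[h1 h2 h3 h4]; rewrite sqnormE.
  have -> : (2 * N%:R)^-1 = 8 * d :> R by rewrite /d; field; rewrite pnatr_eq0 -lt0n.
  have [z1 z1E] : exists z1, z.1 = r * cos t + z1 by exists (z.1 - r * cos t); ring.
  have [z2 z2E] : exists z2, z.2 = r * sin t + z2 by exists (z.2 - r * sin t); ring.
  rewrite z1E z2E in h1 h2 h3 h4 *.
  have /andP[a1 a2] : - d <= z1 <= d by apply/andP; split; lra.
  have /andP[b1 b2] : - d <= z2 <= d by apply/andP; split; lra.
  have /andP[c1 c2] := cst1; have /andP[s1 s2] := snt1.
  have e1 : `|z1 * cos t + z2 * sin t| <= 2 * d.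
    rewrite (le_trans (ler_normD _ _))// !normrM.
    have -> : 2 * d = d * 1 + d * 1 by ring.
    by apply: lerD; apply: ler_pM => //; rewrite ler_norml ?a1 ?b1.
  move: e1; rewrite ler_norml => /andP[e1 e2].
  set e := z1 * cos t + z2 * sin t in e1 e2.
  have -> : (r * cos t + z1) ^+ 2 + (r * sin t + z2) ^+ 2 = r ^+ 2 * (cos t ^+ 2 + sin t ^+ 2) + 2 * r * e + z1 ^+ 2 + z2 ^+ 2.
    by rewrite /e; ring.
  have -> : (r * cos t + z1) * cos t + (r * sin t + z2) * sin t = r * (cos t ^+ 2 + sin t ^+ 2) + e.
    by rewrite /e; ring.
  rewrite cs1 !mulr1.
  have z12 : z1 ^+ 2 <= d ^+ 2 by nra.
  have z22 : z2 ^+ 2 <= d ^+ 2 by nra.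
  have z10 := sqr_ge0 z1; have z20 := sqr_ge0 z2.
  have r0 : 0 < r by rewrite /r; lra.
  have re1 : r * e <= r * (2 * d) by rewrite ler_pM2l.
  have re2 : r * (- (2 * d)) <= r * e by rewrite ler_pM2l// mulNr.
  by move: re1 re2; rewrite /r; split; nra.
have Qdisk z : crect (c - (d, d)) (c + (d, d)) z -> sqnorm z < 1 by case/strip.
pose Q := rect (c - (d, d)) (c + (d, d)).
have mQ : measurable Q by exact: measurable_rect.
have QD : Q `<=` disk by move=> z /rect_crect/Qdisk/ltW.
(* Bernoulli: (1 - 1/(2 N))^N >= 1/2, so on the square the weight costs only a factor 2. *)
have weight z : Q z -> 2^-1 <= sqnorm z ^+ N.
  move=> /rect_crect/strip[_ lowz _].
  have x0 : 0 <= (2 * N%:R)^-1 :> R by rewrite invr_ge0 mulr_ge0.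
  have x1 : (2 * N%:R)^-1 <= 1 :> R by rewrite invf_le1 ?mulr_gt0//; lra.
  have := @bernoulli_le (2 * N%:R)^-1 N; rewrite x0 x1 => /(_ isT) B.
  apply: (@le_trans _ _ ((1 - (2 * N%:R)^-1) ^+ N)).
    apply: le_trans B; have -> : N%:R * (2 * N%:R)^-1 = 2^-1 :> R; last by lra.
    by field; rewrite pnatr_eq0 -lt0n.
  by rewrite lerXn2r ?nnegrE ?subr_ge0// sqnorm_ge0.
pose K := tent2 d c.
have mK : measurable_fun setT K by exact: measurable_tent2.
have K01 z : 0 <= K z <= 1 by exact: tent201.
have Kout z : ~ Q z -> K z = 0 by exact: tent2_out.
have Kk0 : (\int[leb2]_z (K z * k z)%:E = 0)%E.
  transitivity (\int[leb2]_(z in disk) (a * (K z * coord ord0 (f z)) + b * (K z * coord (lift ord0 ord0) (f z)))%:E)%E.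
    rewrite [RHS]integral_mkcond; apply: eq_integral => z _.
    rewrite /k /component patchE indicE; case: (z \in _); last by rewrite !mulr0.
    by congr EFin; rewrite mulr1; ring.
  have iKf i := integrable_tent2_coord mf fi1 d c i.
  rewrite (integral_lincomb _ _ (@measurable_disk R) (iKf _) (iKf _)).
  rewrite -(EFin_Rintegral (@measurable_disk R) (iKf ord0)) -(EFin_Rintegral (@measurable_disk R) (iKf (lift ord0 ord0))).
  by rewrite -!EFinM -EFinD ht.
have WP := weighted_poincare (measurable_component mf a b) (component_le1 fdisk ab1) (@component_out _ f a b)
   (measurable_component_grad wg a b) (@component_grad_out _ g a b) (integrable_component_grad wg ab1)
   (component_weak mf fdisk wg a b) d0 Qdisk mK K01 Kout Kk0.
set X := (\int[leb2]_(z in disk) (sqnorm z ^+ N * defect z)%:E)%E.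
set Y := (\int[leb2]_(z in disk) (sqnorm z ^+ N * grad_sqr z)%:E)%E.
have w0 z : 0 <= sqnorm z ^+ N by rewrite exprn_ge0// sqnorm_ge0.
have X0 : (0 <= X)%E.
  by apply: integral_ge0 => z _; rewrite lee_fin mulr_ge0 ?w0 ?defect_ge0.
have Y0 : (0 <= Y)%E.
  by apply: integral_ge0 => z _; rewrite lee_fin mulr_ge0 ?w0 ?grad_sqr_ge0.
have N2 : 0 < N%:R ^+ 2 :> R by rewrite exprn_gt0// ltr0n.
have [Xoo|Xfin] := eqVneq X +oo%E.
  by rewrite Xoo gt0_muley ?lte_fin// addye ?leey// gt_eqF// (lt_le_trans _ Y0)// ltNy0.
have [Yoo|Yfin] := eqVneq Y +oo%E.
  rewrite Yoo addey ?leey// gt_eqF//.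
  by rewrite (@lt_le_trans _ _ 0%E)// ?ltNy0// mule_ge0// lee_fin ltW.
have XE : X = (fine X)%:E by rewrite fineK// ge0_fin_numE// ltey.
have YE : Y = (fine Y)%:E by rewrite fineK// ge0_fin_numE// ltey.
set A := (\int[leb2]_(z in Q) (h ord0 z ^+ 2 + h (lift ord0 ord0) z ^+ 2)%:E)%E in WP.
set m := (\int[leb2]_z (K z)%:E)%E in WP.
set B := (\int[leb2]_z (K z * k z ^+ 2)%:E)%E in WP.
have iK : leb2.-integrable setT (EFin \o K).
  apply: (integrable_le _ mK (integrable_indic_lty (@measurable_disk R) leb2_disk_fin)) => // z _.
  have /andP[K0 K1] := K01 z; rewrite ger0_norm// indicE.
  have [zQ|zQ] := pselect (Q z); first by rewrite mem_set//; exact: QD.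
  by rewrite Kout.
have mk := measurable_component mf a b.
have k21 z : `|k z ^+ 2| <= 1 by rewrite normrX exprn_ile1//; exact: component_le1.
have iKk2 : leb2.-integrable setT (EFin \o (fun z => K z * k z ^+ 2)).
  by apply: (integrable_mul_bounded (M := 1) _ iK) => //; exact: measurable_funX.
have mE : m = (fine m)%:E by rewrite fineK//; exact: integrable_fin_num.
have BE : B = (fine B)%:E by rewrite fineK//; exact: integrable_fin_num.
have mge := integral_tent2_ge c d0; rewrite -/K -/m mE lee_fin in mge.
have mw : measurable_fun setT (fun z : plane R => sqnorm z ^+ N).
  by apply: measurable_funX; exact: measurable_sqnorm.
have mwd : measurable_fun disk (fun z => (sqnorm z ^+ N * defect z)%:E).
  by apply/measurable_EFinP; apply: measurable_funTS; apply: measurable_funM => //; exact: measurable_defect.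
have mwg : measurable_fun disk (fun z => (sqnorm z ^+ N * grad_sqr z)%:E).
  apply/measurable_EFinP; apply: measurable_funM; first exact: measurable_funTS.
  exact: measurable_grad_sqr.
have wg0 z : disk z -> (0 <= (sqnorm z ^+ N * grad_sqr z)%:E)%E.
  by move=> _; rewrite lee_fin mulr_ge0 ?w0 ?grad_sqr_ge0.
have two0 : (0 <= 2%:E :> \bar R)%E by rewrite lee_fin.
have AY : (A <= 2%:E * Y)%E.
  rewrite /Y -(ge0_integralZl leb2 (@measurable_disk R) mwg wg0 two0).
  apply: (@le_trans _ _ (\int[leb2]_(z in Q) (2%:E * (sqnorm z ^+ N * grad_sqr z)%:E))%E).
    apply: ge0_le_integral => //.
    - by move=> z _; rewrite lee_fin addr_ge0// sqr_ge0.
    - apply/measurable_EFinP; apply: measurable_funTS; apply: measurable_funD;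
        apply: measurable_funX; exact: (measurable_component_grad wg a b).
    - by apply: emeasurable_funM; [exact: measurable_cst|apply: measurable_funS mwg => //; exact: measurable_disk].
    move=> z zQ; rewrite -EFinM lee_fin.
    have h0 := component_grad_sqr g ab1 ord0 z.
    have h1 := component_grad_sqr g ab1 (lift ord0 ord0) z.
    rewrite !patchE (mem_set (QD z zQ)) in h0 h1.
    apply: (@le_trans _ _ (grad_sqr z)).
      by rewrite /grad_sqr !big_ord_recl !big_ord0 !addr0; exact: lerD.
    have := weight z zQ; have := grad_sqr_ge0 z; nra.
  apply: ge0_subset_integral => //; first exact: measurable_disk.
    by apply: emeasurable_funM; [exact: measurable_cst|exact: mwg].
  by move=> z zd; rewrite mule_ge0// wg0.
pose wd : plane R -> R := (fun z => sqnorm z ^+ N * defect z) \_ disk.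
have wdE : EFin \o wd = (fun z => (sqnorm z ^+ N * defect z)%:E) \_ disk.
  by apply/funext => z; rewrite /wd /= !patchE; case: ifP.
have wd0 z : 0 <= wd z.
  by rewrite /wd patchE; case: ifP => // _; rewrite mulr_ge0 ?w0 ?defect_ge0.
have iwd : leb2.-integrable setT (EFin \o wd).
  rewrite wdE; apply/(integrable_mkcond _ (@measurable_disk R)); apply/integrableP; split => //.
  under eq_integral do rewrite gee0_abs ?lee_fin ?mulr_ge0 ?w0 ?defect_ge0//.
  by rewrite -/X ltey.
have XE' : (\int[leb2]_z (wd z)%:E)%E = X.
  by rewrite /X [RHS]integral_mkcond -wdE.
(* Pointwise on the square, [component_sqr_ge] gives K (1/2 - D) <= K k^2, with D the defect, and K
   D <= D <= 2 w D because the weight w is at least 1/2. *)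
have mB : (m <= 2%:E * B + 4%:E * X)%E.
  rewrite -XE' -integral_lincomb//; apply: le_integral => //.
    by apply: integrableDR => //; exact: integrableZR.
  move=> z _; rewrite lee_fin.
  have [zQ|zQ] := pselect (Q z); last first.
    by rewrite Kout// mul0r mulr0 add0r mulr_ge0.
  have zd := QD z zQ.
  have [_ _ zu] := strip z (rect_crect zQ).
  have := component_sqr_ge t (coord ord0 (f z)) (coord (lift ord0 ord0) (f z)) z.1 z.2.
  rewrite /wd patchE mem_set// /k /component indicE mem_set// mulr1.
  have -> : (coord ord0 (f z) ^+ 2 - coord (lift ord0 ord0) (f z) ^+ 2 - z.1) ^+ 2 +
    (2 * coord ord0 (f z) * coord (lift ord0 ord0) (f z) - z.2) ^+ 2 = defect z.
    by rewrite /defect sqnormE.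
  have /andP[K0 K1] := K01 z; have := weight z zQ; have := defect_ge0 z.
  rewrite -/a -/b; move: (_ ^+ N) (defect z) ((a * _ + b * _) ^+ 2) => w D k2 D0 w1 hk.
  have hk' : 2^-1 - D <= k2 by lra.
  have : K z * (2^-1 - D) <= K z * k2 by rewrite ler_wpM2l.
  have : K z * D <= D by rewrite ler_piMl.
  have : D <= 2 * (w * D) by nra.
  by move=> *; nra.
have : ((128 * d ^+ 4)%:E * A <= (128 * d ^+ 4)%:E * (2%:E * Y))%E.
  by apply: lee_wpmul2l => //; rewrite lee_fin mulr_ge0// exprn_ge0// ltW.
move/(le_trans WP) => {}WP; move: WP mB.
rewrite mE BE XE YE -!EFinM -!EFinD !lee_fin.
have := fine_ge0 X0; have := fine_ge0 Y0.
move: (fine m) (fine B) (fine X) (fine Y) mge => m' B' X' Y' mge Y0' X0' WP mB.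
(* This divides m B <= 128 d^4 Y by m >= d^2 / 4. *)
have B1 : B' <= 512 * d ^+ 2 * Y'.
  rewrite leNgt; apply/negP => HB.
  have B0 : 0 < B'.
    have pos (l : R) : 0 <= l -> 0 <= l * d ^+ 2 * Y'.
      by move=> l0; apply: mulr_ge0 => //; apply: mulr_ge0; [exact: l0|exact: sqr_ge0].
    exact: le_lt_trans (pos _ (ler0n R 512)) HB.
  have : (d / 2) ^+ 2 * B' <= m' * B' by rewrite ler_wpM2r// ltW.
  have : (d / 2) ^+ 2 * (512 * d ^+ 2 * Y') < (d / 2) ^+ 2 * B'.
    by rewrite ltr_pM2l// exprn_gt0// divr_gt0.
  have -> : (d / 2) ^+ 2 * (512 * d ^+ 2 * Y') = 128 * d ^+ 4 * Y' by field.
  move=> *; nra.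
(* The relation 16 N d = 1 turns 512 d^2 N^2 X into 2 X, so that d^2 can be factored out. *)
have key : d ^+ 2 * 8^-1 <= d ^+ 2 * (512 * (N%:R ^+ 2 * X' + Y')).
  have -> : d ^+ 2 * (512 * (N%:R ^+ 2 * X' + Y')) = 2 * (16 * N%:R * d) ^+ 2 * X' + 512 * d ^+ 2 * Y' by ring.
  rewrite dN expr1n; nra.
have d2 : 0 < d ^+ 2 by rewrite exprn_gt0.
by move: key; rewrite ler_pM2l//; lra.
Qed.

End energy_lower_bound.

Section energy_limit.
Context {R : realType}.

Lemma energy_step_const : exists2 c : R, 0 < c &
  forall (f : plane R -> plane R) (g : 'I_2 -> 'I_2 -> plane R -> R),
  (forall i, measurable_fun setT (fun z => coord i (f z))) ->
  (forall z, disk (f z)) -> weak_gradient f g -> forall N, (0 < N)%N ->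
  (c%:E <= (N%:R ^+ 2)%:E * \int[leb2]_(z in disk) (sqnorm z ^+ N * defect f z)%:E +
   \int[leb2]_(z in disk) (sqnorm z ^+ N * grad_sqr g z)%:E)%E.
Proof.
exists (4096^-1); first by rewrite invr_gt0 ltr0n.
by move=> f g mf fdisk wg N; exact: energy_step.
Qed.

(** The order of the quantifiers matters: [c] is common to all maps, whereas [N0] depends on how
    fast the weighted gradient energy of the given map falls below half of the constant of
    [energy_step_const]. *)
Lemma energy_eventually : exists2 c : R, 0 < c & forall (f : plane R -> plane R) (g : 'I_2 -> 'I_2 -> plane R -> R),
  (forall i, measurable_fun setT (fun z => coord i (f z))) ->
  (forall z, disk (f z)) -> weak_gradient f g ->
  exists N0, forall N, (N0 <= N)%N ->
  (c%:E <= (N%:R ^+ 2)%:E * \int[leb2]_(z in disk) (sqnorm z ^+ N * defect f z)%:E)%E.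
Proof.
have [c c0 step] := energy_step_const.
have c20 : 0 < c / 2 by rewrite divr_gt0.
exists (c / 2) => // f g mf fdisk wg.
have igg : leb2.-integrable disk (EFin \o grad_sqr g).
  have ig2 alpha i : leb2.-integrable disk (EFin \o (fun z => g alpha i z ^+ 2)).
    have [h _] := wg; have [m fin] := h alpha i.
    apply/integrableP; split; first by apply/measurable_EFinP; exact: measurable_funX.
    by under eq_integral do rewrite /= ger0_norm ?sqr_ge0//.
  rewrite /grad_sqr; under eq_fun do rewrite !big_ord_recl !big_ord0 !addr0.
  by do 2 ?[apply: integrableDR; first exact: measurable_disk]; exact: ig2.
have /fine_cvgP[_] := radial_weight_cvg0 igg.
move=> /cvgrPdist_le /(_ (c / 2) c20) [N0 _ H]; exists N0.+1 => N NN0.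
have := step _ _ mf fdisk wg _ (leq_ltn_trans (leq0n _) NN0).
have := H N (ltnW NN0).
rewrite sub0r normrN => HN.
set Y := (\int[leb2]_(z in disk) (sqnorm z ^+ N * grad_sqr g z)%:E)%E in HN *.
set X := (_ * \int[leb2]_(z in disk) _)%E.
have Y0 : (0 <= Y)%E.
  by apply: integral_ge0 => z _; rewrite lee_fin mulr_ge0 ?exprn_ge0 ?sqnorm_ge0// grad_sqr_ge0.
have iY : leb2.-integrable disk (EFin \o (fun z => sqnorm z ^+ N * grad_sqr g z)).
  apply: (@integrable_le _ _ _ leb2 _ _ (grad_sqr g)) => //.
  - exact: measurable_disk.
  - apply: measurable_funM; last exact: (measurable_grad_sqr wg).
    by apply: measurable_funTS; apply: measurable_funX; exact: measurable_sqnorm.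
  - move=> z zd; rewrite normrM (ger0_norm (grad_sqr_ge0 g z)) ger0_norm ?exprn_ge0 ?sqnorm_ge0//.
    by rewrite ler_piMl ?grad_sqr_ge0// exprn_ile1// sqnorm_ge0.
have YE : Y = (fine Y)%:E by rewrite fineK//; apply: integrable_fin_num => //; exact: measurable_disk.
have Yle : (Y <= (c / 2)%:E)%E by rewrite YE lee_fin (le_trans (ler_norm _)).
move=> h; have {}h := le_trans h (leeD2l X Yle).
rewrite -(@leeD2rE _ (c / 2)%:E)//.
by apply: le_trans h; rewrite -EFinD lee_fin; lra.
Qed.

End energy_limit.

(** * Transfer to classes of maps *)

Section L2_energy.
Context {R : realType}.
Implicit Type F : @L2_disk R.

Lemma measurable_L2_fun F i : measurable_fun setT (fun z => coord i (L2_fun F z)).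
Proof.
have mF : measurable_fun setT (L2_fun F) by exact: measurable_funPT.
rewrite /coord; case: (i == ord0).
  exact: (measurableT_comp measurable_fst mF).
exact: (measurableT_comp measurable_snd mF).
Qed.

Lemma L2_fun_disk F : \forall z \ae (@leb2 R), disk z -> disk (L2_fun F z).
Proof.
have /asboolP [N [mN N0 sN]] := valP F.
exists (N `&` disk); split.
- by apply: measurableI => //; exact: measurable_disk.
- exact: N0.
- move=> z /= /not_implyP[dz nF]; split => //; exact: sN.
Qed.

(** A representative takes its values in the disk only almost everywhere. Sending the exceptional
    points to 0 gives a map to which [energy_eventually] applies, and changes neither the weak
    gradient nor the integrals. *)
Lemma L2_energy : exists2 c : R, 0 < c & forall F, in_H1 (L2_fun F) -> exists N0, forall N, (N0 <= N)%N ->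
  c <= N%:R ^+ 2 * \int[leb2]_(z in disk) (sqnorm z ^+ N * defect (L2_fun F) z).
Proof.
have [c c0 energy] := @energy_eventually R.
exists c => // F [g wg]; have mF := measurable_L2_fun F.
pose S : set (plane R) := [set z | disk (L2_fun F z)].
pose f : plane R -> plane R := fun z => if z \in S then L2_fun F z else 0.
have mS : measurable S.
  rewrite -[S]setTI; apply: (measurable_funPT (val F)) => //; exact: measurable_disk.
have mf i : measurable_fun setT (fun z => coord i (f z)).
  rewrite (_ : (fun z => _) = (fun z => coord i (L2_fun F z)) \_ S).
    by apply/(measurable_restrictT _ mS); exact: measurable_funTS.
  by apply/funext => z; rewrite /f patchE; case: ifP => // _; rewrite /coord; case: ifP.
have fdisk z : disk (f z).
  rewrite /f; case: (boolP (z \in S)) => [|_]; first by rewrite inE.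
  by rewrite /disk/= sqnormE/= expr0n addr0.
have fF : \forall z \ae (@leb2 R), disk z -> f z = L2_fun F z.
  by apply: filterS (L2_fun_disk F) => z h /h zS; rewrite /f mem_set.
have wgf : weak_gradient f g.
  have [h1 h2] := wg; split => // alpha i psi tpsi; rewrite -h2//.
  have [Cpsi _] := tpsi; have [_ psic] := Cpsi.
  have mD : measurable_fun setT (fun z => 'D_(basis alpha : plane R) psi z).
    by apply: continuous_measurable_plane => //; apply: continuous_subspaceT; exact: psic.
  congr fine; apply: ae_eq_integral.
  - exact: measurable_disk.
  - by apply/measurable_EFinP; apply: measurable_funTS; exact: measurable_funM.
  - by apply/measurable_EFinP; apply: measurable_funTS; exact: measurable_funM.
  - by apply: filterS fF => z h /h ->.
have [N0 H] := energy _ _ mf fdisk wgf.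
(* Any bound would do: it makes the weighted defect integrable, so that its extended integral is the
   real one. *)
have ddisk z : disk z -> defect f z <= 8.
  move=> dz; rewrite /defect sqnormE /=.
  have := fdisk z; move: dz; rewrite /disk/= !sqnormE.
  move: (f z).1 (f z).2 z.1 z.2 => x y u v h1 h2.
  have := sqr_ge0 (x ^+ 2 - y ^+ 2 + u); have := sqr_ge0 (2 * x * y + v).
  have : (x ^+ 2 + y ^+ 2) ^+ 2 <= 1 by rewrite exprn_ile1// addr_ge0// sqr_ge0.
  nra.
have mw : measurable_fun setT (fun z : plane R => sqnorm z ^+ N0).
  by apply: measurable_funX; exact: measurable_sqnorm.
exists N0 => N NN0; have := H N NN0.
have -> : \int[leb2]_(z in disk) (sqnorm z ^+ N * defect (L2_fun F) z) =
    \int[leb2]_(z in disk) (sqnorm z ^+ N * defect f z).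
  congr fine; apply: ae_eq_integral.
  - exact: measurable_disk.
  - apply/measurable_EFinP; apply: measurable_funTS; apply: measurable_funM; last exact: measurable_defect.
    by apply: measurable_funX; exact: measurable_sqnorm.
  - apply/measurable_EFinP; apply: measurable_funTS; apply: measurable_funM; last exact: measurable_defect.
    by apply: measurable_funX; exact: measurable_sqnorm.
  - by apply: filterS fF => z h /h; rewrite /defect => ->.
rewrite -EFin_Rintegral//; first exact: measurable_disk.
apply: (@integrable_le _ _ _ leb2 _ _ (fun=> 8)).
- exact: measurable_disk.
- apply: measurable_funTS; apply: measurable_funM; last exact: measurable_defect.
  by apply: measurable_funX; exact: measurable_sqnorm.
- by apply: integrable_cst_lty; [exact: measurable_disk|exact: leb2_disk_fin].
- move=> z dz; rewrite ger0_norm ?mulr_ge0 ?exprn_ge0 ?sqnorm_ge0// ?defect_ge0//.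
  apply: le_trans (ddisk z dz).
  by rewrite ler_piMl ?defect_ge0// exprn_ile1// sqnorm_ge0.
Qed.

End L2_energy.

(** * The functional carried by a superposition *)

Section uniform_continuity.
Context {R : realType}.
Implicit Types a : plane2 R -> R.

Local Notation D := (@disk R `*` @disk R).

Lemma compact_disk2 : compact D.
Proof. by apply: compact_setX; exact: compact_disk. Qed.

Lemma measurable_disk2 : measurable D.
Proof. by apply: measurableX; exact: measurable_disk. Qed.

(** Compactness in the form of near coverings: around each point of the product of disks some radius
    works, hence one radius works everywhere. The distance is measured by [sqnorm] because [L2_dist]
    is. *)
Lemma uniform_continuity_tgt a (w : R) : {within D, continuous a} -> 0 < w ->
  exists2 e : R, 0 < e & forall xi x y, disk xi -> disk x -> disk y ->
    sqnorm (x - y) < e -> `|a (xi, x) - a (xi, y)| < w.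
Proof.
move=> /subspace_continuousP ca w0.
pose P (e : R) (z : plane2 R) := D z -> forall y, disk y -> sqnorm (z.2 - y) < e ->
  `|a z - a (z.1, y)| < w.
have : \forall e \near 0^'+, D `<=` P e.
  apply: (compact_near_coveringP _).1; first exact: compact_disk2.
  move=> z0 Dz0; have w20 : 0 < w / 2 by rewrite divr_gt0.
  have H : \forall z \near z0, D z -> `|a z0 - a z| < w / 2.
    by have /cvgrPdist_lt /(_ _ w20) := ca z0 Dz0; exact.
  have /nbhs_ballP[e /= e0 He] := H.
  exists (ball z0 (e / 2), [set k : R | k < (e / 2) ^+ 2]); first split => /=.
  - by apply: nbhsx_ballx; rewrite divr_gt0.
  - by apply: nbhs_right_lt; rewrite exprn_gt0// divr_gt0.
  move=> [z k] /= [bz ke] Dz y dy zyk.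
  have bz' : ball z0 e z by apply: le_ball bz; lra.
  have bzy : ball z0 e (z.1, y).
    case: bz => b1 b2; split => /=.
      by apply: le_ball b1; lra.
    have hyz : forall u v : R, u ^+ 2 + v ^+ 2 < (e / 2) ^+ 2 -> `|u| < e / 2.
      move=> u v huv; rewrite -(@ltr_pXn2r _ 2) ?nnegrE//; last by rewrite divr_ge0// ltW.
      by rewrite -normrX ger0_norm ?sqr_ge0//; have := sqr_ge0 v; lra.
    have := lt_trans zyk ke; rewrite sqnormE /= => h.
    have h1 := hyz _ _ h.
    have h2 : `|z.2.2 - y.2| < e / 2 by apply: (hyz _ (z.2.1 - y.1)); rewrite addrC.
    case: b2 => /= c1 c2; split => /=; rewrite /ball/=.
      rewrite (_ : _ - y.1 = (z0.2.1 - z.2.1) + (z.2.1 - y.1)); last by ring.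
      by rewrite (le_lt_trans (ler_normD _ _))//; move: c1; rewrite /ball/=; lra.
    rewrite (_ : _ - y.2 = (z0.2.2 - z.2.2) + (z.2.2 - y.2)); last by ring.
    by rewrite (le_lt_trans (ler_normD _ _))//; move: c2; rewrite /ball/=; lra.
  have A1 := He z bz' Dz.
  have A2 := He (z.1, y) bzy (conj Dz.1 dy).
  rewrite (_ : a z - _ = (a z0 - a (z.1, y)) - (a z0 - a z)); last by ring.
  by rewrite (le_lt_trans (ler_normB _ _))//; lra.
move=> [e /= e0 He]; exists (e / 2); first by rewrite divr_gt0.
move=> xi x y dxi dx dy xy.
apply: (He (e / 2) _ _ (xi, x)) => //=.
- by rewrite sub0r normrN ger0_norm; lra.
- by rewrite divr_gt0.
Qed.

Lemma bounded_disk2 a : {within D, continuous a} -> exists M, forall z, D z -> `|a z| <= M.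
Proof. by move=> ca; apply: bounded_compact => //; exact: compact_disk2. Qed.

End uniform_continuity.

Section graph_functional.
Context {R : realType}.
Implicit Types (a : plane2 R -> R) (F G : @L2_disk R).

Local Notation D := (@disk R `*` @disk R).

Definition graph_int a F : R := \int[leb2]_(xi in disk) a (xi, L2_fun F xi).

(** A function continuous within the product of disks is arbitrary outside, where representatives
    may take values on a null set. Its restriction by 0 is measurable and bounded everywhere and
    gives the same integrals. *)
Definition meas_bounded a := measurable_fun setT a /\ exists M, forall z, `|a z| <= M.

Lemma meas_bounded_restrict a : {within D, continuous a} -> meas_bounded (a \_ D).
Proof.
move=> ca; split.
  by apply/(measurable_restrictT _ measurable_disk2); apply: continuous_measurable_plane2 => //; exact: measurable_disk2.
have [M hM] := bounded_disk2 ca; exists `|M| => z; rewrite patchE; case: (boolP (z \in D)) => zD.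
  by rewrite (le_trans (hM z (set_mem zD)))// ler_norm.
by rewrite normr0.
Qed.

Lemma measurable_L2_fun_plane F : measurable_fun setT (L2_fun F).
Proof. exact: measurable_funPT. Qed.

Lemma measurable_graph F : measurable_fun setT (fun xi => (xi, L2_fun F xi) : plane2 R).
Proof. by apply: measurable_fun_pair => //; exact: measurable_L2_fun_plane. Qed.

Lemma integrable_graph a F : meas_bounded a ->
  leb2.-integrable disk (EFin \o (fun xi => a (xi, L2_fun F xi))).
Proof.
move=> [ma [M hM]]; apply: (@integrable_le _ _ _ leb2 _ _ (fun=> M)).
- exact: measurable_disk.
- by apply: measurable_funTS; exact: (measurableT_comp ma (measurable_graph F)).
- by apply: integrable_cst_lty; [exact: measurable_disk|exact: leb2_disk_fin].
- by move=> z _; exact: hM.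
Qed.

Let area : R := fine (leb2 (@disk R)).

Lemma graph_int_bounded a : meas_bounded a -> exists M, forall F, `|graph_int a F| <= M.
Proof.
move=> /[dup] ba [ma [M hM]]; exists (M * area) => F.
apply: le_trans (le_normr_Rintegral _ (integrable_graph F ba)) _; first exact: measurable_disk.
rewrite -Rintegral_cst; last exact: measurable_disk.
apply: le_Rintegral; [exact: measurable_disk| | |by move=> z _; exact: hM].
  by have := integrable_abse (integrable_graph F ba); exact.
by apply: integrable_cst_lty; [exact: measurable_disk|exact: leb2_disk_fin].
Qed.

(** Where the squared distance s of the two maps is below [kap] the integrands differ by less than
    w; elsewhere the difference is at most 2 M <= C s. So it is at most w + C s almost everywhere,
    and the integral of s is the square of [L2_dist]. *)
Lemma graph_int_continuous a F (e : R) : {within D, continuous a} -> 0 < e ->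
  exists2 r : R, 0 < r & forall G, L2_dist F G < r ->
    `|graph_int (a \_ D) F - graph_int (a \_ D) G| < e.
Proof.
move=> ca e0; have ba := meas_bounded_restrict ca; have [_ [M hM]] := ba.
have area0 : 0 <= area by exact: fine_ge0.
(* With this [w], the constant term contributes less than e/2 after integration; the radius sqrt(e /
   (2 C)) below does the same for the term C s. *)
pose w := e / (2 * (area + 1)).
have w0 : 0 < w by rewrite divr_gt0// mulr_gt0// ltr_wpDl.
have [kap k0 Hk] := uniform_continuity_tgt ca w0.
have M0 : 0 <= M by apply: le_trans (hM 0).
pose C := 2 * (M + 1) / kap.
have C0 : 0 < C by rewrite divr_gt0// mulr_gt0// ltr_wpDl.
have eC : 0 < e / (2 * C) by rewrite divr_gt0// mulr_gt0.
exists (Num.sqrt (e / (2 * C))); first by rewrite sqrtr_gt0.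
move=> G FG.
pose s xi := sqnorm (L2_fun F xi - L2_fun G xi).
have ms : measurable_fun setT s.
  have m1 := measurable_L2_fun_plane F; have m2 := measurable_L2_fun_plane G.
  rewrite /s; under eq_fun do rewrite sqnormE /=.
  have c1 (H : @L2_disk R) : measurable_fun setT (fun xi => (L2_fun H xi).1).
    exact: (measurableT_comp measurable_fst (measurable_L2_fun_plane H)).
  have c2 (H : @L2_disk R) : measurable_fun setT (fun xi => (L2_fun H xi).2).
    exact: (measurableT_comp measurable_snd (measurable_L2_fun_plane H)).
  by apply: measurable_funD; apply: measurable_funX; apply: measurable_funB; (exact: c1 || exact: c2).
have s4 xi : disk (L2_fun F xi) -> disk (L2_fun G xi) -> s xi <= 4.
  rewrite /s /disk/= !sqnormE/=; move: (L2_fun F xi) (L2_fun G xi) => [x y] [u v] /= h1 h2.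
  have := sqr_ge0 (x + u); have := sqr_ge0 (y + v); nra.
(* Outside a null set [s <= 4]; the truncation makes it integrable. *)
pose s' xi := Num.min (s xi) 4.
have ms' : measurable_fun setT s' by apply: measurable_minr => //; exact: measurable_cst.
have s'0 xi : 0 <= s' xi by rewrite le_min sqnorm_ge0 ler0n.
have is' : leb2.-integrable disk (EFin \o s').
  apply: (@integrable_le _ _ _ leb2 _ _ (fun=> 4)).
  - exact: measurable_disk.
  - exact: measurable_funTS.
  - by apply: integrable_cst_lty; [exact: measurable_disk|exact: leb2_disk_fin].
  - by move=> z _; rewrite ger0_norm// ge_min lexx orbT.
have ss' : \int[leb2]_(xi in disk) s xi = \int[leb2]_(xi in disk) s' xi.
  congr fine; apply: ae_eq_integral.
  - exact: measurable_disk.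
  - by apply/measurable_EFinP; exact: measurable_funTS.
  - by apply/measurable_EFinP; exact: measurable_funTS.
  - apply: filterS2 (L2_fun_disk F) (L2_fun_disk G) => z h1 h2 dz.
    by rewrite /s' min_l// s4//; [exact: h1|exact: h2].
have dist2 : \int[leb2]_(xi in disk) s' xi < e / (2 * C).
  move: FG; rewrite /L2_dist ltr_sqrt//.
  by rewrite -[X in X < _ -> _]/(\int[leb2]_(xi in disk) s xi) ss'.
have iF := integrable_graph F ba; have iG := integrable_graph G ba.
have iFG := integrableBR (@measurable_disk R) iF iG.
have := RintegralB (@measurable_disk R) iF iG; rewrite -/(graph_int _ _) -/(graph_int _ _) => <-.
apply: le_lt_trans (le_normr_Rintegral _ iFG) _; first exact: measurable_disk.
have iws : leb2.-integrable disk (EFin \o (fun xi => w + C * s' xi)).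
  apply: integrableDR; first exact: measurable_disk.
    by apply: integrable_cst_lty; [exact: measurable_disk|exact: leb2_disk_fin].
  by apply: integrableZR => //; exact: measurable_disk.
apply: (@le_lt_trans _ _ (\int[leb2]_(xi in disk) (w + C * s' xi))).
  have iabs : leb2.-integrable disk (EFin \o (fun xi => `|(a \_ D) (xi, L2_fun F xi) - (a \_ D) (xi, L2_fun G xi)|)).
    by have := integrable_abse iFG; exact.
  rewrite -lee_fin !EFin_Rintegral//; [|exact: measurable_disk..].
  apply: ae_ge0_le_integral.
  - exact: measurable_disk.
  - by move=> z _; rewrite lee_fin.
  - exact: (measurable_int _ iabs).
  - by move=> z _; rewrite lee_fin; apply: addr_ge0; [exact: ltW|apply: mulr_ge0 => //; exact: ltW].
  - exact: (measurable_int _ iws).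
  apply: filterS2 (L2_fun_disk F) (L2_fun_disk G) => z h1 h2 dz; rewrite lee_fin.
  have d1 := h1 dz; have d2 := h2 dz.
  rewrite /s' min_l ?s4//.
  case: (ltP (s z) kap) => hs.
    rewrite !patchE !mem_set//; apply: le_trans (ltW (Hk _ _ _ dz d1 d2 hs)) _.
    by rewrite lerDl; apply: mulr_ge0; [exact: ltW|exact: sqnorm_ge0].
  apply: (@le_trans _ _ (2 * (M + 1))).
    rewrite (le_trans (ler_normB _ _))//.
    by have := hM (z, L2_fun F z); have := hM (z, L2_fun G z); lra.
  apply: (@le_trans _ _ (C * s z)); last by rewrite lerDr ltW.
  have h3 : 1 <= kap^-1 * s z by rewrite ler_pdivlMl// mulr1.
  by rewrite /C -mulrA -[X in X <= _]mulr1 ler_wpM2l// mulr_ge0// addr_ge0.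
have iw : leb2.-integrable disk (EFin \o (fun=> w)).
  by apply: integrable_cst_lty; [exact: measurable_disk|exact: leb2_disk_fin].
rewrite (RintegralD (@measurable_disk R) iw (integrableZR C (@measurable_disk R) is')).
rewrite (Rintegral_cst _ (@measurable_disk R)) (RintegralZl _ (@measurable_disk R) is').
rewrite -/area.
have h1 : w * (2 * (area + 1)) = e by rewrite /w divfK// gt_eqF// mulr_gt0// ltr_wpDl.
have C20 : 0 < 2 * C by rewrite mulr_gt0.
have h2 : (\int[leb2]_(xi in disk) s' xi) * (2 * C) < e by rewrite -ltr_pdivlMr.
set I := Rintegral _ _ _ in h2 *.
move: h1 h2 w0; clearbody I w C area => h1 h2 w0.
by nra.
Qed.

(** By continuity the sets where the functional exceeds x are open for [L2_dist], hence among the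
    generators. *)
Lemma measurable_graph_int a : {within D, continuous a} ->
  measurable_fun setT (graph_int (a \_ D) : g_sigma_algebraType (@L2_open R) -> R).
Proof.
move=> ca; apply: (measurability _ (RGenOInfty.measurableE R)).
move=> _ [_ [x ->] <-]; rewrite setTI; apply: sub_sigma_algebra => F _.
rewrite /= in_itv/= andbT => xF.
have e0 : 0 < graph_int (a \_ D) F - x by rewrite subr_gt0.
have [r r0 Hr] := graph_int_continuous F ca e0.
exists r => // G _ /Hr; rewrite in_itv/= andbT ltr_norml => /andP[_ h]; lra.
Qed.

End graph_functional.

Section representation.
Context {R : realType}.
Implicit Types (a : plane2 R -> R).

Local Notation D := (@disk R `*` @disk R).

Variable mu : plane R -> probability (plane R) R.
Variable Q : probability (g_sigma_algebraType (@L2_open R)) R.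
Hypothesis repr : forall a, {within D, continuous a} ->
  int_mu mu a = \int[Q]_(F in setT) \int[lebesgue2]_(xi in disk) a (xi, L2_fun F xi).

Lemma int_mu_eq (nu : plane R -> probability (plane R) R) a b :
  (forall z, D z -> a z = b z) -> int_mu nu a = int_mu nu b.
Proof.
move=> ab; apply: eq_Rintegral => xi; rewrite inE => dxi.
by apply: eq_Rintegral => x; rewrite inE => dx; exact: ab.
Qed.

Lemma within_restrict a : {within D, continuous a} -> {within D, continuous (a \_ D)}.
Proof.
move=> ca; apply: (subspace_eq_continuous _ ca) => z zD.
by rewrite /from_subspace /patch zD.
Qed.

Lemma int_muE a : {within D, continuous a} -> int_mu mu a = \int[Q]_F graph_int (a \_ D) F.
Proof.
move=> ca; rewrite (@int_mu_eq _ _ (a \_ D)); last by move=> z Dz; rewrite patchE mem_set.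
by rewrite repr//; exact: within_restrict.
Qed.

Lemma integrable_graph_int a : {within D, continuous a} ->
  Q.-integrable setT (EFin \o graph_int (a \_ D)).
Proof.
move=> ca; have [M hM] := graph_int_bounded (meas_bounded_restrict ca).
apply: (@integrable_le _ _ _ Q _ _ (fun=> M)) => //.
- exact: measurable_graph_int.
- by apply: integrable_cst_lty => //; rewrite (le_lt_trans (probability_le1 _ _))// ltry.
Qed.

(** Read off from the representation by Q: for each map the integrand is bounded and measurable on
    the disk, and the resulting functional is bounded and measurable on the space of maps, so both
    integrals are linear. *)
Lemma int_mu_lincomb a b (r s : R) : {within D, continuous a} -> {within D, continuous b} ->
  int_mu mu (fun z => r * a z + s * b z) = r * int_mu mu a + s * int_mu mu b.
Proof.
move=> ca cb.
have cab : {within D, continuous (fun z => r * a z + s * b z)}.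
  move=> z; apply: cvgD; apply: cvgM; try exact: cvg_cst; [exact: ca|exact: cb].
have ia := integrable_graph_int ca; have ib := integrable_graph_int cb.
rewrite !int_muE// -!RintegralZl// -RintegralD//; [|exact: integrableZR..].
apply: eq_Rintegral => F _.
have ja := integrable_graph F (meas_bounded_restrict ca).
have jb := integrable_graph F (meas_bounded_restrict cb).
have md := @measurable_disk R.
rewrite /graph_int -(RintegralZl r md ja) -(RintegralZl s md jb).
rewrite -(RintegralD md (integrableZR r md ja) (integrableZR s md jb)).
apply: eq_Rintegral => xi _; rewrite !patchE.
by case: ifP => // _; rewrite !mulr0 addr0.
Qed.

Lemma int_mu_le a b : {within D, continuous a} -> {within D, continuous b} ->
  (forall z, D z -> a z <= b z) -> int_mu mu a <= int_mu mu b.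
Proof.
move=> ca cb ab; rewrite (int_muE ca) (int_muE cb).
have ia := integrable_graph_int ca; have ib := integrable_graph_int cb.
apply: le_Rintegral => // F _.
have ja := integrable_graph F (meas_bounded_restrict ca).
have jb := integrable_graph F (meas_bounded_restrict cb).
apply: le_Rintegral => //; first exact: measurable_disk.
move=> xi _; rewrite !patchE; case: ifP => // /set_mem; exact: ab.
Qed.

(** The first marginal of mu is the Lebesgue measure of the disk, because Q has mass 1. *)
Lemma int_mu_src (u : plane R -> R) : continuous u ->
  int_mu mu (fun z => u z.1) = \int[leb2]_(xi in disk) u xi.
Proof.
move=> cu.
have ca : {within D, continuous (fun z : plane2 R => u z.1)}.
  apply: continuous_subspaceT => z; apply: (@continuous_comp _ _ _ fst u); last exact: cu.
  exact: cvg_fst.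
rewrite int_muE//.
transitivity (\int[Q]_(F in setT) (\int[leb2]_(xi in disk) u xi)); last first.
  by rewrite Rintegral_cst// -[RHS]mulr1; congr (_ * _); exact: (congr1 fine (probability_setT Q)).
apply: eq_Rintegral => F _.
have mu_ : measurable_fun setT u by apply: continuous_measurable_plane => //; exact: continuous_subspaceT.
congr fine; apply: ae_eq_integral.
- exact: measurable_disk.
- exact: (measurable_int _ (integrable_graph F (meas_bounded_restrict ca))).
- by apply/measurable_EFinP; exact: measurable_funTS.
- apply: filterS (L2_fun_disk F) => z h dz; rewrite patchE mem_set//.
  by split => //=; exact: h.
Qed.

End representation.

(** * Independence of the admissible field *)

Section charge_integral.
Context {R : realType}.
Implicit Types (a : plane2 R -> R) (E : 'I_2 -> 'I_2 -> {charge set (plane2 R) -> \bar R}).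

Local Notation D := (@disk R `*` @disk R).

Lemma within_integrable (m : {finite_measure set (plane2 R) -> \bar R}) a :
  {within D, continuous a} -> m.-integrable D (EFin \o a).
Proof.
move=> ca; have [M hM] := bounded_disk2 ca.
apply: (@integrable_le _ _ _ m _ _ (fun=> M)) => //.
- exact: measurable_disk2.
- by apply: continuous_measurable_plane2 => //; exact: measurable_disk2.
- apply: integrable_cst_lty; first exact: measurable_disk2.
  rewrite -ge0_fin_numE//; apply: fin_num_measure; exact: measurable_disk2.
Qed.

Lemma within_lincomb a (b : plane2 R -> R) (r s : R) : {within D, continuous a} -> {within D, continuous b} ->
  {within D, continuous (fun z => r * a z + s * b z)}.
Proof.
move=> ca cb z; apply: cvgD; apply: cvgM; try exact: cvg_cst; [exact: ca|exact: cb].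
Qed.

Lemma within_mul a (b : plane2 R -> R) : {within D, continuous a} -> {within D, continuous b} ->
  {within D, continuous (fun z => a z * b z)}.
Proof. by move=> ca cb z; apply: cvgM; [exact: ca|exact: cb]. Qed.

Lemma within_add a (b : plane2 R -> R) : {within D, continuous a} -> {within D, continuous b} ->
  {within D, continuous (fun z => a z + b z)}.
Proof. by move=> ca cb z; apply: cvgD; [exact: ca|exact: cb]. Qed.

Lemma Rintegral_lincomb (m : {finite_measure set (plane2 R) -> \bar R}) a (b : plane2 R -> R) (r s : R) :
  {within D, continuous a} -> {within D, continuous b} ->
  \int[m]_(z in D) (r * a z + s * b z) = r * \int[m]_(z in D) a z + s * \int[m]_(z in D) b z.
Proof.
move=> ca cb; have ia := within_integrable m ca; have ib := within_integrable m cb.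
have mD := @measurable_disk2 R.
rewrite -(RintegralZl r mD ia) -(RintegralZl s mD ib).
by rewrite -(RintegralD mD (integrableZR r mD ia) (integrableZR s mD ib)).
Qed.

Lemma charge_int_lincomb (nu : {charge set (plane2 R) -> \bar R}) a (b : plane2 R -> R) (r s : R) :
  {within D, continuous a} -> {within D, continuous b} ->
  charge_int nu D (fun z => r * a z + s * b z) = r * charge_int nu D a + s * charge_int nu D b.
Proof.
move=> ca cb.
have distr (x y z w : R) : r * x + s * y - (r * z + s * w) = r * (x - z) + s * (y - w) by ring.
by apply: etrans (distr _ _ _ _); congr (_ - _); exact: Rintegral_lincomb. Qed.

Definition within_field (b : 'I_2 -> 'I_2 -> plane2 R -> R) :=
  forall alpha i, {within D, continuous (b alpha i)}.

Definition field_lincomb (r s : R) (b b' : 'I_2 -> 'I_2 -> plane2 R -> R) alpha i z :=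
  r * b alpha i z + s * b' alpha i z.

Definition field_inner (b b' : 'I_2 -> 'I_2 -> plane2 R -> R) (z : plane2 R) : R :=
  \sum_(alpha < 2) \sum_(i < 2) b alpha i z * b' alpha i z.

Lemma within_field_inner (b b' : 'I_2 -> 'I_2 -> plane2 R -> R) : within_field b -> within_field b' ->
  {within D, continuous (field_inner b b')}.
Proof.
move=> cb cb'; rewrite /field_inner; under eq_fun do rewrite !big_ord_recl !big_ord0 !addr0.
by do 2?[apply: within_add]; apply: within_mul; (exact: cb || exact: cb').
Qed.

Lemma within_field_lincomb r s (b b' : 'I_2 -> 'I_2 -> plane2 R -> R) : within_field b -> within_field b' ->
  within_field (field_lincomb r s b b').
Proof. by move=> cb cb' alpha i; apply: within_lincomb; [exact: cb|exact: cb']. Qed.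

Lemma field_inner_lincomb (r : R) (b b' : 'I_2 -> 'I_2 -> plane2 R -> R) z :
  field_inner (field_lincomb 1 r b b') (field_lincomb 1 r b b') z =
  field_inner b b z + 2 * r * field_inner b b' z + r ^+ 2 * field_inner b' b' z.
Proof.
rewrite /field_inner /field_lincomb !mulr_sumr -!big_split/=; apply: eq_bigr => alpha _.
rewrite !mulr_sumr -!big_split/=; apply: eq_bigr => i _; ring.
Qed.

Lemma int_E_lincomb E r s (b b' : 'I_2 -> 'I_2 -> plane2 R -> R) : within_field b -> within_field b' ->
  int_E E (field_lincomb r s b b') = r * int_E E b + s * int_E E b'.
Proof.
move=> cb cb'; rewrite /int_E !mulr_sumr -big_split/=; apply: eq_bigr => alpha _.
rewrite !mulr_sumr -big_split/=; apply: eq_bigr => i _.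
by rewrite charge_int_lincomb.
Qed.

Lemma int_E_eq E (b b' : 'I_2 -> 'I_2 -> plane2 R -> R) : (forall alpha i z, D z -> b alpha i z = b' alpha i z) ->
  int_E E b = int_E E b'.
Proof.
move=> bb; apply: eq_bigr => alpha _; apply: eq_bigr => i _.
by rewrite /charge_int; congr (_ - _); apply: eq_Rintegral => z; rewrite inE; exact: bb.
Qed.

End charge_integral.

(** * Bounds for fields of finite energy *)

Section near_optimal.
Context {R : realType}.
Implicit Types (b : 'I_2 -> 'I_2 -> plane2 R -> R).
Local Notation D := (@disk R `*` @disk R).
Variable mu : plane R -> probability (plane R) R.
Variable Q : probability (g_sigma_algebraType (@L2_open R)) R.
Hypothesis repr : forall a : plane2 R -> R, {within D, continuous a} ->
  int_mu mu a = \int[Q]_(F in setT) \int[lebesgue2]_(xi in disk) a (xi, L2_fun F xi).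
Variable E : 'I_2 -> 'I_2 -> {charge set (plane2 R) -> \bar R}.
Hypothesis EDir : (Dir_pair mu E < +oo)%E.

(* Testing the supremum that defines [Dir_pair] with [b0 + lam * b], where [b0] is optimal up to [e]. *)
Lemma near_optimal (e : R) : 0 < e -> exists2 b0, within_field b0 &
  forall b (lam : R), within_field b -> 0 < lam ->
    int_E E b <= e / lam + int_mu mu (field_inner b0 b) + lam / 2 * int_mu mu (field_inner b b).
Proof.
move=> e0.
have c0 : within_field (fun _ _ => cst 0 : plane2 R -> R).
  by move=> alpha i z; exact: cvg_cst.
(* The pair (0, 0) is admissible, so the supremum is nonnegative; being finite, it is attained up to
   e. *)
have Dir0 : (0 <= Dir_pair mu E)%E.
  apply: ereal_sup_ubound; exists (cst 0), (fun _ _ => cst 0); split => //.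
  - by move=> z; exact: cvg_cst.
  - by move=> z _; rewrite /= big1 ?mulr0 ?addr0// => alpha _; rewrite big1// => i _; rewrite expr0n.
  have ci : {within D, continuous (cst 0 : plane2 R -> R)} by move=> z; exact: cvg_cst.
  have -> : int_mu mu (cst 0) = 0.
    have := int_mu_lincomb repr 0 0 ci ci; rewrite !mul0r addr0; apply: etrans.
    by apply: int_mu_eq => z _; rewrite !mul0r addr0.
  have -> : int_E E (fun _ _ => cst 0) = 0.
    have := int_E_lincomb E 0 0 c0 c0; rewrite !mul0r addr0; apply: etrans.
    by apply: int_E_eq => alpha i z _; rewrite /field_lincomb !mul0r addr0.
  by rewrite addr0.
have fin : Dir_pair mu E \is a fin_num by rewrite ge0_fin_numE.
have [_ [a0 [b0 [ca0 cb0 ab0 ->]]] near] := ub_ereal_sup_adherent e0 fin.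
exists b0 => // b lam cb lam0.
pose b1 := field_lincomb 1 lam b0 b.
have cb1 : within_field b1 by exact: within_field_lincomb.
have c00 := within_field_inner cb0 cb0; have c0b := within_field_inner cb0 cb.
have cbb := within_field_inner cb cb; have c11 := within_field_inner cb1 cb1.
(* For a given [b1], the largest admissible [a] is - |b1|^2 / 2. The summand with factor 0 only
   gives it the shape expected by [within_lincomb]. *)
have ub : ((int_mu mu (fun z => - 2^-1 * field_inner b1 b1 z + 0 * field_inner b1 b1 z) + int_E E b1)%:E <= Dir_pair mu E)%E.
  apply: ereal_sup_ubound; eexists; exists b1; split; [| | |reflexivity].
  - exact: within_lincomb.
  - exact: cb1.
  - move=> z _; rewrite /field_inner; under [X in 2^-1 * X]eq_bigr do under eq_bigr do rewrite expr2.
    by rewrite mul0r addr0 mulNr addNr.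
have E1 : int_mu mu (fun z => - 2^-1 * field_inner b1 b1 z + 0 * field_inner b1 b1 z) =
   - 2^-1 * int_mu mu (field_inner b0 b0) - lam * int_mu mu (field_inner b0 b) - lam ^+ 2 / 2 * int_mu mu (field_inner b b).
  rewrite (@int_mu_eq _ _ _ (fun z => 1 * (- 2^-1 * field_inner b0 b0 z + (- lam) * field_inner b0 b z) + (- (lam ^+ 2 / 2)) * field_inner b b z)).
    rewrite (int_mu_lincomb repr)//; last exact: within_lincomb.
    rewrite (int_mu_lincomb repr)//.
    move: (int_mu mu (field_inner b0 b0)) (int_mu mu (field_inner b0 b)) (int_mu mu (field_inner b b)) => x y z.
    by ring.
  by move=> z _; rewrite field_inner_lincomb; field.
have E2 : int_E E b1 = int_E E b0 + lam * int_E E b by rewrite int_E_lincomb// mul1r.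
have le0 : int_mu mu a0 <= - 2^-1 * int_mu mu (field_inner b0 b0).
  have := @int_mu_le _ _ _ repr a0 (fun z => - 2^-1 * field_inner b0 b0 z + 0 * field_inner b0 b0 z) ca0.
  rewrite (int_mu_lincomb repr)// mul0r addr0; apply; first exact: within_lincomb.
  move=> w Dw; have := ab0 w Dw; rewrite /field_inner.
  under eq_bigr do under eq_bigr do rewrite expr2.
  by rewrite mul0r addr0 mulNr -lerBrDr sub0r.
move: near ub; rewrite -/(Dir_pair mu E) -(fineK fin) E1 E2 -EFinB lte_fin lee_fin => near ub.
(* The term |b0|^2 / 2 from the expansion of |b1|^2 / 2 is cancelled by a0 <= - |b0|^2 / 2, and the
   values of E on [b0] cancel too; what remains is e, the cross term and the quadratic term in
   lam. *)
have key : lam * int_E E b <= e + lam * int_mu mu (field_inner b0 b) + lam ^+ 2 / 2 * int_mu mu (field_inner b b).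
  move: near ub le0; move: (fine (Dir_pair mu E)) (int_mu mu a0) (int_mu mu (field_inner b0 b0)).
  move: (int_mu mu (field_inner b0 b)) (int_mu mu (field_inner b b)) (int_E E b0) (int_E E b).
  clear; move=> x0 x1 x2 x3 x4 x5 x6.
  set u := lam * x0; set v := lam ^+ 2 / 2 * x1; set w := lam * x3; set s := - 2^-1 * x6.
  lra.
rewrite -(ler_pM2l lam0); apply: le_trans key _.
move: (int_mu mu (field_inner b0 b)) (int_mu mu (field_inner b b)) => x y.
by rewrite le_eqVlt; apply/orP; left; apply/eqP; field; rewrite gt_eqF.
Qed.

End near_optimal.

Section projections.
Context {R : realType}.
Implicit Types (z v : plane2 R).

Lemma C1d_src i : C1d (fun z => coord i z.1) (fun v _ => coord i v.1).
Proof.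
apply: C1d_linear => [r u w|z]; rewrite /coord; case: (i == ord0) => //.
- by apply: (@continuous_comp (plane2 R) (plane R) R fst fst); exact: cvg_fst.
- by apply: (@continuous_comp (plane2 R) (plane R) R fst snd); [exact: cvg_fst|exact: cvg_snd].
Qed.

Lemma C1d_tgt i : C1d (fun z => coord i z.2) (fun v _ => coord i v.2).
Proof.
apply: C1d_linear => [r u w|z]; rewrite /coord; case: (i == ord0) => //.
- by apply: (@continuous_comp (plane2 R) (plane R) R snd fst); [exact: cvg_snd|exact: cvg_fst].
- by apply: (@continuous_comp (plane2 R) (plane R) R snd snd); exact: cvg_snd.
Qed.

Lemma C1d_sqnorm_src : exists df, C1d (fun z => sqnorm z.1) df.
Proof.
have C i := C1d_mul (C1d_src i) (C1d_src i).
have Cs := C1d_add (C ord0) (C (lift ord0 ord0)); eexists.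
rewrite (_ : (fun z => sqnorm z.1) = (fun z => coord ord0 z.1 * coord ord0 z.1 +
  coord (lift ord0 ord0) z.1 * coord (lift ord0 ord0) z.1)); first exact: Cs.
by apply/funext => z; rewrite sqnormE !expr2.
Qed.

Lemma derive_tgt_cst (u : plane R -> R) (w : plane R) z : 'D_((0, w) : plane2 R) (fun z => u z.1) z = 0.
Proof.
rewrite /derive (_ : (fun h => _) = cst 0) ?lim_cst//; apply/funext => h /=.
by rewrite scaler0 add0r subrr scaler0.
Qed.

End projections.

(** * Cutoffs in the source variable *)

Section cutoff.
Context {R : realType}.
Implicit Types (xi : plane R).

(** It vanishes where n (1 - |xi|^2) <= 1, which gives a compact support in the open disk, and
    equals 1 where n (1 - |xi|^2) >= 2. *)
Definition cutoff n xi : R := saturate 1 (pos2 (n%:R * (1 - sqnorm xi) - 1)).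

Lemma cutoff_ge0 n xi : 0 <= cutoff n xi <= 1.
Proof. by apply: saturate_ge0; exact: pos2_ge0. Qed.

Lemma cutoff_eq1 xi : sqnorm xi < 1 -> \forall n \near \oo, cutoff n xi = 1.
Proof.
rewrite -subr_gt0 => x0; near=> n; rewrite /cutoff /saturate.
have h : 2 <= n%:R * (1 - sqnorm xi).
  by rewrite -ler_pdivrMr//; near: n; exact: nbhs_infty_ger.
rewrite [pos2 (1 - _)]pos2_le0 ?subr0// mul1r subr_le0 /pos2 max_l; last by lra.
by rewrite expr_ge1//; lra.
Unshelve. all: by end_near. Qed.

Lemma cutoff_eq0 n xi : n%:R * (1 - sqnorm xi) <= 1 -> cutoff n xi = 0.
Proof. by move=> h; rewrite /cutoff [pos2 (_ - 1)]pos2_le0 ?saturate_eq0// subr_le0. Qed.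

Lemma C1d_cutoff n : exists df, C1d (fun z : plane2 R => cutoff n z.1) df.
Proof.
have [df Cf] := @C1d_sqnorm_src R.
exact: (C1d_saturate 1 (C1d_pos2 (C1d_add (C1d_mul (C1d_cst n%:R) (C1d_add (C1d_cst 1) (C1d_opp Cf))) (C1d_cst (- 1))))).
Qed.

Lemma continuous_cutoff n : continuous (cutoff n).
Proof.
have [df Cf] := C1d_cutoff n; move=> xi.
apply: (@continuous_comp (plane R) (plane2 R) R (fun x => (x, x)) (fun z => cutoff n z.1)); last exact: (C1d_continuous Cf).
apply: (cvg_pair (F:=nbhs xi) (G:=nbhs xi) (H:=nbhs xi)); exact: cvg_id.
Qed.

Lemma compact_cutoff n : exists X, [/\ compact X, X `<=` (@disk R)^° & forall xi, ~ X xi -> cutoff n xi = 0].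
Proof.
exists [set xi | 1 <= n%:R * (1 - sqnorm xi)]; split.
- apply: (@subclosed_compact _ _ (@disk R)); last 2 first.
  + exact: compact_disk.
  + move=> xi /= h; rewrite /disk/= leNgt; apply/negP => x1.
    by have : 0 <= n%:R :> R by []; nra.
  + rewrite (_ : [set _ | _] = (fun xi => n%:R * (1 - sqnorm xi)) @^-1` [set x | 1 <= x])//.
    apply: closed_comp; last exact: closed_ge.
    move=> xi _; apply: cvgM; first exact: cvg_cst.
    by apply: cvgB; [exact: cvg_cst|exact: continuous_sqnorm].
- move=> xi /= h; apply: open_disk_interior; rewrite ltNge; apply/negP => x1.
  by have : 0 <= n%:R :> R by []; nra.
- by move=> xi /negP; rewrite -ltNge => /ltW; exact: cutoff_eq0.
Qed.

Lemma cutoff_cvg : \int[leb2]_(xi in disk) ((1 - cutoff n xi) ^+ 2) @[n --> \oo] --> (0 : R).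
Proof.
have mu_ n : measurable_fun disk (fun xi => (1 - cutoff n xi) ^+ 2).
  apply: measurable_funX; apply: measurable_funB; first exact: measurable_cst.
  apply: continuous_measurable_plane; first exact: measurable_disk.
  by apply: continuous_subspaceT; exact: continuous_cutoff.
have bnd n xi : `|(1 - cutoff n xi) ^+ 2| <= 1.
  rewrite ger0_norm ?sqr_ge0//; have /andP[] := cutoff_ge0 n xi; nra.
have i1 : leb2.-integrable disk (EFin \o (fun=> 1 : R)).
  by apply: integrable_cst_lty; [exact: measurable_disk|exact: leb2_disk_fin].
have [] := @dominated_convergence _ _ R leb2 disk measurable_disk
   (fun n xi => ((1 - cutoff n xi) ^+ 2)%:E) (cst 0%E) (fun xi => 1%:E)%E => //.
- by move=> n; exact/measurable_EFinP.
- apply: filterS ae_sqnorm_lt1 => xi x1 /x1 {}x1.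
  apply: cvg_near_cst; apply: filterS (cutoff_eq1 x1) => n ->.
  by rewrite subrr expr0n.
- by apply: aeW => xi n _; rewrite /= lee_fin.
- move=> _ _; rewrite integral0 => h.
  exact: (@fine_cvg _ _ _ _ _ 0).
Qed.

End cutoff.

Section independence.
Context {R : realType}.
Local Notation D := (@disk R `*` @disk R).
Implicit Types (b : 'I_2 -> 'I_2 -> plane2 R -> R).
Implicit Types (E : 'I_2 -> 'I_2 -> {charge set (plane2 R) -> \bar R}).
Variable mu : plane R -> probability (plane R) R.
Variable Q : probability (g_sigma_algebraType (@L2_open R)) R.
Hypothesis repr : forall a : plane2 R -> R, {within D, continuous a} ->
  int_mu mu a = \int[Q]_(F in setT) \int[lebesgue2]_(xi in disk) a (xi, L2_fun F xi).

Lemma int_mu_ge0 (nu : plane R -> probability (plane R) R) a :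
  (forall z, D z -> 0 <= a z) -> 0 <= int_mu nu a.
Proof.
by move=> a0; apply: Rintegral_ge0 => xi dxi; apply: Rintegral_ge0 => x dx; exact: a0.
Qed.

(** Young's inequality applied to the cross term of [near_optimal]. Since lam is free, this is a
    Cauchy-Schwarz inequality in L^2(mu), obtained without writing E as a density times mu. *)
Lemma int_E_quadratic_bound E : (Dir_pair mu E < +oo)%E -> exists K : R,
  forall b (lam : R), within_field b -> 0 < lam ->
    int_E E b <= K / lam + lam * int_mu mu (field_inner b b).
Proof.
move=> EDir; have [b0 cb0 near] := near_optimal repr EDir ltr01.
exists (1 + int_mu mu (field_inner b0 b0) / 2) => b lam cb lam0.
apply: le_trans (near _ _ cb lam0) _.
have c00 := within_field_inner cb0 cb0; have c0b := within_field_inner cb0 cb.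
have cbb := within_field_inner cb cb.
have : int_mu mu (field_inner b0 b) <= (2 * lam)^-1 * int_mu mu (field_inner b0 b0) + lam / 2 * int_mu mu (field_inner b b).
  rewrite -(int_mu_lincomb repr)//; apply: (int_mu_le repr) => //; first exact: within_lincomb.
  move=> z _; rewrite /field_inner !mulr_sumr -big_split; apply: ler_sum => alpha _.
  rewrite /= !mulr_sumr -big_split; apply: ler_sum => i _ /=.
  rewrite -(ler_pM2l (_ : 0 < 2 * lam)) ?mulr_gt0// mulrDr mulVKf ?mulf_neq0 ?gt_eqF//.
  have := sqr_ge0 (b0 alpha i z - lam * b alpha i z); nra.
move: (int_mu mu (field_inner b0 b0)) (int_mu mu (field_inner b0 b)) (int_mu mu (field_inner b b)) => x y z h.
have -> : (1 + x / 2) / lam + lam * z = 1 / lam + ((2 * lam)^-1 * x + lam / 2 * z) + lam / 2 * z.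
  by field; rewrite gt_eqF.
by rewrite lerD2r lerD2l.
Qed.

Lemma continuous_within_field phi : (forall alpha, C1 (phi alpha)) ->
  within_field (grad_tgt phi : 'I_2 -> 'I_2 -> plane2 R -> R).
Proof. by move=> Cphi alpha i; apply: continuous_subspaceT; exact: (Cphi alpha).2. Qed.

Section cutoff_field.
Variable phi : 'I_2 -> plane2 R -> R.
Hypothesis Cphi : forall alpha, C1 (phi alpha).

Definition cutoff_field n alpha (z : plane2 R) : R := cutoff n z.1 * phi alpha z.

Lemma C1_cutoff_field n alpha : C1 (cutoff_field n alpha).
Proof.
have [df Cf] := @C1d_cutoff R n.
exact: (C1d_C1 (C1d_mul Cf (C1_C1d (Cphi alpha)))).
Qed.

Lemma grad_tgt_cutoff_field n alpha i z :
  grad_tgt (cutoff_field n) alpha i z = cutoff n z.1 * grad_tgt phi alpha i z.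
Proof.
have [df Cf] := @C1d_cutoff R n.
have [_ E _] := C1d_mul Cf (C1_C1d (Cphi alpha)); rewrite [LHS]E.
have [_ {}E _] := Cf; rewrite -[df _ _]E.
by rewrite (derive_tgt_cst (cutoff n)) mul0r add0r.
Qed.

Lemma weak_div_cutoff_field E n : continuity_equation mu E -> weak_div mu (cutoff_field n) E = 0.
Proof.
move=> CE; apply: CE; first exact: C1_cutoff_field.
have [X [cX XD X0]] := @compact_cutoff R n.
by exists X; split => // xi x alpha _ _ /X0 h; rewrite /cutoff_field/= h mul0r.
Qed.

Let rest n := field_lincomb 1 (-1) (grad_tgt phi) (grad_tgt (cutoff_field n)).

Let within_rest n : within_field (rest n).
Proof.
apply: within_field_lincomb; first exact: continuous_within_field.
exact: (continuous_within_field (C1_cutoff_field n)).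
Qed.

(** The cutoff depends on the source variable alone, so [rest n] is 1 - [cutoff n] times the
    gradient of [phi] in the target. That gradient is bounded, and the first marginal of mu is the
    Lebesgue measure. *)
Lemma rest_cvg : int_mu mu (field_inner (rest n) (rest n)) @[n --> \oo] --> (0 : R).
Proof.
have cg := continuous_within_field Cphi.
have [M hM] := bounded_disk2 (within_field_inner cg cg).
have cc n : continuous (fun xi : plane R => (1 - cutoff n xi) ^+ 2).
  move=> xi; apply: (@continuous_comp _ _ _ (fun xi : plane R => 1 - cutoff n xi) (fun x => x ^+ 2)).
    by apply: cvgB; [exact: cvg_cst|exact: continuous_cutoff].
  exact: exprn_continuous.
have c1 n : {within D, continuous (fun z : plane2 R => (1 - cutoff n z.1) ^+ 2)}.
  apply: continuous_subspaceT => z.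
  by apply: (@continuous_comp _ _ _ fst (fun xi : plane R => (1 - cutoff n xi) ^+ 2)); [exact: cvg_fst|exact: cc].
apply: (@squeeze_cvgr _ _ _ _ (cst 0) (fun n => M * \int[leb2]_(xi in disk) ((1 - cutoff n xi) ^+ 2))).
- apply: nearW => n; apply/andP; split.
    apply: int_mu_ge0.
    by move=> z _; rewrite /field_inner; do 2!apply: sumr_ge0 => ? _; rewrite -expr2 sqr_ge0.
  rewrite -(int_mu_src repr (cc n)).
  have -> : M * int_mu mu (fun z => (1 - cutoff n z.1) ^+ 2) =
      int_mu mu (fun z => M * (1 - cutoff n z.1) ^+ 2 + 0 * (1 - cutoff n z.1) ^+ 2).
    by rewrite (int_mu_lincomb repr)// mul0r addr0.
  apply: (int_mu_le repr); [exact: within_field_inner|exact: within_lincomb|].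
  move=> z Dz; rewrite mul0r addr0.
  have -> : field_inner (rest n) (rest n) z = (1 - cutoff n z.1) ^+ 2 * field_inner (grad_tgt phi) (grad_tgt phi) z.
    rewrite /field_inner mulr_sumr; apply: eq_bigr => alpha _; rewrite mulr_sumr; apply: eq_bigr => i _.
    by rewrite /rest /field_lincomb grad_tgt_cutoff_field; ring.
  by rewrite mulrC ler_wpM2r ?sqr_ge0// (le_trans (ler_norm _))// hM.
- exact: cvg_cst.
- rewrite -[X in _ --> X](mulr0 M); apply: cvgM; first exact: cvg_cst.
  exact: cutoff_cvg.
Qed.

(** The derivative of the cutoff blows up, but it occurs only in the source divergence, which is
    common to E and E'. Subtracting the two continuity equations tested with the cut off field
    leaves the integrals of [rest n] against E and E', and these are small because [rest n] tends to
    0 in L^2(mu). Exchanging E and E' gives equality. *)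
Lemma weak_div_le E E' : continuity_equation mu E -> (Dir_pair mu E < +oo)%E ->
  continuity_equation mu E' -> (Dir_pair mu E' < +oo)%E ->
  weak_div mu phi E <= weak_div mu phi E'.
Proof.
move=> CE /int_E_quadratic_bound[K hK] CE' /int_E_quadratic_bound[K' hK'].
rewrite leNgt; apply/negP; rewrite -subr_gt0; set W := _ - _ => W0.
have cg := continuous_within_field Cphi.
have cgn n := continuous_within_field (C1_cutoff_field n).
have key n (lam : R) : 0 < lam -> W <= (K + K') / lam + 2 * lam * int_mu mu (field_inner (rest n) (rest n)).
  move=> lam0.
  (* The linear combination with coefficients -1 and 0 is the opposite of [rest n]: the available
     bounds are one-sided, and the term in E' enters with a minus sign. *)
  have WE : W = int_E E (rest n) + int_E E' (field_lincomb (-1) 0 (rest n) (rest n)).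
    rewrite /W (int_E_lincomb E' _ _ (@within_rest n) (@within_rest n)) /rest.
    rewrite !(int_E_lincomb _ _ _ cg (cgn n)).
    have := weak_div_cutoff_field n CE; have := weak_div_cutoff_field n CE'.
    rewrite /weak_div.
    move: (int_mu mu (div_src (cutoff_field n))) (int_mu mu (div_src phi)).
    move: (int_E E (grad_tgt phi)) (int_E E' (grad_tgt phi)).
    move: (int_E E (grad_tgt (cutoff_field n))) (int_E E' (grad_tgt (cutoff_field n))).
    clear; move=> x1 x2 x3 x4 x5 x6; lra.
  have h1 := hK _ _ (@within_rest n) lam0.
  have h2 := hK' _ _ (@within_field_lincomb _ (-1) 0 _ _ (@within_rest n) (@within_rest n)) lam0.
  rewrite WE; apply: le_trans (lerD h1 h2) _.
  have -> : int_mu mu (field_inner (field_lincomb (-1) 0 (rest n) (rest n)) (field_lincomb (-1) 0 (rest n) (rest n))) =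
      int_mu mu (field_inner (rest n) (rest n)).
    apply: int_mu_eq => z _; apply: eq_bigr => alpha _; apply: eq_bigr => i _.
    by rewrite /field_lincomb; ring.
  by move: (int_mu mu _) => x; rewrite le_eqVlt; apply/orP; left; apply/eqP; ring.
(* With this [lam] the term in K + K' is below W/2; then n is taken so large that the quadratic term
   is below W/2 as well. *)
pose lam := 2 * (`|K + K'| + 1) / W.
have lam0 : 0 < lam by rewrite divr_gt0// mulr_gt0// ltr_wpDl.
have lamE : W * lam = 2 * (`|K + K'| + 1) by rewrite /lam mulrC divfK// gt_eqF.
clearbody lam W.
have small : \forall n \near \oo, int_mu mu (field_inner (rest n) (rest n)) < W / (4 * lam).
  by move/cvgr_lt : rest_cvg; apply; rewrite divr_gt0// mulr_gt0.
have [n hn] : exists n, int_mu mu (field_inner (rest n) (rest n)) < W / (4 * lam).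
  by have [n _ /(_ n (leqnn n))] := small; exists n.
have := key n lam lam0; apply/negP; rewrite -ltNge.
move: hn; move: (int_mu mu _) => x hn.
have h1 : 2 * lam * x < W / 2.
  by move: hn; rewrite ltr_pdivlMr ?mulr_gt0// => hn; lra.
have h2 : (K + K') / lam < W / 2.
  rewrite ltr_pdivrMr//; have := ler_norm (K + K').
  by rewrite mulrAC lamE; lra.
by lra.
Qed.

End cutoff_field.

Lemma BT_weak_div E phi : (forall alpha, C1 (phi alpha)) ->
  continuity_equation mu E -> (Dir_pair mu E < +oo)%E -> BT mu phi = weak_div mu phi E.
Proof.
move=> Cphi CE DE; rewrite /BT; case: xgetP => [y -> [E' [CE' DE' ->]]|/(_ (weak_div mu phi E))].
  by apply/eqP; rewrite eq_le !weak_div_le.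
by case; exists E.
Qed.

End independence.

Lemma exists_admissible (R : realType) (mu : plane R -> probability (plane R) R) :
  (Dir mu < +oo)%E -> exists2 E, continuity_equation mu E & (Dir_pair mu E < +oo)%E.
Proof. by move=> /ereal_inf_lt[_ [E CE <-] EDir]; exists E. Qed.

(** * Decay of the weighted residual *)

Section test_field.
Context {R : realType}.
Implicit Types (v z : plane2 R).

Definition residual z : R := sqnorm (csqr z.2 - z.1).

Lemma residualE z : residual z =
  (z.2.1 ^+ 2 - z.2.2 ^+ 2 - z.1.1) ^+ 2 + (2 * z.2.1 * z.2.2 - z.1.2) ^+ 2.
Proof. by rewrite /residual sqnormE. Qed.

Lemma residual_ge0 z : 0 <= residual z. Proof. exact: sqnorm_ge0. Qed.

Let residual' v z : R :=
  2 * (z.2.1 ^+ 2 - z.2.2 ^+ 2 - z.1.1) * (2 * z.2.1 * v.2.1 - 2 * z.2.2 * v.2.2 - v.1.1) +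
  2 * (2 * z.2.1 * z.2.2 - z.1.2) * (2 * z.2.1 * v.2.2 + 2 * z.2.2 * v.2.1 - v.1.2).

Let C1d_residual : C1d residual residual'.
Proof.
have x1 : C1d (fun z => z.2.1) (fun v _ => v.2.1 : R) := C1d_tgt ord0.
have x2 : C1d (fun z => z.2.2) (fun v _ => v.2.2 : R) := C1d_tgt (lift ord0 ord0).
have y1 : C1d (fun z => z.1.1) (fun v _ => v.1.1 : R) := C1d_src ord0.
have y2 : C1d (fun z => z.1.2) (fun v _ => v.1.2 : R) := C1d_src (lift ord0 ord0).
have h1 := C1d_add (C1d_add (C1d_exprn 2 x1) (C1d_opp (C1d_exprn 2 x2))) (C1d_opp y1).
have h2 := C1d_add (C1d_mul (C1d_mul (C1d_cst 2) x1) x2) (C1d_opp y2).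
apply: C1d_ext (C1d_add (C1d_exprn 2 h1) (C1d_exprn 2 h2)) => [z|v z]; first by rewrite residualE.
rewrite /residual' /=; ring.
Qed.

(* The radial weight kills the field inside the disk as [N] grows; on the circle the field is normal
   and vanishes on the square roots. *)
Definition test_field N (alpha : 'I_2) z : R := sqnorm z.1 ^+ N * coord alpha z.1 * residual z.

Let C1d_test_field N alpha : C1d (test_field N alpha) (fun v z =>
  (N%:R * sqnorm z.1 ^+ N.-1 * (2 * z.1.1 * v.1.1 + 2 * z.1.2 * v.1.2) * coord alpha z.1 +
   sqnorm z.1 ^+ N * coord alpha v.1) * residual z + sqnorm z.1 ^+ N * coord alpha z.1 * residual' v z).
Proof.
have y1 : C1d (fun z => z.1.1) (fun v _ => v.1.1 : R) := C1d_src ord0.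
have y2 : C1d (fun z => z.1.2) (fun v _ => v.1.2 : R) := C1d_src (lift ord0 ord0).
have s := C1d_add (C1d_exprn 2 y1) (C1d_exprn 2 y2).
apply: C1d_ext (C1d_mul (C1d_mul (C1d_exprn N s) (C1d_src alpha)) C1d_residual) => [z|v z].
  by rewrite /test_field sqnormE.
by rewrite sqnormE /= !expr1.
Qed.

Lemma C1_test_field N alpha : C1 (test_field N alpha).
Proof. exact: C1d_C1 (C1d_test_field N alpha). Qed.

(** The divergence of |xi|^(2N) xi is (2N + 2) |xi|^(2N), and the last term is the derivative of the
    residual along xi. The main term is N times the quantity to be estimated. *)
Lemma div_src_test_field N z : div_src (test_field N) z = sqnorm z.1 ^+ N *
  ((2 * N%:R + 2) * residual z - 2 * (z.1.1 * (z.2.1 ^+ 2 - z.2.2 ^+ 2 - z.1.1) + z.1.2 * (2 * z.2.1 * z.2.2 - z.1.2))).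
Proof.
rewrite /div_src !big_ord_recl big_ord0 addr0.
have D alpha v : 'D_v (test_field N alpha) z = _ := let: And3 _ H _ := C1d_test_field N alpha in H v z.
rewrite !D /residual' /coord /basis /= {D}.
case: N => [|N]; first by rewrite !expr0 !mul0r !mulr0; ring.
rewrite /= exprS; move: (sqnorm z.1 ^+ N) => w; rewrite sqnormE -natr1; ring.
Qed.

Definition tgt_factor (alpha i : 'I_2) z : R := coord alpha z.1 * residual' (0, basis i) z.

Lemma grad_tgt_test_field N alpha i z :
  grad_tgt (test_field N) alpha i z = sqnorm z.1 ^+ N * tgt_factor alpha i z.
Proof.
have D v : 'D_v (test_field N alpha) z = _ := let: And3 _ H _ := C1d_test_field N alpha in H v z.
rewrite /grad_tgt D /tgt_factor /=.
have -> : coord alpha (0 : plane R) = 0 by rewrite /coord; case: ifP.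
by rewrite !(mulr0, mul0r, addr0, add0r) mulrA.
Qed.

(** The gradient of |x^2 - xi|^2 in x has norm 4 |x| |x^2 - xi|; the sum is therefore 16 |xi|^2
    |x|^2 times the residual. Control by the residual itself is what allows the absorption in
    [residual_estimate]. *)
Lemma tgt_factor_norm z : (disk `*` disk) z ->
  \sum_(alpha < 2) \sum_(i < 2) tgt_factor alpha i z ^+ 2 <= 16 * residual z.
Proof.
move=> [d1 d2]; rewrite !big_ord_recl !big_ord0 /tgt_factor /coord /basis /residual' /=.
have -> : forall a b c d : R, a ^+ 2 + (b ^+ 2 + 0) + (c ^+ 2 + (d ^+ 2 + 0) + 0) = a ^+ 2 + b ^+ 2 + (c ^+ 2 + d ^+ 2).
  by move=> *; rewrite ?addr0; ring.
apply: (@le_trans _ _ (16 * residual z * (sqnorm z.1 * sqnorm z.2))).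
  by rewrite residualE !sqnormE le_eqVlt; apply/orP; left; apply/eqP; ring.
rewrite ler_piMr ?mulr_ge0 ?residual_ge0//.
by apply: mulr_ile1; rewrite ?sqnorm_ge0.
Qed.

Lemma test_field_boundary N (t : R) (xi := (cos t, sin t) : plane R) :
  \int[mu_s xi]_(x in disk) (\sum_(alpha < 2) test_field N alpha (xi, x) * coord alpha xi) = 0.
Proof.
transitivity (fine 0%E : R) => //; congr fine.
rewrite -[RHS](@integral0 _ _ R (mu_s xi) disk); apply: ae_eq_integral => //.
- exact: measurable_disk.
- apply/measurable_EFinP; apply: continuous_measurable_plane; first exact: measurable_disk.
  apply: continuous_subspaceT => x; under eq_fun do rewrite !big_ord_recl big_ord0 addr0.
  have cp alpha : continuous (fun x => test_field N alpha (xi, x)).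
    move=> y; apply: (@continuous_comp (plane R) (plane2 R) R (fun x => (xi, x)) (test_field N alpha)).
      by apply: (cvg_pair (F:=nbhs y) (G:=nbhs xi) (H:=nbhs y)); [exact: cvg_cst|exact: cvg_id].
    exact: (C1d_continuous (C1d_test_field N alpha)).
  by apply: cvgD; apply: cvgM; (exact: cp || exact: cvg_cst).
- exists (~` sqroots xi); split.
  + apply: measurableC; apply: countable_measurable; last exact: (finite_set_countable (finite_sqroots xi)).
    move=> [a b]; rewrite (_ : [set (a, b)] = [set a] `*` [set b] :> set (plane R)); first exact: measurableX.
    by apply/seteqP; split => [x ->|[x y] [/= -> ->]].
  + rewrite /= /mu_s fsbig1 ?mule0// => z hz.
    by rewrite diracE memNset//= => /(_ hz).
  + move=> x /= /not_implyP[_ h] hx; apply: h.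
    rewrite big1// => alpha _; rewrite /test_field /residual /= hx subrr.
    by rewrite [sqnorm 0]sqnormE/= expr0n addr0 mulr0 mul0r.
Qed.

End test_field.

Section residual_decay.
Context {R : realType}.
Local Notation D := (@disk R `*` @disk R).
Variable mu : plane R -> probability (plane R) R.
Variable Q : probability (g_sigma_algebraType (@L2_open R)) R.
Hypothesis repr : forall a : plane2 R -> R, {within D, continuous a} ->
  int_mu mu a = \int[Q]_(F in setT) \int[lebesgue2]_(xi in disk) a (xi, L2_fun F xi).
Hypothesis mu_boundary : boundary_values mu (fun xi : plane R => mu_s xi).
Hypothesis mu_Dir : (Dir mu < +oo)%E.

Definition weighted_residual N (z : plane2 R) : R := sqnorm z.1 ^+ N * residual z.

Lemma continuous_residual : continuous (@residual R).
Proof.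
have cs : continuous (fun z : plane2 R => csqr z.2 - z.1).
  have c1 : continuous (fun z : plane2 R => z.2.1 ^+ 2 - z.2.2 ^+ 2 - z.1.1).
    have h i := C1d_continuous (C1d_exprn 2 (@C1d_tgt R i)).
    move=> z; apply: cvgB; first apply: cvgB.
    - exact: (h ord0).
    - exact: (h (lift ord0 ord0)).
    - exact: (C1d_continuous (@C1d_src R ord0)).
  have c2 : continuous (fun z : plane2 R => 2 * z.2.1 * z.2.2 - z.1.2).
    move=> z; apply: cvgB; first apply: cvgM; first apply: cvgM.
    - exact: cvg_cst.
    - exact: (C1d_continuous (@C1d_tgt R ord0)).
    - exact: (C1d_continuous (@C1d_tgt R (lift ord0 ord0))).
    - exact: (C1d_continuous (@C1d_src R (lift ord0 ord0))).
  move=> z; apply: (cvg_pair (F:=nbhs z) (G:=nbhs _) (H:=nbhs _)); [exact: c1|exact: c2].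
by move=> z; apply: continuous_comp; [exact: cs|exact: continuous_sqnorm].
Qed.

Lemma continuous_weight N : continuous (fun xi : plane R => sqnorm xi ^+ N).
Proof.
move=> xi; apply: (@continuous_comp _ _ _ (@sqnorm R) (fun x => x ^+ N)).
  exact: continuous_sqnorm.
exact: exprn_continuous.
Qed.

Lemma within_weight N : {within D, continuous (fun z : plane2 R => sqnorm z.1 ^+ N)}.
Proof.
apply: continuous_subspaceT => z.
by apply: (@continuous_comp _ _ _ fst (fun xi : plane R => sqnorm xi ^+ N)); [exact: cvg_fst|exact: continuous_weight].
Qed.

Lemma within_weighted_residual N : {within D, continuous (weighted_residual N)}.
Proof.
apply: within_mul; first exact: within_weight.
by apply: continuous_subspaceT; exact: continuous_residual.
Qed.

Lemma young (l a b : R) : 0 < l -> a * b <= l * b ^+ 2 + (4 * l)^-1 * a ^+ 2.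
Proof.
move=> l0; rewrite -(ler_pM2l (_ : 0 < 4 * l)) ?mulr_gt0// mulrDr mulVKf ?mulf_neq0 ?gt_eqF//.
by have := sqr_ge0 (a - 2 * l * b); nra.
Qed.

(** By the boundary condition the integral of the divergence, of order 2N times the weighted
    residual, equals the action of E on minus the target gradient, which [near_optimal] bounds. The
    bound of [int_E_quadratic_bound] would only keep N^2 times the residual bounded; here the error
    is a multiple of e. [C] depends on e through [b0], but it multiplies an integral that tends to
    0. *)
Lemma residual_estimate (e : R) : 0 < e -> exists C : R, forall N, (0 < N)%N ->
  N%:R ^+ 2 * int_mu mu (weighted_residual N) <= C * \int[leb2]_(xi in disk) (sqnorm xi ^+ N) + 32 * e.
Proof.
move=> e0; have [E CE DE] := exists_admissible mu_Dir.
have [b0 cb0 near] := near_optimal repr DE e0.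
have [K hK] := bounded_disk2 (within_field_inner cb0 cb0).
exists (4 + 16 * K) => N N0; pose n : R := N%:R.
have n0 : 0 < n by rewrite ltr0n.
have Cphi := @C1_test_field R N.
have B0 : weak_div mu (test_field N) E = 0.
  rewrite -(BT_weak_div repr Cphi CE DE) mu_boundary//.
  under eq_Rintegral do rewrite /= test_field_boundary.
  by rewrite /Rintegral integral0.
pose g := grad_tgt (test_field N) : 'I_2 -> 'I_2 -> plane2 R -> R.
have cg : within_field g by exact: continuous_within_field.
pose b := field_lincomb (-1) 0 g g.
have cb : within_field b by exact: within_field_lincomb.
have cdiv : {within D, continuous (div_src (@test_field R N))}.
  apply: continuous_subspaceT => z; rewrite /div_src; under eq_fun do rewrite !big_ord_recl big_ord0 addr0.
  by apply: cvgD; exact: (Cphi _).2.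
have c0b := within_field_inner cb0 cb; have cbb := within_field_inner cb cb.
have cw := @within_weight N; have cr := @within_weighted_residual N.
(* With lam = n / 32 the quadratic term is n / 64 times the squared gradient, hence at most n / 4
   times the weighted residual, and e / lam becomes 32 e after multiplication by n. *)
have n320 : 0 < n / 32 by rewrite divr_gt0.
have Eb : int_E E b = int_mu mu (div_src (test_field N)).
  rewrite (int_E_lincomb E _ _ cg cg); move: B0; rewrite /weak_div -/g.
  by move: (int_mu _ _) (int_E _ _) => x y h; lra.
have := near b _ cb n320; rewrite Eb.
have : int_mu mu (fun z => n * weighted_residual N z + (- ((4 + 16 * K) / n)) * sqnorm z.1 ^+ N) <=
  int_mu mu (fun z => 1 * div_src (test_field N) z + (-1) * (1 * field_inner b0 b z + n / 32 / 2 * field_inner b b z)).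
  apply: (int_mu_le repr); [exact: within_lincomb|apply: within_lincomb => //; exact: within_lincomb|].
  move=> z Dz; rewrite div_src_test_field /weighted_residual.
  have [d1 d2] := Dz.
  have w0 : 0 <= sqnorm z.1 ^+ N by rewrite exprn_ge0// sqnorm_ge0.
  have w1 : sqnorm z.1 ^+ N <= 1 by rewrite exprn_ile1// sqnorm_ge0.
  have Ebb : field_inner b b z = (sqnorm z.1 ^+ N) ^+ 2 * \sum_(alpha < 2) \sum_(i < 2) tgt_factor alpha i z ^+ 2.
    rewrite mulr_sumr; apply: eq_bigr => alpha _; rewrite mulr_sumr; apply: eq_bigr => i _.
    rewrite /b /field_lincomb /g grad_tgt_test_field; ring.
  have E0b : field_inner b0 b z = sqnorm z.1 ^+ N * \sum_(alpha < 2) \sum_(i < 2) (- b0 alpha i z) * tgt_factor alpha i z.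
    rewrite mulr_sumr; apply: eq_bigr => alpha _; rewrite mulr_sumr; apply: eq_bigr => i _.
    rewrite /b /field_lincomb /g grad_tgt_test_field; ring.
  have S16 := tgt_factor_norm Dz.
  have P : field_inner b0 b0 z <= K by rewrite (le_trans (ler_norm _))// hK.
  (* The weight n / 64 makes this cross term, like the quadratic one and the term [q] below, cost n
     / 4 times the residual. Together they use 3 n / 4 out of 2 n, so at least n times the residual
     is left. *)
  have T : \sum_(alpha < 2) \sum_(i < 2) (- b0 alpha i z) * tgt_factor alpha i z <=
      n / 64 * (\sum_(alpha < 2) \sum_(i < 2) tgt_factor alpha i z ^+ 2) + 16 / n * field_inner b0 b0 z.
    rewrite /field_inner !mulr_sumr -big_split; apply: ler_sum => alpha _.
    rewrite /= !mulr_sumr -big_split; apply: ler_sum => i _ /=.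
    apply: le_trans (young _ _ (_ : 0 < n / 64)) _; first by rewrite divr_gt0.
    by rewrite sqrrN expr2 lerD2l le_eqVlt; apply/orP; left; apply/eqP; field; rewrite gt_eqF.
  have q : 2 * (z.1.1 * (z.2.1 ^+ 2 - z.2.2 ^+ 2 - z.1.1) + z.1.2 * (2 * z.2.1 * z.2.2 - z.1.2)) <=
      n / 4 * residual z + 4 / n.
    rewrite residualE; move: (_ - z.1.1) (_ - z.1.2) => h0 h1.
    have n80 : 0 < n / 8 by rewrite divr_gt0.
    have := young z.1.1 h0 n80; have := young z.1.2 h1 n80.
    have -> : (4 * (n / 8))^-1 = 2 / n by field; rewrite gt_eqF.
    move: d1; rewrite /disk/= sqnormE => d1.
    have : 2 / n * (z.1.1 ^+ 2 + z.1.2 ^+ 2) <= 2 / n * 1 by rewrite ler_wpM2l// divr_ge0// ltW.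
    have -> : 4 / n = 2 * (2 / n) by field; rewrite gt_eqF.
    by move: (2 / n) => m; lra.
  rewrite Ebb E0b; move: S16 T q P w0 w1 (residual_ge0 z).
  move: (sqnorm z.1 ^+ N) (residual z) (field_inner b0 b0 z) => w H p.
  move: (\sum_(alpha < 2) \sum_(i < 2) (- b0 alpha i z) * _) (\sum_(alpha < 2) \sum_(i < 2) _) => T S.
  move: (2 * (z.1.1 * _ + _)) => q.
  move=> S16 hT hq hP w0 w1 H0.
  have hm : 16 / n * p <= 16 / n * K by rewrite ler_wpM2l// divr_ge0// ltW.
  have hS : n / 64 * S <= n / 4 * H.
    have n64 : 0 <= n / 64 by rewrite divr_ge0// ltW.
    by have := ler_wpM2l n64 S16; lra.
  have hCn : (4 + 16 * K) / n = 4 / n + 16 / n * K by field; rewrite gt_eqF.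
  have nH : 0 <= n * H by rewrite mulr_ge0// ltW.
  have key : n * H - (4 + 16 * K) / n <= (2 * n + 2) * H - q - T - n / 4 * H.
    by rewrite hCn; lra.
  have w2 : w ^+ 2 * (n / 64 * S) <= w * (n / 4 * H).
    apply: (@le_trans _ _ (w ^+ 2 * (n / 4 * H))); first by rewrite ler_wpM2l ?sqr_ge0.
    by apply: ler_wpM2r; [lra|rewrite expr2 ler_piMl].
  have := ler_wpM2l w0 key; move: w2; move: ((4 + 16 * K) / n) => c; lra.
have vE : int_mu mu (fun z => sqnorm z.1 ^+ N) = \int[leb2]_(xi in disk) (sqnorm xi ^+ N).
  exact: (int_mu_src repr (@continuous_weight N)).
have c2 : {within D, continuous (fun z => 1 * field_inner b0 b z + n / 32 / 2 * field_inner b b z)}.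
  exact: within_lincomb.
rewrite (int_mu_lincomb repr n _ cr cw) (int_mu_lincomb repr 1 (-1) cdiv c2).
rewrite (int_mu_lincomb repr 1 _ c0b cbb) vE.
move: (int_mu mu (field_inner b0 b)) (int_mu mu (field_inner b b)) (int_mu mu (div_src _)) => x y u.
move: (int_mu mu _) (\int[leb2]_(xi in disk) _) => Psi v h1 h2.
have h3 : n * Psi <= (4 + 16 * K) / n * v + e / (n / 32) by move: h1 h2; clear; lra.
have := ler_wpM2l (ltW n0) h3.
have -> : n * ((4 + 16 * K) / n * v + e / (n / 32)) = (4 + 16 * K) * v + 32 * e by field; rewrite gt_eqF.
by rewrite mulrA -expr2.
Qed.

Lemma weight_cvg0 : \int[leb2]_(xi in @disk R) (sqnorm xi ^+ N) @[N --> \oo] --> (0 : R).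
Proof.
have i1 : leb2.-integrable disk (EFin \o (fun=> 1 : R)).
  by apply: integrable_cst_lty; [exact: measurable_disk|exact: leb2_disk_fin].
have := radial_weight_cvg0 i1; under eq_fun do under eq_integral do rewrite mulr1.
by move=> h; exact: (@fine_cvg _ _ _ _ _ 0).
Qed.

Lemma weighted_residual_cvg0 : N%:R ^+ 2 * int_mu mu (weighted_residual N) @[N --> \oo] --> (0 : R).
Proof.
apply/cvgrPdist_lt => /= e e0.
(* 32 times e / 64 is one half of the error allowed; the other half is for the integral of the
   weight. *)
have e64 : 0 < e / 64 by rewrite divr_gt0.
have [C hC] := residual_estimate e64.
have Cv : C * \int[leb2]_(xi in disk) (sqnorm xi ^+ N) @[N --> \oo] --> (0 : R).
  by rewrite -[X in _ --> X](mulr0 C); apply: cvgM; [exact: cvg_cst|exact: weight_cvg0].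
have e2 : 0 < e / 2 by rewrite divr_gt0.
have near := (cvgr_lt _ Cv) _ e2.
near=> N.
have N0 : (0 < N)%N by near: N; exact: nbhs_infty_gt.
have v0 : C * \int[leb2]_(xi in disk) (sqnorm xi ^+ N) < e / 2 by near: N; exact: near.
rewrite sub0r normrN ger0_norm; last first.
  rewrite mulr_ge0 ?sqr_ge0//; apply: int_mu_ge0 => z _.
  by rewrite mulr_ge0 ?residual_ge0// exprn_ge0// sqnorm_ge0.
apply: le_lt_trans (hC N N0) _.
by rewrite -ltrBrDr; apply: lt_le_trans v0 _; lra.
Unshelve. all: by end_near. Qed.

End residual_decay.

(** The integral of a nonnegative function is a supremum over the simple functions below it, hence
    monotone without measurability. This is what permits a lower bound on the integral of [Dir_c]
    with no study of its measurability. *)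
Lemma ge0_le_integral_nonmeasurable d (T : measurableType d) (R : realType)
    (m : {measure set T -> \bar R}) (f g : T -> \bar R) :
  (forall x, (0 <= f x)%E) -> (forall x, (f x <= g x)%E) ->
  (\int[m]_x f x <= \int[m]_x g x)%E.
Proof.
move=> f0 fg; rewrite !ge0_integralTE//; last by move=> x; exact: le_trans (fg x).
apply: le_ereal_sup => _ [h /= hf <-]; exists h => // x.
exact: le_trans (hf x) (fg x).
Qed.

(** * Almost every map of a superposition has infinite energy *)

Section conclusion.
Context {R : realType}.
Local Notation D := (@disk R `*` @disk R).
Variable mu : plane R -> probability (plane R) R.
Variable Q : probability (g_sigma_algebraType (@L2_open R)) R.
Hypothesis repr : forall a : plane2 R -> R, {within D, continuous a} ->
  int_mu mu a = \int[Q]_(F in setT) \int[lebesgue2]_(xi in disk) a (xi, L2_fun F xi).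
Hypothesis mu_boundary : boundary_values mu (fun xi : plane R => mu_s xi).
Hypothesis mu_Dir : (Dir mu < +oo)%E.

Let energy N (F : g_sigma_algebraType (@L2_open R)) : R :=
  N%:R ^+ 2 * graph_int (weighted_residual N \_ D) F.

Let energy_ge0 N F : 0 <= energy N F.
Proof.
rewrite mulr_ge0 ?sqr_ge0//; apply: Rintegral_ge0 => xi _; rewrite patchE; case: ifP => // _.
by rewrite mulr_ge0 ?residual_ge0// exprn_ge0// sqnorm_ge0.
Qed.

Let measurable_energy N : measurable_fun setT (energy N).
Proof.
apply: measurable_funM; first exact: measurable_cst.
exact: measurable_graph_int (@within_weighted_residual R N).
Qed.

(** These sets are measurable, and for the constant of [L2_energy] their countable union over [N0]
    contains every class of maps in H^1. The index [N0] accounts for the threshold that varies with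
    the map. *)
Let large_energy (c : R) N0 : set (g_sigma_algebraType (@L2_open R)) :=
  \bigcap_(N in [set N | (N0 <= N)%N]) [set F | c <= energy N F].

Let measurable_large_energy c N0 : measurable (large_energy c N0).
Proof.
apply: bigcap_measurableType => N _.
rewrite (_ : [set F | _] = setT `&` energy N @^-1` `[c, +oo[%classic).
  exact: measurable_energy.
by rewrite setTI; apply/seteqP; split => F; rewrite /= in_itv/= andbT.
Qed.

Lemma large_energy_null (c : R) N0 : 0 < c ->
  Q (large_energy c N0) = 0%E.
Proof.
move=> c0; set B := large_energy c N0; have mB : measurable B by exact: measurable_large_energy.
have QB N : (N0 <= N)%N -> c * fine (Q B) <= N%:R ^+ 2 * int_mu mu (weighted_residual N).
  move=> N0N; have ig := integrable_graph_int Q (@within_weighted_residual R N).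
  rewrite (int_muE repr (@within_weighted_residual R N)) -(RintegralZl _ measurableT ig).
  rewrite -lee_fin EFinM fineK ?fin_num_measure// EFin_Rintegral//; last exact: integrableZR.
  rewrite -[in X in (X <= _)%E](setIT B) -(integral_indic Q measurableT mB) -ge0_integralZl//=; last 2 first.
  - by apply/measurable_EFinP; exact: measurable_indic.
  - by rewrite lee_fin ltW.
  apply: ge0_le_integral => //.
  - by move=> F _; rewrite -EFinM lee_fin mulr_ge0// ltW.
  - by apply/measurable_EFinP; apply: measurable_funM => //; exact: measurable_indic.
  - by apply/measurable_EFinP; exact: measurable_energy.
  - move=> F _; rewrite -EFinM lee_fin indicE; case: (boolP (F \in B)) => FB; last by rewrite mulr0 energy_ge0.
    by rewrite mulr1; exact: (set_mem FB).
have le0 : c * fine (Q B) <= 0.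
  apply: (cvgr_to_ge (weighted_residual_cvg0 repr mu_boundary mu_Dir)).
  by exists N0 => // N /= /QB.
apply/eqP; rewrite eq_le measure_ge0 andbT -[Q B]fineK ?fin_num_measure// lee_fin.
by rewrite -(ler_pM2l c0) mulr0.
Qed.

Lemma graph_int_weighted_residual N (F : @L2_disk R) : graph_int (weighted_residual N \_ D) F =
  \int[leb2]_(z in disk) (sqnorm z ^+ N * defect (L2_fun F) z).
Proof.
have cr := @within_weighted_residual R N.
congr fine; apply: ae_eq_integral.
- exact: measurable_disk.
- exact: (measurable_int _ (integrable_graph F (meas_bounded_restrict cr))).
- apply/measurable_EFinP; apply: measurable_funTS.
  apply: (measurableT_comp (f := weighted_residual N) _ (measurable_graph F)).
  apply: continuous_measurable_plane2 => //; apply: continuous_subspaceT => z.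
  apply: cvgM; last exact: continuous_residual.
  by apply: (@continuous_comp _ _ _ fst (fun xi : plane R => sqnorm xi ^+ N)); [exact: cvg_fst|exact: continuous_weight].
- apply: filterS (L2_fun_disk F) => z h dz; rewrite patchE mem_set//.
  by split => //=; exact: h.
Qed.

Lemma Dir_c_ge0 (F : @L2_disk R) : (0 <= Dir_c F)%E.
Proof.
rewrite /Dir_c; case: ifP => // _; apply: integral_ge0 => xi _; rewrite lee_fin.
by rewrite mulr_ge0//; do 2!apply: sumr_ge0 => ? _; exact: sqr_ge0.
Qed.

(** Outside a null set containing all the [large_energy] sets, no map is in H^1, and [Dir_c] takes
    the value that it has there by definition. *)
Lemma integral_Dir_c : (\int[Q]_(F in setT) Dir_c F = +oo)%E.
Proof.
have [c c0 hc] := @L2_energy R.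
have [A [mA QA BA]] : Q.-negligible (\bigcup_N0 large_energy c N0).
  by apply: negligible_bigcup => N0; apply/negligibleP; [exact: measurable_large_energy|exact: large_energy_null].
have mAC : measurable (~` A) by exact: measurableC.
have QAC : Q (~` A) = 1%E by rewrite probability_setC// QA sube0.
have Dir_oo F : (~` A) F -> Dir_c F = +oo%E.
  move=> AF; rewrite /Dir_c; case: ifPn => // /asboolP /hc[N0 hN0]; exfalso; apply: AF.
  by apply: BA; exists N0 => // N /= /hN0; rewrite /energy graph_int_weighted_residual.
(* Every real r is a lower bound: r times the indicator of a set of full measure is below
   [Dir_c]. *)
apply/eqyP => r r0.
have -> : r%:E = (\int[Q]_F (r%:E * (\1_(~` A) F : R)%:E))%E.
  rewrite ge0_integralZl//; last 2 first.
  - by apply/measurable_EFinP; exact: measurable_indic.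
  - by rewrite lee_fin ltW.
  by rewrite integral_indic// setIT [X in (_ * X)%E]QAC mule1.
apply: ge0_le_integral_nonmeasurable => F.
  by rewrite -EFinM lee_fin mulr_ge0// ltW.
rewrite indicE; case: (boolP (F \in ~` A)) => [/set_mem/Dir_oo ->|_]; first exact: leey.
by rewrite mule0; exact: Dir_c_ge0.
Qed.

End conclusion.

Theorem proposition5p5 (R : realType)
    (mu : plane R -> probability (plane R) R)
    (mu_H1 : H1_Pdisk mu)
    (mu_boundary : boundary_values mu (fun xi : plane R => mu_s xi)) :
  ~ superposition mu.
Proof.
move=> [Q [repr ineq]]; have [_ Dir_lty] := mu_H1.
by move: ineq; rewrite (integral_Dir_c repr)// leye_eq => /eqP E; rewrite E ltxx in Dir_lty.
Qed.
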